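(* Let $K\subset\mathbb{R}^n$ be a non-trivial closed convex cone, $G\in\mathbb{R}^{m\times n}$ a standard Gaussian matrix, and $L\equiv\{x\in\mathbb{R}^m: x_{\ell+1}=\dots=x_m=0\}$ for an integer $\ell$ with $\max\{1,(m-\delta(K))_+\}\le\ell\le m$. Assume there is $\tau\in(0,1/2)$ with $m-\ell\le(1-\tau)\delta(K)$. Then there is a constant $c=c(\tau)>0$ such that for every $\epsilon\in(0,1/2)$ and every integer $k$ with $1\le k\le\min\{\ell,\,c\,\mathscr{L}(\epsilon^2\delta(K))\}$, with probability at least $1-\exp(-c\epsilon^2\delta(K))$, $$(1-\epsilon)B_k\big(\sqrt{\delta(K)-m+\ell}\big)\subset\Pi_{m\to k}\big(L\cap GK_n\big)\subset(1+\epsilon)B_k\big(\sqrt{\delta(K)-m+\ell}\big).$$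
   Context: A standard Gaussian matrix has i.i.d. $\mathcal{N}(0,1)$ entries. $B_n$ is the closed Euclidean unit ball of $\mathbb{R}^n$, $K_n\equiv K\cap B_n$, $GK_n\equiv\{G\mu:\mu\in K_n\}$, $B_k(r)$ is the closed Euclidean ball of radius $r$ centered at $0$ in $\mathbb{R}^k$, $\Pi_{m\to k}:\mathbb{R}^m\to\mathbb{R}^k$ is the projection onto the first $k$ coordinates, and $\mathscr{L}(x)\equiv x/\log(e\vee(1/x))$. $a_+=\max(a,0)$. A closed convex cone is non-trivial if it is not $\{0\}$. $\delta(K)\equiv\mathbb{E}\|\Pi_K(g)\|^2$ with $g\sim\mathcal{N}(0,I_n)$, where $\Pi_K$ is the Euclidean metric projection onto $K$. *)

(* Defs.v *)
From HB Require Import structures.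
From mathcomp Require Import all_boot all_order all_algebra.
From mathcomp Require Import all_classical all_reals all_analysis.
Set Implicit Arguments. Unset Strict Implicit. Unset Printing Implicit Defensive.
Import Order.TTheory GRing.Theory Num.Theory.
Import numFieldNormedType.Exports.
Local Open Scope classical_set_scope.
Local Open Scope ring_scope.

Section Defs.
Variable R : realType.

Definition enorm (n : nat) (x : 'cV[R]_n) : R := Num.sqrt (\sum_(i < n) x i 0 ^+ 2).

Definition eball (n : nat) (r : R) : set 'cV[R]_n := [set x | enorm x <= r].

Definition is_cone (n : nat) (K : set 'cV[R]_n) : Prop :=
  K 0 /\ forall x, K x -> forall t : R, 0 <= t -> K (t *: x).
Definition is_convex_set (n : nat) (K : set 'cV[R]_n) : Prop :=
  forall x y, K x -> K y -> forall t : R, 0 <= t <= 1 -> K (t *: x + (1 - t) *: y).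
Definition nontrivial_closed_convex_cone (n : nat) (K : set 'cV[R]_n) : Prop :=
  closed K /\ is_cone K /\ is_convex_set K /\ K <> [set 0].

Definition metric_proj (n : nat) (K : set 'cV[R]_n) (x : 'cV[R]_n) : 'cV[R]_n :=
  xget 0 [set y | K y /\ forall z, K z -> enorm (x - y) <= enorm (x - z)].

Definition std_gaussian_matrix (d : measure_display) (T : measurableType d)
    (P : probability T R) (m n : nat) (G : T -> 'M[R]_(m, n)) : Prop :=
  (forall i j, measurable_fun setT (fun w => G w i j)) /\
  (forall i j (B : set R), measurable B ->
      P ((fun w => G w i j) @^-1` B) = normal_prob 0 1 B) /\
  (forall B : 'I_m -> 'I_n -> set R, (forall i j, measurable (B i j)) ->
      P [set w | forall i j, B i j (G w i j)] =
      (\prod_(i < m) \prod_(j < n) P ((fun w => G w i j) @^-1` B i j))%E).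

(* delta(K) = E ||Pi_K(g)||^2 for a standard Gaussian vector g (an n x 1 Gaussian matrix) *)
Definition stat_dim (d : measure_display) (T : measurableType d)
    (P : probability T R) (n : nat) (K : set 'cV[R]_n) (g : T -> 'cV[R]_n) : R :=
  fine (\int[P]_w ((enorm (metric_proj K (g w)) ^+ 2)%:E)).

Definition scrL (x : R) : R := x / ln (Num.max (expR 1) x^-1).

(* L = {x in R^m : x_{l+1} = ... = x_m = 0} (0-based indices l..m-1 vanish) *)
Definition coordL (m l : nat) : set 'cV[R]_m := [set x | forall i : 'I_m, (l <= i)%N -> x i 0 = 0].

Definition GKn (m n : nat) (G : 'M[R]_(m, n)) (K : set 'cV[R]_n) : set 'cV[R]_m :=
  [set G *m mu | mu in K `&` @eball n 1].

Definition coord_nat (m : nat) (x : 'cV[R]_m) (i : nat) : R :=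
  oapp (fun j : 'I_m => x j 0) 0 (insub i).
Definition proj_first (m k : nat) (x : 'cV[R]_m) : 'cV[R]_k := \col_(i < k) coord_nat x i.

End Defs.

(* Main.v *)
Require Import Defs.
From HB Require Import structures.
From mathcomp Require Import all_boot all_order all_algebra.
From mathcomp Require Import all_classical all_reals all_analysis measurable_realfun.
From mathcomp Require Import ring lra.
Set Implicit Arguments. Unset Strict Implicit. Unset Printing Implicit Defensive.
Import Order.TTheory GRing.Theory Num.Theory.
Import numFieldNormedType.Exports.
Local Open Scope classical_set_scope.
Local Open Scope ring_scope.

(** The two inclusions fail only if one of two min-max events for bilinear forms [w^T G mu] over
    finite nets occurs.  Gordon's comparison replaces [w^T G mu] by [<g, mu> + <h, w>] with
    independent Gaussian vectors [g] and [h]; the min-max then only involves [|Pi_K g|] and the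
    norms of two coordinate blocks of [h], which concentrate around [sqrt delta], [sqrt k] and
    [sqrt (m - l)].  For the upper inclusion, [w = u + v] with [u] carried by the first [k] rows and
    [v] by the last [m - l]; their norms [r / sqrt delta] and [sqrt (m - l) / sqrt delta], where
    [r^2 = delta - m + l], are those for which the min-max is largest.  For the lower inclusion,
    a point missed by the convex set [Pi (L `&` G K_n)] is separated from it by some [w].

    Both Gordon's inequality and concentration come from one interpolation inequality: if
    [Psi] is smooth with values in [0, 1] and the trace of its Hessian against the difference of the
    covariances is at most [kap * Psi], then [E Psi(Y) <= exp (kap / 2) * E Psi(X)].  The
    interpolation is carried out in finitely many steps, by stability of the Gaussian measure and
    a Taylor bound, so that nothing is differentiated under an integral. *)

(** * Independent families *)

(** The nets cost nothing. A union bound would pay for their cardinality, but the comparison holds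
    at every inverse temperature [beta] of the soft min-max, and [beta] can be taken as large as the
    net sizes require. Neither the mesh nor the dimensions [n] and [m] enter the probability bound.
    This allows a crude order of choices at the end: a Frobenius bound [M] on [G] that fails with
    probability at most one tail, then a mesh [e] small against [M]. For the same reason one
    function [sm] serves twice. Gordon's inequality is the case [theta = 1], [kap = 0].
    Concentration compares two independent copies of a vector with one copy used twice; there
    [kap = 2 (theta beta)^2] depends on [beta] only through the product [theta beta], which stays
    fixed. All errors are measured against [u = tau eps sqrt delta]: a relative change [eps] of the
    radius moves the upper min-max by at least [u] and the lower one by at least [u / 2]. Since
    [1 <= k <= (u / 1024)^2], [u] is at least 1024, which absorbs the additive constants of the
    concentration bounds and the factor 193 in front of the exponential. *)

Section iid.
Variables (R : realType) (dS : measure_display) (S : measurableType dS).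
Implicit Types (I J : finType).

Definition box I (B : I -> set S) : set (I -> S) := [set x | forall i, B i (x i)].

Definition boxes I : set (set (I -> S)) :=
  [set box B | B in [set B | forall i, measurable (B i)]].

(** The product sigma-algebra is put on functions out of any finite type, so that [I + J] and
    [I * J] index pairs of vectors and matrices without renumbering. *)
Definition vec I := g_sigma_algebraType (@boxes I).
HB.instance Definition _ I := Measurable.on (vec I).

Lemma measurable_box I (B : I -> set S) :
  (forall i, measurable (B i)) -> measurable (box B : set (vec I)).
Proof. by move=> mB; apply: sub_sigma_algebra; exists B. Qed.

Lemma measurable_coord I (i : I) : measurable_fun setT (fun x : vec I => x i).
Proof.
move=> _ B mB; rewrite setTI.
rewrite (_ : _ @^-1` _ = box (fun j => if j == i then B else setT)); last first.
  apply/seteqP; split => [x Bx j|x /(_ i)]; last by rewrite eqxx.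
  by case: eqP => // ->.
by apply: measurable_box => j; case: eqP.
Qed.

Lemma measurable_vecP d (T : measurableType d) I (W : T -> vec I) :
  (forall i, measurable_fun setT (fun t => W t i)) -> measurable_fun setT W.
Proof.
move=> mW; apply: (@measurability _ _ T (vec I) setT W (@boxes I)) => //.
move=> _ [_ [B mB <-] <-].
rewrite setTI (_ : _ @^-1` _ = \bigcap_(i in [set: I]) ((fun t => W t i) @^-1` B i)); last first.
  by apply/seteqP; split => [t Wt i _|t Wt i]; [exact: Wt|exact: (Wt i)].
apply: fin_bigcap_measurable; first exact: finite_finset.
by move=> i _; rewrite -[X in measurable X]setTI; exact: mW.
Qed.

(** Prescribing the probabilities of boxes gives independence and the common law [Q] at once;
    [iid_law] extends this to every measurable set. *)
Definition iid (Q : probability S R) d (T : measurableType d) (P : probability T R)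
    I (W : T -> vec I) : Prop :=
  (forall i, measurable_fun setT (fun t => W t i)) /\
  forall B : I -> set S, (forall i, measurable (B i)) ->
    P (W @^-1` box B) = (\prod_i Q (B i))%E.

Lemma iid_measurable Q d (T : measurableType d) (P : probability T R) I (W : T -> vec I) :
  iid Q P W -> measurable_fun setT W.
Proof. by case=> mW _; exact: measurable_vecP. Qed.

Lemma iid_reindex Q d (T : measurableType d) (P : probability T R) I J (f : J -> I)
  (W : T -> vec I) : injective f -> iid Q P W -> iid Q P (fun t (j : J) => W t (f j)).
Proof.
move=> f_inj [mW PW]; split=> [j|B mB]; first exact: mW.
(* Coordinates outside the image of [f] are left unconstrained and contribute factors
   [Q setT = 1]. *)
pose B' i : set S := if [pick j | f j == i] is Some j then B j else setT.
have B'f j : B' (f j) = B j.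
  rewrite /B'; case: pickP => [j' /eqP/f_inj->//|/(_ j)]; by rewrite eqxx.
have -> : (fun t (j : J) => W t (f j)) @^-1` box B = W @^-1` box B'.
  apply/seteqP; split => t /= Wt; last by move=> j; rewrite -B'f; exact: Wt.
  move=> i; rewrite /B'; case: pickP => // j /eqP <-; exact: Wt.
rewrite PW; last by move=> i; rewrite /B'; case: pickP.
rewrite (bigID (fun i => i \in codom f)) /= [X in (_ * X)%E]big1 ?mule1; last first.
  move=> i; rewrite /B'; case: pickP => [j /eqP <-|_ _]; first by rewrite codom_f.
  exact: probability_setT.
have := @big_imset _ _ mule _ _ f predT (fun i => Q (B' i)) (in2W f_inj) => /=.
move=> h; transitivity (\prod_(j : J) Q (B' (f j)))%E; last by apply: eq_bigr => j _; rewrite B'f.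
rewrite -h; apply: eq_bigl => i; apply/codomP/imsetP => [[j ->]|[j _ ->]]; last by exists j.
by exists j.
Qed.

(** Product measures add one coordinate at a time over ordinals; [enum_rank] transports the result
    to any finite type. *)
Lemma iid_exists (Q : probability S R) I :
  exists d (T : measurableType d) (P : probability T R) (W : T -> vec I), iid Q P W.
Proof.
suff: forall n, exists d (T : measurableType d) (P : probability T R) (W : T -> vec 'I_n), iid Q P W.
  move=> /(_ #|I|) [d [T [P [W h]]]]; exists d, T, P, (fun t i => W t (enum_rank i)).
  exact: (iid_reindex enum_rank_inj h).
elim=> [|n [d [T [P [W [mW PW]]]]]].
  exists dS, S, Q, (fun s _ => s); split=> [[]//|B mB].
  by rewrite big_ord0 (_ : _ @^-1` _ = setT) ?probability_setT//; apply/seteqP; split => // s _ [].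
pose W' (ts : T * S) : vec 'I_n.+1 :=
  fun i => if unlift ord0 i is Some j then W ts.1 j else ts.2.
exists _, (T * S)%type, (P \x Q)%E, W'; split=> [i|B mB].
  rewrite /W'; case: unliftP => [j|] _.
    by apply: (measurableT_comp (mW j)); exact: measurable_fst.
  exact: measurable_snd.
have -> : W' @^-1` box B = (W @^-1` box (fun j => B (lift ord0 j))) `*` B ord0.
  apply/seteqP; split => [[t s] /= h|[t s] /= [h1 h2]].
    split => [j /=|]; first by have := h (lift ord0 j); rewrite /W' liftK.
    by have := h ord0; rewrite /W' unlift_none.
  by move=> i; rewrite /W'; case: unliftP => [j|] -> //=; exact: h1.
rewrite [LHS]product_measure1E//.
- rewrite big_ord_recl muleC; congr (_ * _)%E.
  exact: (PW (fun j => B (lift ord0 j))).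
- rewrite -[X in measurable X]setTI; apply: measurable_vecP => //.
  exact: measurable_box.
Qed.

Lemma setI_closed_boxes I : setI_closed (@boxes I).
Proof.
move=> _ _ [B mB <-] [C mC <-]; exists (fun i => B i `&` C i).
  by move=> i; exact: measurableI.
apply/seteqP; split => x /=; first by move=> h; split => i; case: (h i).
by move=> [h1 h2] i; split; [exact: h1|exact: h2].
Qed.

(** Uniqueness of measures: the two image laws agree on boxes, which are stable under intersection
    and generate the sigma-algebra. *)
Lemma iid_law Q d (T : measurableType d) (P : probability T R)
    d' (T' : measurableType d') (P' : probability T' R) I (W : T -> vec I) (W' : T' -> vec I) :
  iid Q P W -> iid Q P' W' -> forall A : set (vec I), measurable A ->
  P (W @^-1` A) = P' (W' @^-1` A).
Proof.
move=> gW gW' A mA.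
have mW := iid_measurable gW; have mW' := iid_measurable gW'.
pose X := HB.pack_for {mfun T >-> vec I} W (isMeasurableFun.Build _ _ _ _ W mW).
pose X' := HB.pack_for {mfun T' >-> vec I} W' (isMeasurableFun.Build _ _ _ _ W' mW').
have := @measure_unique _ R (vec I) (@boxes I) (fun=> setT) _ (@setI_closed_boxes I) _ _
  (distribution P X) (distribution P' X') _ _ A mA; apply => //.
- by move=> _; exists (fun=> setT) => //; apply/seteqP; split.
- by rewrite bigcup_const.
- by move=> _ [B mB <-]; case: gW gW' => _ h [_ h']; rewrite /= /distribution /pushforward h// h'.
- by move=> _; rewrite (le_lt_trans (probability_le1 (distribution P X) measurableT)) ?ltry.
Qed.

End iid.

(** * The standard normal law on the line *)

Section normal1.
Variable R : realType.
Notation mu := (@lebesgue_measure R).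

(* [normal_prob] lives on [measurableTypeR R], whose display differs from that of [R]. *)
Definition idTR : measurableTypeR R -> R := idfun.
Lemma measurable_idTR : measurable_fun setT idTR. Proof. exact: (@measurable_id _ (measurableTypeR R) setT). Qed.
HB.instance Definition _ := isMeasurableFun.Build _ _ _ _ idTR measurable_idTR.

Definition gauss1 : probability R R := distribution (normal_prob (0:R) 1) idTR.
Notation phi := (normal_pdf (0:R) 1).

(** The Radon-Nikodym derivative equals the explicit density almost everywhere, because both have
    the same integral over every measurable set. *)
Lemma ge0_integral_gauss1 (f : R -> \bar R) : measurable_fun setT f -> (forall x, (0 <= f x)%E) ->
  (\int[gauss1]_x f x = \int[mu]_x (f x * (phi x)%:E))%E.
Proof.
move=> mf f0.
have dom := normal_prob_dominates (0:R) 1.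
transitivity (\int[normal_prob 0 1]_x f x)%E; first by rewrite ge0_integral_distribution.
rewrite -(Radon_Nikodym_SigmaFinite.change_of_variables dom)//.
have h0 := Radon_Nikodym_SigmaFinite.f_ge0 dom.
have hint := Radon_Nikodym_SigmaFinite.f_integrable dom.
have hE := Radon_Nikodym_SigmaFinite.f_integral dom.
have mphi : measurable_fun setT (fun x : R => (phi x)%:E).
  by apply/measurable_EFinP; exact: measurable_normal_pdf.
apply: ge0_ae_eq_integral => //.
- by apply: emeasurable_funM => //; exact: (measurable_int mu).
- exact: emeasurable_funM.
- by move=> x _; apply: mule_ge0.
- by move=> x _; apply: mule_ge0 => //; rewrite lee_fin normal_pdf_ge0.
- apply: ae_eqe_mul2l => /=.
  apply: integral_ae_eq => //= E _ mE.
  by rewrite -hE.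
Qed.

(** Lebesgue measure is [a] times its image under [x |-> a x + c], which by uniqueness need only be
    checked on half-open intervals. *)
Lemma ge0_integral_affine (a c : R) (f : R -> \bar R) : 0 < a -> measurable_fun setT f ->
  (forall x, (0 <= f x)%E) ->
  (\int[mu]_x f (a * x + c)%R = (a^-1)%:E * \int[mu]_x f x)%E.
Proof.
move=> a0 mf f0.
have maff : measurable_fun setT (fun x : R => a * x + c : R).
  by apply: measurable_funD => //; exact: measurable_funM.
pose aff0 (x : measurableTypeR R) : measurableTypeR R := a * x + c.
have maff0 : measurable_fun setT aff0 by exact: maff.
have a0' : 0 <= a by exact: ltW.
pose m'' : {measure set (measurableTypeR R) -> \bar R} := mscale (NngNum a0') (pushforward mu aff0).
pose m' := m'' maff0.
have muE (A : set R) : measurable A -> mu A = m' A.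
  move=> mA; apply: lebesgue_measure_unique => //= _ [[u v]] _ <-.
  rewrite /m' /m''/= /mscale/= /pushforward.
  have -> : aff0 @^-1` `]u, v] = `](u - c) / a, (v - c) / a]%classic.
    apply/seteqP; split => x /=; rewrite !in_itv/= ltr_pdivrMr// ler_pdivlMr// ltrBlDr lerBrDr (mulrC x) //.
  rewrite [LHS]lebesgue_measure_itv/= lebesgue_measure_itv/= !lte_fin ltr_pM2r ?invr_gt0// ltrD2r.
  case: ifPn => uv; last by rewrite mule0.
  by rewrite -!EFinD -EFinM -mulrBl mulrCA divff ?gt_eqF// mulr1 opprB addrA subrK.
have -> : (\int[mu]_x f x = \int[m']_x f x)%E.
  by apply: eq_measure_integral => A mA _; rewrite -muE.
rewrite ge0_integral_mscale//= muleA -EFinM mulVf ?gt_eqF// mul1e.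
by rewrite ge0_integral_pushforward.
Qed.

Lemma ge0_integral_gauss1_affine (a c : R) (f : R -> \bar R) : 0 < a -> measurable_fun setT f ->
  (forall x, (0 <= f x)%E) ->
  (\int[gauss1]_x f (a * x + c)%R = \int[mu]_x (f x * (normal_pdf c a x)%:E))%E.
Proof.
move=> a0 mf f0.
have maff : measurable_fun setT (fun x : R => a * x + c : R).
  by apply: measurable_funD => //; exact: measurable_funM.
have mg : measurable_fun setT (fun x : R => f x * (normal_pdf c a x)%:E)%E.
  apply: emeasurable_funM => //; apply/measurable_EFinP; exact: measurable_normal_pdf.
have g0 x : (0 <= f x * (normal_pdf c a x)%:E)%E.
  by rewrite mule_ge0 // lee_fin normal_pdf_ge0.
transitivity (\int[mu]_x (f (a * x + c)%R * (phi x)%:E))%E.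
  by apply: (@ge0_integral_gauss1 (fun x => f (a * x + c)%R)) => //; exact: (measurableT_comp mf maff).
have := ge0_integral_affine c a0 mg g0 => /= h.
have e1 : 1%E = (a%:E * (a^-1)%:E)%E by rewrite -EFinM divff// gt_eqF.
rewrite -[RHS]mul1e [X in _ = (X * _)%E]e1 -muleA -h -ge0_integralZl//.
- apply: eq_integral => x _; rewrite muleCA; congr (_ * _)%E; rewrite -EFinM; congr EFin.
  rewrite !normal_pdfE ?gt_eqF// /normal_fun /normal_peak.
  rewrite addrK subr0 expr1n mul1r mulrA; congr (_ * expR _).
    rewrite -mulrnAr sqrtrM ?sqr_ge0// sqrtr_sqr gtr0_norm// invfM mulrA divff ?gt_eqF// mul1r //.
  by field; rewrite gt_eqF.
- exact: (measurableT_comp mg).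
- by rewrite lee_fin ltW.
Qed.

Lemma ge0_integral_gauss1N (f : R -> \bar R) : measurable_fun setT f ->
  (forall x, (0 <= f x)%E) -> (\int[gauss1]_x f (- x)%R = \int[gauss1]_x f x)%E.
Proof.
move=> mf f0.
have mN : measurable_fun setT (-%R : R -> R) by exact: oppr_measurable.
have mphi : measurable_fun setT (fun x : R => (phi x)%:E).
  by apply/measurable_EFinP; exact: measurable_normal_pdf.
have phi0 x : (0 <= (phi x)%:E)%E by rewrite lee_fin normal_pdf_ge0.
rewrite (@ge0_integral_gauss1 (fun x => f (- x)%R))//; last exact: (measurableT_comp mf mN).
rewrite (@ge0_integral_gauss1 f)//.
transitivity (\int[pushforward mu (-%R : _ -> measurableTypeR R)]_x (f x * (phi x)%:E))%E; last first.
  apply: eq_measure_integral => A mA _; exact: (@lebesgue_measureN R A mA).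
rewrite ge0_integral_pushforward.
- apply: eq_integral => x _ /=; congr (_ * EFin _)%E.
  by rewrite !normal_pdfE ?oner_eq0// /normal_fun !subr0 sqrrN.
- exact: mN.
- exact: measurableT.
- exact: (emeasurable_funM mf mphi).
- by move=> x _; apply: mule_ge0.
Qed.

Lemma gauss1N (B : set R) : measurable B -> gauss1 (-%R @^-1` B) = gauss1 B.
Proof.
move=> mB.
have mN : measurable_fun setT (-%R : R -> R) by exact: oppr_measurable.
have mNB : measurable ((-%R : R -> R) @^-1` B) by rewrite -[X in measurable X]setTI; exact: mN.
have e A : measurable A -> (\int[gauss1]_x (\1_A x)%:E)%E = gauss1 A.
  by move=> mA; rewrite integral_indic// setIT.
rewrite -(e _ mNB) -(e _ mB) -[RHS](@ge0_integral_gauss1N (fun x => (\1_B x)%:E)).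
- by apply: eq_integral => x _.
- by apply/measurable_EFinP; exact: measurable_indic.
- by move=> x; rewrite lee_fin.
Qed.

Lemma gauss1_stable (a b : R) (f : R -> \bar R) : 0 < a -> 0 <= b -> a ^+ 2 + b ^+ 2 = 1 ->
  measurable_fun setT f -> (forall x, (0 <= f x)%E) ->
  (\int[gauss1]_y \int[gauss1]_x f (a * x + b * y)%R = \int[gauss1]_x f x)%E.
Proof.
move=> a0 b0 ab mf f0.
under eq_integral do rewrite ge0_integral_gauss1_affine//.
have mphi : measurable_fun setT (fun x : R => (phi x)%:E).
  by apply/measurable_EFinP; exact: measurable_normal_pdf.
have phi0 x : (0 <= (phi x)%:E)%E by rewrite lee_fin normal_pdf_ge0.
pose g (u y : R) := (f u * (normal_pdf (b * y) a u)%:E)%E.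
(* With [u = a x + b y], the joint density of [u] and [y] is symmetric in the two variables. Given
   [u], the law of [y] is therefore normal with mean [b u] and deviation [a], and integrates to
   1. *)
have gE u y : (g u y * (phi y)%:E = f u * (phi u)%:E * (normal_pdf (b * u) a y)%:E)%E.
  rewrite /g -!muleA -!EFinM; congr (_ * EFin _)%E.
  rewrite !normal_pdfE ?gt_eqF// /normal_fun.
  rewrite mulrACA [RHS]mulrACA [normal_peak _ * _]mulrC; congr (_ * _).
  rewrite -!expRD !subr0 expr1n; congr expR.
  have a2 : a ^+ 2 = 1 - b ^+ 2 by rewrite -ab addrK.
  have : 1 - b ^+ 2 != 0 by rewrite -a2 expf_neq0// gt_eqF.
  by rewrite a2 => hb; field.
have g0 u y : (0 <= g u y)%E by rewrite /g !mule_ge0// lee_fin normal_pdf_ge0.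
have mg : measurable_fun setT (fun p : R * R => g p.1 p.2).
  apply: emeasurable_funM; first by apply: (measurableT_comp mf); exact: measurable_fst.
  apply/measurable_EFinP.
  under eq_fun do rewrite normal_pdfE ?gt_eqF// /normal_fun.
  apply: measurable_funM => //; apply: measurableT_comp => //.
  apply: measurable_funM => //; apply: measurable_funN; apply: measurable_funX.
  apply: measurable_funB; first exact: measurable_fst.
  by apply: measurable_funM => //; exact: measurable_snd.
have mF : measurable_fun setT (fun p : R * R => g p.1 p.2 * (phi p.2)%:E)%E.
  by apply: emeasurable_funM => //; apply: (measurableT_comp mphi); exact: measurable_snd.
have F0 u y : (0 <= g u y * (phi y)%:E)%E by exact: mule_ge0.
transitivity (\int[mu]_y (\int[mu]_u (g u y) * (phi y)%:E))%E.
  apply: (@ge0_integral_gauss1 (fun y => \int[mu]_u (g u y))%E) => [|y]; last exact: integral_ge0.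
  exact: (@measurable_fun_fubini_tonelli_G _ _ (measurableTypeR R) (measurableTypeR R) R mu
    (fun p => g p.1 p.2) mg (fun p => g0 p.1 p.2)).
transitivity (\int[mu]_y \int[mu]_u (g u y * (phi y)%:E))%E.
  apply: eq_integral => y _; rewrite ge0_integralZr//.
  exact: (measurableT_comp mg (measurable_pair2 y)).
transitivity (\int[mu]_u \int[mu]_y (g u y * (phi y)%:E))%E.
  exact: (esym (@fubini_tonelli _ _ (measurableTypeR R) (measurableTypeR R) R mu mu
    (fun p => g p.1 p.2 * (phi p.2)%:E)%E mF (fun p => F0 p.1 p.2))).
transitivity (\int[mu]_u (f u * (phi u)%:E))%E; last exact/esym/ge0_integral_gauss1.
apply: eq_integral => u _.
under eq_integral do rewrite gE.
rewrite ge0_integralZl.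
- by rewrite integral_normal_pdf mule1.
- exact: measurableT.
- by apply/measurable_EFinP; exact: measurable_normal_pdf.
- by move=> x _; rewrite lee_fin normal_pdf_ge0.
- exact: mule_ge0.
Qed.

(** The exponent is the one that turns the standard density into [s] times the density of deviation
    [s]. Every moment below is controlled through this single integral. *)
Lemma integral_gauss1_exp_sq (s : R) : 0 < s ->
  (\int[gauss1]_x (expR ((1 - s ^- 2) / 2 * x ^+ 2))%:E = s%:E)%E.
Proof.
move=> s0.
have me : measurable_fun setT (fun x : R => (expR ((1 - s ^- 2) / 2 * x ^+ 2))%:E).
  apply/measurable_EFinP; apply: measurableT_comp => //; exact: measurable_funM.
transitivity (\int[mu]_x ((expR ((1 - s ^- 2) / 2 * x ^+ 2))%:E * (phi x)%:E))%E.
  by apply: (@ge0_integral_gauss1 (fun x => (expR ((1 - s ^- 2) / 2 * x ^+ 2))%:E)).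
transitivity (\int[mu]_x (s%:E * (normal_pdf 0 s x)%:E))%E.
  apply: eq_integral => x _; rewrite -!EFinM; congr EFin.
  rewrite !normal_pdfE ?gt_eqF// /normal_fun /normal_peak !subr0 expr1n mul1r.
  rewrite -mulrnAr sqrtrM ?sqr_ge0// sqrtr_sqr gtr0_norm// [in RHS]invfM.
  rewrite mulrCA -expRD !mulrA divff ?gt_eqF// mul1r; congr (_ * expR _).
  by field; rewrite gt_eqF.
rewrite ge0_integralZl.
- by rewrite integral_normal_pdf mule1.
- exact: measurableT.
- by apply/measurable_EFinP; exact: measurable_normal_pdf.
- by move=> x _; rewrite lee_fin normal_pdf_ge0.
- by rewrite lee_fin ltW.
Qed.

Lemma integrable_gauss1_dom (f : R -> R) (C : R) : measurable_fun setT f ->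
  (forall x, `|f x| <= C * expR ((1 - 2 ^- 2) / 2 * x ^+ 2)) -> gauss1.-integrable setT (EFin \o f).
Proof.
move=> mf fC; have C0 : 0 <= C.
  by have := le_trans (normr_ge0 _) (fC 0); rewrite expr0n mulr0 expR0 mulr1.
have me : measurable_fun setT (fun x : R => expR ((1 - 2 ^- 2) / 2 * x ^+ 2)).
  by apply: measurableT_comp => //; exact: measurable_funM.
have ig : gauss1.-integrable setT (fun x => (C%:E * (expR ((1 - 2 ^- 2) / 2 * x ^+ 2))%:E)%E).
  apply: (integrableZl measurableT); apply/integrableP; split; first exact/measurable_EFinP.
  under eq_integral do rewrite gee0_abs ?lee_fin ?expR_ge0//.
  by rewrite integral_gauss1_exp_sq// ltry.
apply: (le_integrable measurableT _ _ ig); first exact/measurable_EFinP.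
by move=> x _; rewrite -EFinM !abse_EFin lee_fin (ger0_norm (mulr_ge0 C0 (expR_ge0 _))).
Qed.

(** Squaring [1 + 3/16 x^2 <= exp (3/16 x^2)] gives both the quadratic and the quartic lower
    bound. *)
Let expR_ge (x : R) (a := expR ((1 - 2 ^- 2) / 2 * x ^+ 2)) : 1 + 3 / 8 * x ^+ 2 <= a /\ x ^+ 4 <= 128 * a.
Proof.
have -> : a = expR (3 / 16 * x ^+ 2) * expR (3 / 16 * x ^+ 2).
  by rewrite -expRD; congr expR; field.
have := expR_ge1Dx (3 / 16 * x ^+ 2); have := sqr_ge0 x.
have -> : x ^+ 4 = (x ^+ 2) ^+ 2 by rewrite -exprM.
move: (x ^+ 2) (expR _) => u E u0 h.
by split; nra.
Qed.

Lemma integral_gauss1_pow4 : (\int[gauss1]_x (x ^+ 4)%:E < +oo)%E.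
Proof.
have i4 : gauss1.-integrable setT (EFin \o (fun x : R => x ^+ 4)).
  apply: (@integrable_gauss1_dom _ 128); first exact: measurable_funX.
  by move=> x; rewrite ger0_norm ?(proj2 (expR_ge x))// -[X in x ^+ X]/(2 * 2)%N exprM sqr_ge0.
by have /fineK <- := integrable_fin_num measurableT i4; exact: ltry.
Qed.

(* Integrating [1 + c x^2 <= exp (c x^2)] for [c = (1 - s^-2) / 2] gives
   [(s^2 - 1) v <= 2 s^2 (s - 1)] for all [s > 0], which forces [v = 1] when [s] tends to 1. *)
Lemma integral_gauss1_sq : (\int[gauss1]_x (x ^+ 2)%:E = 1)%E.
Proof.
have i2 : gauss1.-integrable setT (EFin \o (fun x : R => x ^+ 2)).
  apply: (@integrable_gauss1_dom _ 3); first exact: measurable_funX.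
  move=> x; rewrite ger0_norm ?sqr_ge0//; have [+ _] := expR_ge x.
  by move: (expR _) (sqr_ge0 x) => E; lra.
have := integrable_fin_num measurableT i2; set m2 := (\int[gauss1]_x _)%E => m2fin.
have m2_0 : (0 <= m2)%E by apply: integral_ge0 => x _; rewrite lee_fin sqr_ge0.
have v0 : 0 <= fine m2 by exact: fine_ge0.
have key s : 0 < s -> (s ^+ 2 - 1) * fine m2 <= 2 * s ^+ 2 * (s - 1).
  move=> s0; pose c := (1 - s ^- 2) / 2.
  have : (\int[gauss1]_x (1%:E + c%:E * (x ^+ 2)%:E) <= s%:E)%E.
    rewrite -(integral_gauss1_exp_sq s0) -/c; apply: le_integral => //.
    - apply: integrableD => //; first exact: finite_measure_integrable_cst.
      exact: (integrableZl measurableT c i2).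
    - apply/integrableP; split.
        by apply/measurable_EFinP; apply: measurableT_comp => //; exact: measurable_funM.
      under eq_integral do rewrite gee0_abs ?lee_fin ?expR_ge0//.
      by rewrite integral_gauss1_exp_sq// ltry.
    - by move=> x _; rewrite -EFinM -EFinD lee_fin expR_ge1Dx.
  rewrite integralD//; [|exact: finite_measure_integrable_cst|exact: (integrableZl measurableT c i2)].
  have -> : (\int[gauss1]_x (1:R)%:E = 1%:E)%E.
    by rewrite integral_cst// mul1e; exact: (@probability_setT _ _ _ gauss1).
  rewrite integralZl// -/m2 -(fineK m2fin).
  rewrite -EFinM -EFinD lee_fin => h.
  have -> : (s ^+ 2 - 1) * fine m2 = 2 * s ^+ 2 * (c * fine m2) by rewrite /c; field; rewrite gt_eqF.
  by rewrite ler_wpM2l ?mulr_ge0 ?sqr_ge0//; lra.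
rewrite -(fineK m2fin); congr EFin; move: (fine m2) v0 key => v v0 key.
(* Dividing by [s - 1] turns [key] into [(s + 1) v <= 2 s^2] for [s > 1], and into the reverse for
   [s < 1]. Moving [s] from 1 by a quarter of the gap between [v] and 1 contradicts each. *)
apply/eqP; rewrite eq_le !leNgt; apply/andP; split; apply/negP => v1.
- have /(exprn_gt0 2) : 0 < v - 1 by rewrite subr_gt0.
  have /(exprn_gt0 3) : 0 < v - 1 by rewrite subr_gt0.
  by have := key (1 + (v - 1) / 4) ltac:(lra); lra.
- have v1' : 0 < 1 - v by rewrite subr_gt0.
  have := mulr_gt0 (exprn_gt0 2 v1') (_ : 0 < 9 + v); rewrite ltr_wpDr// => /(_ isT).
  by have := key (1 - (1 - v) / 4) ltac:(lra); lra.
Qed.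

End normal1.

(** * The standard Gaussian measure *)

Section gam.
Variable R : realType.
Implicit Types (I J : finType).
Notation gauss1 := (@gauss1 R).
Notation gauss := (iid gauss1).

Lemma ge0_integral_law d (T : measurableType d) (P : probability T R) d' (T' : measurableType d')
    (W : T -> T') (f : T' -> \bar R) (mW : measurable_fun setT W) :
  measurable_fun setT f -> (forall x, (0 <= f x)%E) ->
  (\int[pushforward P W]_x f x = \int[P]_t f (W t))%E.
Proof. by move=> mf f0; rewrite ge0_integral_pushforward. Qed.

Lemma gam_ex I : exists P : probability (vec R I) R, gauss P (fun x => x).
Proof.
have [d [T [P [W h]]]] := iid_exists gauss1 I.
have mW := iid_measurable h.
pose X := HB.pack_for {mfun T >-> vec R I} W (isMeasurableFun.Build _ _ _ _ W mW).
exists (distribution P X); split; first exact: measurable_coord.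
by move=> B mB; rewrite /= /distribution /pushforward; exact: h.2.
Qed.

(** A canonical Gaussian space for each index type: every Gaussian family, on whatever space, is
    transported here by its law. *)
Definition gam I : probability (vec R I) R := sval (cid (gam_ex I)).

Lemma gamP I : gauss (gam I) (fun x => x).
Proof. exact: (svalP (cid (gam_ex I))). Qed.

Lemma gam_law d (T : measurableType d) (P : probability T R) I (W : T -> vec R I) :
  gauss P W -> forall A, measurable A -> P (W @^-1` A) = gam I A.
Proof. by move=> gW A mA; rewrite (iid_law gW (@gamP I)). Qed.

Lemma ge0_integral_gam d (T : measurableType d) (P : probability T R) I (W : T -> vec R I)
    (f : vec R I -> \bar R) :
  gauss P W -> measurable_fun setT f -> (forall x, (0 <= f x)%E) ->
  (\int[gam I]_x f x = \int[P]_t f (W t))%E.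
Proof.
move=> gW mf f0; have mW := iid_measurable gW.
rewrite -(ge0_integral_law P mW mf f0).
by apply: eq_measure_integral => A mA _; rewrite /= /pushforward (gam_law gW).
Qed.

Definition vcat I J (x : vec R I) (y : vec R J) : vec R (I + J)%type :=
  fun k => match k with inl i => x i | inr j => y j end.

Lemma iid_prod d (T : measurableType d) (P : probability T R) d' (T' : measurableType d')
    (P' : probability T' R) I J (W : T -> vec R I) (W' : T' -> vec R J) :
  gauss P W -> gauss P' W' -> gauss (P \x P')%E (fun t => vcat (W t.1) (W' t.2)).
Proof.
move=> gW gW'; split=> [[i|j]|B mB].
- by apply: (measurableT_comp (gW.1 i)); exact: measurable_fst.
- by apply: (measurableT_comp (gW'.1 j)); exact: measurable_snd.
have -> : (fun t => vcat (W t.1) (W' t.2)) @^-1` box B =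
    (W @^-1` box (fun i => B (inl i))) `*` (W' @^-1` box (fun j => B (inr j))).
  apply/seteqP; split => [[t s] /= h|[t s] /= [h1 h2]].
    by split => i; [exact: (h (inl i))|exact: (h (inr i))].
  by case=> i /=; [exact: h1|exact: h2].
have mW := iid_measurable gW; have mW' := iid_measurable gW'.
rewrite [LHS]product_measure1E.
- rewrite big_sumType; congr (_ * _)%E.
    exact: (gW.2 (fun i => B (inl i))).
  exact: (gW'.2 (fun j => B (inr j))).
- by rewrite -[X in measurable X]setTI; apply: mW => //; exact: measurable_box.
- by rewrite -[X in measurable X]setTI; apply: mW' => //; exact: measurable_box.
Qed.

Lemma measurable_vcat I J : measurable_fun setT (fun t : vec R I * vec R J => vcat t.1 t.2).
Proof. exact: (iid_measurable (iid_prod (@gamP I) (@gamP J))). Qed.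

Lemma gam_fubini I J (f : vec R (I + J)%type -> \bar R) :
  measurable_fun setT f -> (forall x, (0 <= f x)%E) ->
  (\int[gam (I + J)%type]_z f z = \int[gam I]_x \int[gam J]_y f (vcat x y))%E.
Proof.
move=> mf f0.
rewrite (ge0_integral_gam (iid_prod (@gamP I) (@gamP J)) mf f0).
have mg := measurableT_comp mf (@measurable_vcat I J).
by rewrite (fubini_tonelli1 (fun t => f (vcat t.1 t.2)) mg).
Qed.

Lemma gauss1_prod_stable (a b : R) (B : set R) : 0 < a -> 0 <= b -> a ^+ 2 + b ^+ 2 = 1 ->
  measurable B -> (gauss1 \x gauss1)%E [set p | B (a * p.1 + b * p.2)] = gauss1 B.
Proof.
move=> a0 b0 ab mB.
have mab : measurable_fun setT (fun p : R * R => a * p.1 + b * p.2).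
  by apply: measurable_funD; exact: measurable_funM.
have mS : measurable [set p : R * R | B (a * p.1 + b * p.2)].
  by rewrite -[X in measurable X]setTI; exact: mab.
have e d (T : measurableType d) (P : probability T R) A :
    measurable A -> (\int[P]_x (\1_A x : R)%:E)%E = P A.
  by move=> mA; rewrite integral_indic// setIT.
have mi : measurable_fun setT (fun x : R => (\1_B x : R)%:E).
  by apply/measurable_EFinP; exact: measurable_indic.
rewrite -(e _ _ _ _ mS) -(e _ _ _ _ mB) -(gauss1_stable a0 b0 ab mi); last by move=> x; rewrite lee_fin.
rewrite (fubini_tonelli2 (fun p => (\1_[set p : R * R | B (a * p.1 + b * p.2)] p : R)%:E)).
- by [].
- by apply/measurable_EFinP; exact: measurable_indic.
- by move=> x; rewrite lee_fin.
Qed.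

Lemma gam_stable I (a b : R) (f : vec R I -> \bar R) : 0 < a -> 0 <= b -> a ^+ 2 + b ^+ 2 = 1 ->
  measurable_fun setT f -> (forall x, (0 <= f x)%E) ->
  (\int[gam I]_x \int[gam I]_y f (fun i => a * x i + b * y i)%R = \int[gam I]_x f x)%E.
Proof.
move=> a0 b0 ab mf f0.
(* One pair of independent normals per coordinate. The same [W] is read as a Gaussian vector over
   [I + I] and, by stability, as one over [I]; comparing the two readings gives the identity. *)
have [d [T [P [W [mW PW]]]]] := iid_exists (gauss1 \x gauss1)%E I.
pose W1 t : vec R (I + I)%type := fun k => match k with inl i => (W t i).1 | inr i => (W t i).2 end.
pose W2 t : vec R I := fun i => a * (W t i).1 + b * (W t i).2.
have gW1 : gauss P W1.
  split=> [[i|i]|B mB].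
  - by apply: (measurableT_comp _ (mW i)); exact: measurable_fst.
  - by apply: (measurableT_comp _ (mW i)); exact: measurable_snd.
  have -> : W1 @^-1` box B = W @^-1` box (fun i => B (inl i) `*` B (inr i)).
    apply/seteqP; split => t /= h; first by move=> i; split; [exact: (h (inl i))|exact: (h (inr i))].
    by case=> i; have [] := h i.
  rewrite PW; last by move=> i; exact: measurableX.
  transitivity (\prod_i (gauss1 (B (inl i)) * gauss1 (B (inr i))))%E; last by rewrite big_sumType big_split.
  by apply: eq_bigr => i _; exact: product_measure1E.
have gW2 : gauss P W2.
  have mab : measurable_fun setT (fun p : R * R => a * p.1 + b * p.2).
    by apply: measurable_funD; exact: measurable_funM.
  split=> [i|B mB]; first exact: (measurableT_comp mab (mW i)).
  have -> : W2 @^-1` box B = W @^-1` box (fun i => [set p | B i (a * p.1 + b * p.2)]).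
    by apply/seteqP; split => t /= h i; exact: h.
  rewrite PW; last by move=> i; rewrite -[X in measurable X]setTI; exact: mab.
  by apply: eq_bigr => i _; exact: gauss1_prod_stable.
have mc : measurable_fun setT (fun z : vec R (I + I)%type => (fun i => a * z (inl i) + b * z (inr i)) : vec R I).
  apply: measurable_vecP => i.
  by apply: measurable_funD; apply: measurable_funM => //; exact: measurable_coord.
transitivity (\int[gam (I + I)%type]_z f (fun i => a * z (inl i) + b * z (inr i))%R)%E.
  exact: (esym (gam_fubini (measurableT_comp mf mc) (fun z => f0 _))).
rewrite (ge0_integral_gam gW2 mf f0).
exact: (ge0_integral_gam gW1 (measurableT_comp mf mc) (fun z => f0 _)).
Qed.

(** Sign symmetry is what makes first moments and mixed second moments vanish, with no integral
    computed. *)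
Lemma gam_flip I (s : I -> bool) : gauss (gam I) (fun x i => (-1) ^+ s i * x i).
Proof.
have mN b : measurable_fun setT (fun x : R => (-1) ^+ b * x) by exact: measurable_funM.
split=> [i|B mB].
  by apply: (measurableT_comp (mN (s i))); exact: measurable_coord.
have mB' i : measurable ((fun x : R => (-1) ^+ s i * x) @^-1` B i).
  by rewrite -[X in measurable X]setTI; exact: mN.
have := (@gamP I).2 _ mB'.
rewrite (_ : _ @^-1` _ = (fun x i => (-1) ^+ s i * x i) @^-1` box B)//.
move=> ->; apply: eq_bigr => i _.
have -> : [eta *%R ((-1) ^+ s i)] @^-1` B i = if s i then -%R @^-1` B i else B i.
  by case: (s i); apply/funext => x /=; rewrite ?expr0 ?mul1r ?expr1 ?mulN1r.
by case: (s i); rewrite ?gauss1N.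
Qed.

Lemma measurable_coordf I (f : R -> R) (i : I) :
  measurable_fun setT f -> measurable_fun setT (fun x : vec R I => f (x i)).
Proof. by move=> mf; apply: (measurableT_comp mf); exact: measurable_coord. Qed.

Lemma ge0_integral_coord I (i : I) (f : R -> \bar R) :
  measurable_fun setT f -> (forall x, (0 <= f x)%E) ->
  (\int[gam I]_x f (x i) = \int[gauss1]_x f x)%E.
Proof.
move=> mf f0.
have mi : measurable_fun setT (fun x : vec R I => x i) by exact: measurable_coord.
rewrite -(ge0_integral_law (gam I) mi mf f0).
apply: eq_measure_integral => A mA _; rewrite /= /pushforward.
have := iid_reindex (f := fun _ : unit => i) _ (@gamP I) => /(_ (fun x y _ => _)).
move=> /(_ ltac:(by case=> -[])) [_ /(_ (fun=> A) (fun=> mA))].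
rewrite (big_pred1 tt); last by case.
rewrite [X in _ -> gam I X = _](_ : _ = (fun (t : vec R I) (_ : unit) => t i) @^-1` box (fun=> A)) //.
by apply/seteqP; split => x /= h; [move=> _|apply: (h tt)].
Qed.

Definition itg I (f : vec R I -> R) := (gam I).-integrable setT (EFin \o f).
Definition Eg I (f : vec R I -> R) : R := Rintegral (gam I) setT f.

Lemma itgD I (f g : vec R I -> R) : itg f -> itg g -> itg (fun x => f x + g x).
Proof. by move=> hf hg; exact: (integrableD _ hf hg). Qed.

Lemma itgZ I (c : R) (f : vec R I -> R) : itg f -> itg (fun x => c * f x).
Proof. by move=> hf; exact: (integrableZl _ c hf). Qed.

Lemma itg_sum I J (f : J -> vec R I -> R) : (forall j, itg (f j)) -> itg (fun x => \sum_j f j x).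
Proof.
move=> hf; rewrite /itg (_ : _ \o _ = (fun x => \sum_(j <- index_enum J) (f j x)%:E)%E); last first.
  by apply/funext => x /=; rewrite sumEFin.
by apply: integrable_sum => //= j _; exact: hf.
Qed.

Lemma itg_bounded I (f : vec R I -> R) (M : R) : measurable_fun setT f ->
  (forall x, `|f x| <= M) -> itg f.
Proof.
move=> mf fM; apply: measurable_bounded_integrable => //.
- exact: (le_lt_trans (probability_le1 _ measurableT) (ltry _)).
- by exists M; split => [|y My x _]; [exact: num_real|exact: le_trans (fM x) (ltW My)].
Qed.

Lemma itg_le I (f g : vec R I -> R) : measurable_fun setT f -> itg g ->
  (forall x, `|f x| <= `|g x|) -> itg f.
Proof.
move=> mf hg fg; apply: (le_integrable measurableT _ _ hg).
- exact/measurable_EFinP.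
- by move=> x _; rewrite /= lee_fin.
Qed.

Lemma EgD I (f g : vec R I -> R) : itg f -> itg g -> Eg (fun x => f x + g x) = Eg f + Eg g.
Proof. by move=> hf hg; exact: RintegralD. Qed.

Lemma EgZ I (c : R) (f : vec R I -> R) : itg f -> Eg (fun x => c * f x) = c * Eg f.
Proof. by move=> hf; exact: RintegralZl. Qed.

Lemma Eg_cst I (c : R) : Eg (fun _ : vec R I => c) = c.
Proof.
rewrite /Eg Rintegral_cst// [X in c * fine X](_ : _ = 1%E) ?mulr1//.
exact: (@probability_setT _ _ _ (gam I)).
Qed.

Lemma itg_cst I (c : R) : itg (fun _ : vec R I => c).
Proof. by apply: (@itg_bounded _ _ `|c|). Qed.

Lemma Eg_sum I J (f : J -> vec R I -> R) : (forall j, itg (f j)) ->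
  Eg (fun x => \sum_j f j x) = \sum_j Eg (f j).
Proof.
move=> hf; elim: (index_enum J) => [|j s IH].
  by under eq_fun do rewrite big_nil; rewrite big_nil Eg_cst.
under eq_fun do rewrite big_cons; rewrite big_cons EgD ?IH//.
elim: s {IH} => [|k s IH]; first by under eq_fun do rewrite big_nil; exact: itg_cst.
by under eq_fun do rewrite big_cons; exact: itgD.
Qed.

Lemma le_Eg I (f g : vec R I -> R) : itg f -> itg g -> (forall x, f x <= g x) -> Eg f <= Eg g.
Proof. by move=> hf hg fg; apply: le_Rintegral. Qed.

Lemma Eg_flip I (s : I -> bool) (f : vec R I -> R) : measurable_fun setT f ->
  itg (fun x => f (fun i => (-1) ^+ s i * x i)) -> Eg (fun x => f (fun i => (-1) ^+ s i * x i)) = Eg f.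
Proof.
move=> mf hf; rewrite /Eg /Rintegral; congr fine.
pose W (x : vec R I) : vec R I := fun i => (-1) ^+ s i * x i.
have mW : measurable_fun setT W := iid_measurable (gam_flip s).
have mf' : measurable_fun setT (EFin \o f) by exact/measurable_EFinP.
transitivity (\int[pushforward (gam I) W]_x (f x)%:E)%E; first by rewrite integral_pushforward.
by apply: eq_measure_integral => A mA _; rewrite /= /pushforward (gam_law (gam_flip s)).
Qed.

Lemma itg_coord4 I (i : I) : itg (fun x => x i ^+ 4).
Proof.
have m4 : measurable_fun setT (fun x : R => x ^+ 4) by exact: measurable_funX.
apply/integrableP; split; first by apply/measurable_EFinP; exact: (@measurable_coordf _ (fun x => x ^+ 4) i).
have p4 (x : R) : 0 <= x ^+ 4 by rewrite -[X in x ^+ X]/(2 * 2)%N exprM sqr_ge0.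
rewrite (_ : (fun x => _) = (fun x : vec R I => (x i ^+ 4)%:E)); last first.
  by apply/funext => x /=; rewrite ger0_norm.
rewrite (@ge0_integral_coord _ i (fun x => (x ^+ 4)%:E)) ?integral_gauss1_pow4//.
exact/measurable_EFinP.
Qed.

(** The Taylor remainder needs moments of order at most 3, all of which the fourth moment
    dominates. *)
Lemma itg_coord_le4 I (i : I) (f : R -> R) (a b : R) : measurable_fun setT f -> 0 <= a -> 0 <= b ->
  (forall x, `|f x| <= a + b * x ^+ 4) -> itg (fun x => f (x i)).
Proof.
move=> mf a0 b0 fx; apply: (itg_le _ (itgD (itg_cst I a) (itgZ b (@itg_coord4 _ i)))).
  exact: measurable_coordf.
by move=> x; apply: (le_trans (fx _)); exact: ler_norm.
Qed.

Lemma itg_coord I (i : I) : itg (fun x => x i).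
Proof.
apply: (@itg_coord_le4 _ i id 1 1) => // x.
have : 0 <= (`|x| ^+ 2 - 1) ^+ 2 by exact: sqr_ge0.
have : 0 <= (`|x| - 1) ^+ 2 by exact: sqr_ge0.
have -> : x ^+ 4 = (`|x| ^+ 2) ^+ 2 by rewrite real_normK ?num_real// -exprM.
have := normr_ge0 x; rewrite /= ; nra.
Qed.

Lemma itg_coord3 I (i : I) : itg (fun x => `|x i| ^+ 3).
Proof.
apply: (@itg_coord_le4 _ i (fun x => `|x| ^+ 3) 1 1) => //.
  by apply: measurable_funX; exact: normr_measurable.
move=> x; rewrite normrX normr_id.
have -> : x ^+ 4 = (`|x| ^+ 2) ^+ 2 by rewrite real_normK ?num_real// -exprM.
have := normr_ge0 x; set y := `|x| => y0.
have [y1|y1] := lerP y 1; first by apply: (@le_trans _ _ 1); rewrite ?expr_le1// mul1r lerDl -exprM exprn_ge0.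
have : 0 <= y ^+ 3 * (y - 1) by rewrite mulr_ge0// ?exprn_ge0//; lra.
by rewrite -exprM; lra.
Qed.

Lemma itg_coord2 I (i : I) : itg (fun x => x i ^+ 2).
Proof.
apply: (@itg_coord_le4 _ i (fun x => x ^+ 2) 1 1) => //.
move=> x; rewrite ger0_norm ?sqr_ge0//.
have -> : x ^+ 4 = (x ^+ 2) ^+ 2 by rewrite -exprM.
have := sqr_ge0 x; nra.
Qed.

Lemma itg_coordM I (i j : I) : itg (fun x => x i * x j).
Proof.
apply: (itg_le _ (itgD (@itg_coord2 _ i) (@itg_coord2 _ j))).
  by apply: measurable_funM; exact: measurable_coord.
move=> x; rewrite [leRHS]ger0_norm ?addr_ge0 ?sqr_ge0// normrM -(real_normK (num_real (x i))) -(real_normK (num_real (x j))).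
have : 0 <= (`|x i| - `|x j|) ^+ 2 by exact: sqr_ge0.
have := normr_ge0 (x i); have := normr_ge0 (x j); nra.
Qed.

Lemma Eg_coord I (i : I) : Eg (fun x => x i) = 0.
Proof.
have := @Eg_flip _ (fun j => j == i) (fun x => x i) (measurable_coord i).
rewrite eqxx expr1; under eq_fun do rewrite mulN1r -mulN1r.
move=> /(_ (itgZ _ (itg_coord i))); rewrite EgZ; last exact: itg_coord.
lra.
Qed.

Lemma Eg_coordM I (i j : I) : Eg (fun x => x i * x j) = (i == j)%:R.
Proof.
case: eqP => [->|/eqP ij].
  rewrite /Eg /Rintegral [X in fine X](_ : _ = 1%E)//.
  have m2 : measurable_fun setT (fun x : R => (x ^+ 2)%:E) by apply/measurable_EFinP; exact: measurable_funX.
  rewrite -integral_gauss1_sq -(@ge0_integral_coord _ j _ m2) => [|x]; last by rewrite lee_fin sqr_ge0.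
  by apply: eq_integral => x _; rewrite expr2.
have mM : measurable_fun setT (fun x : vec R I => x i * x j) by apply: measurable_funM; exact: measurable_coord.
have := @Eg_flip _ (fun k => k == i) (fun x => x i * x j) mM.
rewrite eqxx eq_sym (negbTE ij) expr1 expr0.
have -> : (fun x : vec R I => -1 * x i * (1 * x j)) = (fun x => -1 * (x i * x j)) by apply/funext => x; ring.
move=> /(_ (itgZ _ (itg_coordM i j))); rewrite EgZ; last exact: itg_coordM.
rewrite /=; lra.
Qed.

End gam.

(** * Comparison of Gaussian vectors *)

Section unit_valued.
Variable R : realType.
Implicit Types (I J : finType).

Lemma measurable_vec_coord d (T : measurableType d) I (W : T -> vec R I) (i : I) :
  measurable_fun setT W -> measurable_fun setT (fun t => W t i).
Proof. by move=> mW; exact: (measurableT_comp (measurable_coord i) mW). Qed.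

(** Values in [[0, 1]] are the regularity kept along the interpolation: besides measurability,
    nothing else is required for integrability and for exchanging expectations. *)
Lemma itg01 I (f : vec R I -> R) : measurable_fun setT f -> (forall x, 0 <= f x <= 1) -> itg f.
Proof.
move=> mf f01; apply: (itg_bounded (M := 1) mf) => x.
by have /andP[f0 f1] := f01 x; rewrite ger0_norm.
Qed.

Lemma Eg01E I (f : vec R I -> R) : measurable_fun setT f -> (forall x, 0 <= f x <= 1) ->
  (\int[gam R I]_x (f x)%:E)%E = (Eg f)%:E.
Proof.
move=> mf f01; rewrite /Eg /Rintegral fineK//.
exact: (integrable_fin_num measurableT (itg01 mf f01)).
Qed.

Lemma Eg01 I (f : vec R I -> R) : measurable_fun setT f -> (forall x, 0 <= f x <= 1) ->
  0 <= Eg f <= 1.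
Proof.
move=> mf f01; have hf := itg01 mf f01.
rewrite -{1}(Eg_cst I 0) -(Eg_cst I 1); apply/andP; split; apply: le_Eg => //; try exact: itg_cst.
- by move=> x; have /andP[] := f01 x.
- by move=> x; have /andP[] := f01 x.
Qed.

Lemma measurable_Eg01 d (T : measurableType d) J (f : T -> vec R J -> R) :
  measurable_fun setT (fun t : T * vec R J => f t.1 t.2) ->
  (forall x y, 0 <= f x y <= 1) -> measurable_fun setT (fun x => Eg (f x)).
Proof.
move=> mf f01; apply/measurable_EFinP.
have mfx x : measurable_fun setT (f x) by exact: (measurableT_comp mf (measurable_pair1 x)).
rewrite (_ : _ \o _ = (fun x => \int[gam R J]_y (f x y)%:E)%E); last first.
  by apply/funext => x /=; rewrite Eg01E.
apply: (@measurable_fun_fubini_tonelli_F _ _ _ _ R (gam R J) (fun t => (f t.1 t.2)%:E)).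
  exact/measurable_EFinP.
by move=> t; rewrite lee_fin; have /andP[] := f01 t.1 t.2.
Qed.

Lemma Eg_swap I J (f : vec R I -> vec R J -> R) :
  measurable_fun setT (fun t : vec R I * vec R J => f t.1 t.2) ->
  (forall x y, 0 <= f x y <= 1) ->
  Eg (fun x => Eg (f x)) = Eg (fun y => Eg (fun x => f x y)).
Proof.
move=> mf f01.
have mf' : measurable_fun setT (fun t : vec R J * vec R I => f t.2 t.1).
  exact: (measurableT_comp mf (@measurable_swap _ _ _ _)).
have mfx x : measurable_fun setT (f x) by exact: (measurableT_comp mf (measurable_pair1 x)).
have mfy y : measurable_fun setT (f^~ y) by exact: (measurableT_comp mf (measurable_pair2 y)).
apply: EFin_inj; rewrite -!Eg01E; first last.
- by move=> x; exact: Eg01.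
- exact: measurable_Eg01.
- by move=> x; exact: Eg01.
- exact: (@measurable_Eg01 _ (vec R J) _ (fun y x => f x y)).
under eq_integral do rewrite -Eg01E//.
under [RHS]eq_integral do rewrite -Eg01E//.
apply: (@fubini_tonelli _ _ _ _ R (gam R I) (gam R J) (fun t => (f t.1 t.2)%:E)).
  exact/measurable_EFinP.
by move=> t; rewrite lee_fin; have /andP[] := f01 t.1 t.2.
Qed.

Lemma Eg_law_prod I J (f : vec R (I + J)%type -> R) : measurable_fun setT f ->
  (forall x, 0 <= f x <= 1) -> Eg f = Eg (fun x => Eg (fun y => f (vcat x y))).
Proof.
move=> mf f01.
have mg := measurableT_comp mf (@measurable_vcat R I J).
have mfx x : measurable_fun setT (fun y => f (vcat x y)).
  exact: (measurableT_comp mg (measurable_pair1 x)).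
apply: EFin_inj; rewrite -!Eg01E//; first last.
- by move=> x; exact: Eg01.
- exact: (measurable_Eg01 (f := fun (x : vec R I) (y : vec R J) => f (vcat x y))).
under [RHS]eq_integral do rewrite -Eg01E//.
apply: gam_fubini; first exact/measurable_EFinP.
by move=> t; rewrite lee_fin; have /andP[] := f01 t.
Qed.

Lemma Eg_stable I (a b : R) (f : vec R I -> R) : 0 <= a -> 0 < b ->
  measurable_fun setT f -> (forall x, 0 <= f x <= 1) ->
  Eg (fun x => Eg (fun y => f (fun i => a * x i + b * y i))) =
  Eg (fun x => f (fun i => Num.sqrt (a ^+ 2 + b ^+ 2) * x i)).
Proof.
move=> a0 b0 mf f01.
pose c := Num.sqrt (a ^+ 2 + b ^+ 2).
have c0 : 0 < c by rewrite sqrtr_gt0 ltr_wpDl ?sqr_ge0// exprn_gt0.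
have c2 : c ^+ 2 = a ^+ 2 + b ^+ 2 by rewrite sqr_sqrtr// addr_ge0// sqr_ge0.
pose g (x : vec R I) := f (fun i => c * x i).
have mc : measurable_fun setT (fun x : vec R I => (fun i => c * x i) : vec R I).
  by apply: measurable_vecP => i; apply: measurable_funM => //; exact: measurable_coord.
have mg : measurable_fun setT g by exact: (measurableT_comp mf mc).
have mab : measurable_fun setT (fun t : vec R I * vec R I => f (fun i => a * t.1 i + b * t.2 i)).
  apply: (measurableT_comp mf); apply: measurable_vecP => i.
  by apply: measurable_funD; apply: measurable_funM => //; exact: measurable_vec_coord.
(* [gam_stable] wants the outer coefficient positive. That is [b], since [a] may vanish at an end of
   the interpolation, hence the exchange. *)
rewrite Eg_swap//; apply: EFin_inj; rewrite -!Eg01E//; first last.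
- move=> x; apply: Eg01 => //; exact: (measurableT_comp mab (measurable_pair2 x)).
- apply: (measurable_Eg01 (f := fun y x : vec R I => f (fun i => a * x i + b * y i))) => //.
  exact: (measurableT_comp mab (@measurable_swap _ _ _ _)).
under eq_integral => x _.
  rewrite -Eg01E//; last exact: (measurableT_comp mab (measurable_pair2 x)).
  over.
rewrite /= -(@gam_stable _ _ (b / c) (a / c) (EFin \o g)).
- apply: eq_integral => x _; apply: eq_integral => y _ /=; rewrite /g; congr (f _)%:E.
  by apply/funext => i; field; rewrite gt_eqF.
- by rewrite divr_gt0.
- by rewrite divr_ge0// ltW.
- by rewrite !expr_div_n -mulrDl addrC -c2 divff// expf_neq0// gt_eqF.
- exact/measurable_EFinP.
- by move=> t; rewrite lee_fin; have /andP[] := f01 (fun i => c * t i).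
Qed.

End unit_valued.

(** * The interpolation inequality *)

Section core.
Variable R : realType.
Implicit Types (I J M : finType).

(** For a standard Gaussian [x], [lin A x] is the centred Gaussian vector of covariance [gram A].
    Keeping the factor [A] avoids any square root of a covariance matrix. *)
Definition lin M I (A : M -> I -> R) (x : I -> R) : M -> R := fun a => \sum_i A a i * x i.
Definition gram M I (A : M -> I -> R) (a b : M) : R := \sum_i A a i * A b i.

Lemma measurable_lin M I (A : M -> I -> R) :
  measurable_fun setT (lin A : vec R I -> vec R M).
Proof.
apply: measurable_vecP => a; apply: measurable_sum => i.
by apply: measurable_funM => //; exact: measurable_coord.
Qed.

Lemma measurable_lin_comp d (T : measurableType d) M I (A : M -> I -> R) (x : T -> vec R I) a :
  measurable_fun setT x -> measurable_fun setT (fun t => lin A (x t) a).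
Proof.
move=> mx.
exact: (@measurable_vec_coord R _ _ _ (fun t => lin A (x t)) a (measurableT_comp (measurable_lin A) mx)).
Qed.

Lemma cube_normD_le (u v : R) : `|u + v| ^+ 3 <= 4 * (`|u| ^+ 3 + `|v| ^+ 3).
Proof.
apply: (@le_trans _ _ ((`|u| + `|v|) ^+ 3)).
  by rewrite ler_pXn2r ?nnegrE ?addr_ge0// ler_normD.
have := normr_ge0 u; have := normr_ge0 v; set a := `|u|; set b := `|v| => b0 a0.
have : 0 <= (a + b) * (a - b) ^+ 2 by rewrite mulr_ge0 ?sqr_ge0// addr_ge0.
have -> : (a + b) * (a - b) ^+ 2 = a ^+ 3 + b ^+ 3 - a ^+ 2 * b - a * b ^+ 2 by ring.
have -> : (a + b) ^+ 3 = a ^+ 3 + b ^+ 3 + 3 * (a ^+ 2 * b + a * b ^+ 2) by ring.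
lra.
Qed.

Lemma itg_cube_sum I (B : I -> R) : itg (fun y : vec R I => `|\sum_j B j * y j| ^+ 3).
Proof.
elim: (index_enum I) => [|j s IH].
  by under eq_fun do rewrite big_nil normr0 expr0n; exact: itg_cst.
have ms (r : seq I) : measurable_fun setT (fun y : vec R I => \sum_(k <- r) B k * y k).
  by apply: measurable_sum => k; apply: measurable_funM => //; exact: measurable_coord.
apply: (itg_le _ (itgZ 4 (itgD (itgZ (`|B j| ^+ 3) (itg_coord3 _ j)) IH))).
  by apply: measurable_funX; apply: (measurableT_comp (@normr_measurable R setT)); exact: ms.
move=> y; rewrite big_cons [leLHS]ger0_norm ?exprn_ge0//.
by apply: le_trans (ler_norm _); rewrite -exprMn -normrM cube_normD_le.
Qed.

Variables (M : finType) (Psi : (M -> R) -> R) (D1 : M -> (M -> R) -> R)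
  (D2 : M -> M -> (M -> R) -> R) (C : R).
(** [D1] and [D2] are just coefficient families for which this expansion holds uniformly in [z];
    [sm_taylor] provides it for the soft min-max. *)
Hypothesis taylor : forall z v : M -> R,
  `|Psi (fun a => z a + v a) - Psi z - \sum_a v a * D1 a z
    - 2^-1 * \sum_a \sum_b v a * v b * D2 a b z| <= C * \sum_a `|v a| ^+ 3.
Hypothesis D2_le : forall a b z, `|D2 a b z| <= C.
Hypothesis mPsi : measurable_fun (setT : set (vec R M)) Psi.
Hypothesis Psi01 : forall z, 0 <= Psi z <= 1.

(** The trace of the second derivative against the covariance of [lin A]: half of it is the rate of
    change of the expectation in the added variance [s^2]. *)
Definition hess I (A : M -> I -> R) (z : M -> R) := \sum_a \sum_b gram A a b * D2 a b z.

Lemma measurable_shift_lin d (T : measurableType d) J (B : M -> J -> R) (z : T -> vec R M)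
    (y : T -> vec R J) (s : R) : measurable_fun setT z -> measurable_fun setT y ->
  measurable_fun setT (fun t => Psi (fun a => z t a + s * lin B (y t) a)).
Proof.
move=> mz my; apply: (measurableT_comp mPsi); apply: measurable_vecP => a.
apply: measurable_funD; first exact: measurable_vec_coord.
apply: measurable_funM => //.
exact: measurable_lin_comp.
Qed.

(** Averaging the Taylor expansion over a centred Gaussian kills the linear term and turns the
    quadratic one into half a trace. [K] depends on third moments only, hence not on [z]. *)
Lemma Eg_taylor J (B : M -> J -> R) : exists2 K, 0 <= K & forall (z : M -> R) (s : R), 0 <= s ->
  `|Eg (fun y : vec R J => Psi (fun a => z a + s * lin B y a)) - Psi z - s ^+ 2 / 2 * hess B z|
    <= K * s ^+ 3.
Proof.
pose cub (y : vec R J) := \sum_a `|lin B y a| ^+ 3.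
have icub : itg cub by apply: itg_sum => a; exact: itg_cube_sum.
exists `|C * Eg cub| => // z s s0.
pose f (y : vec R J) := Psi (fun a => z a + s * lin B y a).
have mf : measurable_fun setT f by apply: measurable_shift_lin.
have itf : itg f by apply: itg01 => // y; exact: Psi01.
pose g1 (y : vec R J) := \sum_a D1 a z * (\sum_j B a j * y j).
pose g2 (y : vec R J) := \sum_a \sum_b D2 a b z * (\sum_i \sum_j B a i * B b j * (y i * y j)).
have it1 : itg g1.
  by apply: itg_sum => a; apply: itgZ; apply: itg_sum => j; apply: itgZ; exact: itg_coord.
have it2' a b : itg (fun y : vec R J => \sum_i \sum_j B a i * B b j * (y i * y j)).
  by apply: itg_sum => i; apply: itg_sum => j; apply: itgZ; exact: itg_coordM.
have it2 : itg g2.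
  by apply: itg_sum => a; apply: itg_sum => b; apply: itgZ; exact: it2'.
have E1 : Eg g1 = 0.
  rewrite Eg_sum => [|a]; last by apply: itgZ; apply: itg_sum => j; apply: itgZ; exact: itg_coord.
  rewrite big1// => a _; rewrite EgZ; last by apply: itg_sum => j; apply: itgZ; exact: itg_coord.
  rewrite Eg_sum => [|j]; last by apply: itgZ; exact: itg_coord.
  by rewrite big1 ?mulr0// => j _; rewrite EgZ ?Eg_coord ?mulr0//; exact: itg_coord.
have E2 : Eg g2 = hess B z.
  rewrite Eg_sum => [|a]; last by apply: itg_sum => b; apply: itgZ; exact: it2'.
  apply: eq_bigr => a _; rewrite Eg_sum => [|b]; last by apply: itgZ; exact: it2'.
  apply: eq_bigr => b _; rewrite EgZ// mulrC; congr (_ * _).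
  rewrite Eg_sum => [|i]; last by apply: itg_sum => j; apply: itgZ; exact: itg_coordM.
  apply: eq_bigr => i _; rewrite Eg_sum => [|j]; last by apply: itgZ; exact: itg_coordM.
  rewrite (bigD1 i)//= big1 => [|j ji]; last first.
    by rewrite EgZ ?Eg_coordM 1?eq_sym ?(negbTE ji) ?mulr0//; exact: itg_coordM.
  by rewrite EgZ ?Eg_coordM ?eqxx ?mulr1 ?addr0//; exact: itg_coordM.
have pw y : `|f y - Psi z - s * g1 y - s ^+ 2 / 2 * g2 y| <= s ^+ 3 * (C * cub y).
  have := taylor z (fun a => s * lin B y a); rewrite -/(f y).
  have -> : \sum_a s * lin B y a * D1 a z = s * g1 y.
    by rewrite mulr_sumr; apply: eq_bigr => a _; rewrite -mulrA (mulrC (lin _ _ _)).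
  have -> : 2^-1 * \sum_a \sum_b s * lin B y a * (s * lin B y b) * D2 a b z = s ^+ 2 / 2 * g2 y.
    rewrite /g2 [LHS]mulr_sumr [RHS]mulr_sumr; apply: eq_bigr => a _; rewrite [LHS]mulr_sumr [RHS]mulr_sumr; apply: eq_bigr => b _.
    have -> : \sum_i \sum_j B a i * B b j * (y i * y j) = lin B y a * lin B y b.
      rewrite /lin mulr_suml; apply: eq_bigr => i _; rewrite mulr_sumr; apply: eq_bigr => j _; ring.
    by ring.
  move=> h; apply: (le_trans h); rewrite le_eqVlt; apply/orP; left; apply/eqP.
  rewrite mulrCA; congr (_ * _); rewrite mulr_sumr; apply: eq_bigr => a _.
  by rewrite normrM exprMn (ger0_norm s0).
have itr : itg (fun y => s ^+ 3 * (C * cub y)) by do 2 apply: itgZ.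
have itp : itg (fun y => Psi z + (s * g1 y + s ^+ 2 / 2 * g2 y)).
  by apply: itgD; [exact: itg_cst|apply: itgD; exact: itgZ].
have Ep : Eg (fun y => Psi z + (s * g1 y + s ^+ 2 / 2 * g2 y)) = Psi z + s ^+ 2 / 2 * hess B z.
  rewrite EgD; [|exact: itg_cst|by apply: itgD; exact: itgZ].
  by rewrite Eg_cst EgD ?EgZ// ?E1 ?E2 ?mulr0 ?add0r//; exact: itgZ.
have Er : Eg (fun y => s ^+ 3 * (C * cub y)) <= `|C * Eg cub| * s ^+ 3.
  by rewrite EgZ ?EgZ//; [rewrite mulrC ler_wpM2r ?exprn_ge0// ler_norm|exact: itgZ].
rewrite ler_norml; apply/andP; split.
- have : Psi z + s ^+ 2 / 2 * hess B z <= Eg f + Eg (fun y => s ^+ 3 * (C * cub y)).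
    rewrite -Ep -EgD//; apply: le_Eg => //; first exact: itgD.
    by move=> y; have := pw y; rewrite ler_norml => /andP[]; lra.
  rewrite -/f; lra.
- have : Eg f <= Psi z + s ^+ 2 / 2 * hess B z + Eg (fun y => s ^+ 3 * (C * cub y)).
    rewrite -Ep -EgD//; apply: le_Eg => //; first exact: itgD.
    by move=> y; have := pw y; rewrite ler_norml => /andP[]; lra.
  rewrite -/f; lra.
Qed.

Lemma linD I (A : M -> I -> R) (u v : R) (x y : I -> R) a :
  lin A (fun i => u * x i + v * y i) a = u * lin A x a + v * lin A y a.
Proof.
rewrite /lin !mulr_sumr -big_split /=; apply: eq_bigr => i _; ring.
Qed.

Lemma measurable_Psi_comb d (T : measurableType d) I J (A : M -> I -> R) (B : M -> J -> R)
    (x : T -> vec R I) (y : T -> vec R J) (u v : R) :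
  measurable_fun setT x -> measurable_fun setT y ->
  measurable_fun setT (fun t => Psi (fun a => u * lin A (x t) a + v * lin B (y t) a)).
Proof.
move=> mx my; apply: measurable_shift_lin => //; apply: measurable_vecP => a.
apply: measurable_funM => //.
exact: measurable_lin_comp.
Qed.

Section interpolation.
Variables (I J : finType) (A : M -> I -> R) (B : M -> J -> R) (kap : R).
Hypothesis kap0 : 0 <= kap.
Hypothesis hess_le : forall (x : I -> R) (y : J -> R),
  let z := fun a => lin A x a + lin B y a in hess B z - hess A z <= kap * Psi z.

(** [u^2] and [v^2] are the variances given to the two processes; [path 1 0] and [path 0 1] are the
    two sides of the comparison. *)
Let path (u v : R) : R :=
  Eg (fun x : vec R I => Eg (fun y : vec R J => Psi (fun a => u * lin A x a + v * lin B y a))).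

(* Moves a variance [s^2] from the [A]-part of the path to its [B]-part. *)
Lemma path_step : exists2 K, 0 <= K & forall u v s, 0 <= u -> 0 <= v -> 0 < s -> s <= 1 ->
  path u (Num.sqrt (v ^+ 2 + s ^+ 2)) <=
  (1 + kap * s ^+ 2 / 2) * path (Num.sqrt (u ^+ 2 + s ^+ 2)) v + K * s ^+ 3.
Proof.
have [KA KA0 hA] := Eg_taylor A; have [KB KB0 hB] := Eg_taylor B.
pose HA := `|\sum_a \sum_b `|gram A a b| * C|.
have HA_ge z : `|hess A z| <= HA.
  apply: le_trans (ler_norm _); apply: (le_trans (ler_norm_sum _ _ _)); apply: ler_sum => a _.
  apply: (le_trans (ler_norm_sum _ _ _)); apply: ler_sum => b _.
  by rewrite normrM ler_wpM2l.
pose K := KA + KB + kap * (HA + KA).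
have HA0 : 0 <= HA by rewrite normr_ge0.
exists K; first by rewrite /K !addr_ge0// mulr_ge0// addr_ge0.
move=> u v s u0 v0 s0 s1.
pose z (x : vec R I) (y : vec R J) : M -> R := fun a => u * lin A x a + v * lin B y a.
pose EA x y := Eg (fun x' : vec R I => Psi (fun a => z x y a + s * lin A x' a)).
pose EB x y := Eg (fun y' : vec R J => Psi (fun a => z x y a + s * lin B y' a)).
have mz : measurable_fun setT (fun t : vec R I * vec R J => z t.1 t.2 : vec R M).
  apply: measurable_vecP => a; apply: measurable_funD; apply: measurable_funM => //.
    exact: (measurable_lin_comp _ _ measurable_fst).
  exact: (measurable_lin_comp _ _ measurable_snd).
have s0' := ltW s0.
(* Both increments are expanded at the common point [z x y]. There [hess_le] bounds the difference
   of the traces by [kap * Psi], and [Psi z] is replaced by [EA] at a cost of order [s^2], which the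
   factor [s^2] in front makes of order at most [s^3]. *)
have pw x y : EB x y <= (1 + kap * s ^+ 2 / 2) * EA x y + K * s ^+ 3.
  have := hA (z x y) s s0'; have := hB (z x y) s s0'.
  rewrite -/(EA x y) -/(EB x y) !ler_norml => /andP[_ b2] /andP[a1 _].
  have zE : z x y = (fun a => lin A (fun i => u * x i) a + lin B (fun j => v * y j) a).
    by apply/funext => a; rewrite /z /lin !mulr_sumr; congr (_ + _); apply: eq_bigr => i _; rewrite mulrCA.
  have := hess_le (fun i => u * x i) (fun j => v * y j); rewrite /= -zE => hk.
  have := HA_ge (z x y); rewrite ler_norml => /andP[g1 _].
  have /andP[p0 p1] := Psi01 (z x y).
  have s20 : 0 <= s ^+ 2 by rewrite exprn_ge0.
  have s32 : s ^+ 3 <= s ^+ 2 by rewrite exprS ler_piMl.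
  have s43 : s ^+ 2 * s ^+ 2 <= s ^+ 3.
    by rewrite -exprD (exprD _ 1 3) expr1 ler_piMl// exprn_ge0.
  have s30 : 0 <= s ^+ 3 by rewrite exprn_ge0.
  have s53 : s ^+ 2 * s ^+ 3 <= s ^+ 3 by rewrite ler_piMl// expr_le1.
  have q1 : s ^+ 2 / 2 * (hess B (z x y) - hess A (z x y)) <= s ^+ 2 / 2 * (kap * Psi (z x y)).
    by rewrite ler_wpM2l// divr_ge0.
  have q2 : - (s ^+ 2 / 2 * HA) <= s ^+ 2 / 2 * hess A (z x y).
    by rewrite -mulrN ler_wpM2l// divr_ge0.
  have q3 : kap * (s ^+ 2 / 2) * Psi (z x y) <= kap * (s ^+ 2 / 2) * (EA x y + s ^+ 2 / 2 * HA + KA * s ^+ 3).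
    by rewrite ler_wpM2l ?mulr_ge0 ?divr_ge0//; lra.
  have q4 : HA * (s ^+ 2 * s ^+ 2) <= HA * s ^+ 3 by rewrite ler_wpM2l.
  have q5 : KA * (s ^+ 2 * s ^+ 3) <= KA * s ^+ 3 by rewrite ler_wpM2l.
  have q6 : kap * (HA * (s ^+ 2 * s ^+ 2) / 4 + KA * (s ^+ 2 * s ^+ 3) / 2) <= kap * ((HA + KA) * s ^+ 3).
    rewrite ler_wpM2l//.
    have : 0 <= HA * s ^+ 3 by rewrite mulr_ge0.
    have : 0 <= KA * s ^+ 3 by rewrite mulr_ge0.
    lra.
  rewrite /K; lra.
have EBE : path u (Num.sqrt (v ^+ 2 + s ^+ 2)) = Eg (fun x => Eg (EB x)).
  congr Eg; apply/funext => x; rewrite /EB.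
  have mf : measurable_fun setT (fun y : vec R J => Psi (fun a => u * lin A x a + 1 * lin B y a)).
    by apply: measurable_Psi_comb.
  have := Eg_stable v0 s0 mf (fun _ => Psi01 _) => h.
  transitivity (Eg (fun y : vec R J => Psi (fun a => u * lin A x a + 1 * lin B (fun i => Num.sqrt (v ^+ 2 + s ^+ 2) * y i) a))).
    congr Eg; apply/funext => y; congr Psi; apply/funext => a; congr (_ + _).
    by rewrite mul1r /lin mulr_sumr; apply: eq_bigr => i _; rewrite mulrCA.
  rewrite -h; congr Eg; apply/funext => y; congr Eg; apply/funext => y'.
  by congr Psi; apply/funext => a; rewrite /z linD mul1r addrA.
have mEA0' (x : vec R I) : measurable_fun setT (fun t : vec R J * vec R I => Psi (fun a => z x t.1 a + s * lin A t.2 a)).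
  apply: measurable_shift_lin; last exact: measurable_snd.
  exact: (measurableT_comp (measurableT_comp mz (measurable_pair1 x)) measurable_fst).
(* The increment [x'] sits inside the [y] integral; it is moved next to [x] before stability merges
   the two. *)
have EAE : path (Num.sqrt (u ^+ 2 + s ^+ 2)) v = Eg (fun x => Eg (EA x)).
  rewrite /path.
  pose f (x : vec R I) := Eg (fun y : vec R J => Psi (fun a => 1 * lin A x a + v * lin B y a)).
  have mf : measurable_fun setT f.
    apply: (@measurable_Eg01 R _ (vec R I) J (fun x y => Psi (fun a => 1 * lin A x a + v * lin B y a))) => [|x y]; last exact: Psi01.
    by apply: measurable_Psi_comb.
  have f01 x : 0 <= f x <= 1 by apply: Eg01 => [|y]; [exact: measurable_Psi_comb|exact: Psi01].
  have := Eg_stable u0 s0 mf f01 => h.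
  transitivity (Eg (fun x : vec R I => f (fun i => Num.sqrt (u ^+ 2 + s ^+ 2) * x i))).
    congr Eg; apply/funext => x; congr Eg; apply/funext => y; congr Psi; apply/funext => a; congr (_ + _).
    by rewrite mul1r /lin mulr_sumr; apply: eq_bigr => i _; rewrite mulrCA.
  rewrite -h; congr Eg; apply/funext => x; rewrite /EA.
  rewrite (Eg_swap (mEA0' x) (fun _ _ => Psi01 _)).
  congr Eg; apply/funext => x'; congr Eg; apply/funext => y.
  by congr Psi; apply/funext => a; rewrite /z linD mul1r addrAC.
have EA01 x y : 0 <= EA x y <= 1.
  by apply: Eg01 => [|x']; [apply: measurable_shift_lin|exact: Psi01].
have EB01 x y : 0 <= EB x y <= 1.
  by apply: Eg01 => [|x']; [apply: measurable_shift_lin|exact: Psi01].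
have mEA : measurable_fun setT (fun t : vec R I * vec R J => EA t.1 t.2).
  apply: (@measurable_Eg01 R _ (vec R I * vec R J)%type I (fun t x' => Psi (fun a => z t.1 t.2 a + s * lin A x' a))) => [|t x']; last exact: Psi01.
  by apply: measurable_shift_lin; [exact: (measurableT_comp mz measurable_fst)|exact: measurable_snd].
have mEB : measurable_fun setT (fun t : vec R I * vec R J => EB t.1 t.2).
  apply: (@measurable_Eg01 R _ (vec R I * vec R J)%type J (fun t y' => Psi (fun a => z t.1 t.2 a + s * lin B y' a))) => [|t y']; last exact: Psi01.
  by apply: measurable_shift_lin; [exact: (measurableT_comp mz measurable_fst)|exact: measurable_snd].
have mEAx x : measurable_fun setT (EA x) by exact: (measurableT_comp mEA (measurable_pair1 x)).
have mEBx x : measurable_fun setT (EB x) by exact: (measurableT_comp mEB (measurable_pair1 x)).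
have iEAx x : itg (EA x) by exact: itg01.
have iEBx x : itg (EB x) by exact: itg01.
have iEA : itg (fun x => Eg (EA x)).
  by apply: itg01 => [|x]; [exact: measurable_Eg01|exact: Eg01].
have iEB : itg (fun x => Eg (EB x)).
  by apply: itg01 => [|x]; [exact: measurable_Eg01|exact: Eg01].
rewrite {}EBE {}EAE; clear mEA mEB mEAx mEBx EA01 EB01; clearbody EA EB.
rewrite -(EgZ _ iEA) -(Eg_cst I (K * s ^+ 3)) -(EgD (itgZ _ iEA) (itg_cst _ _)).
apply: (le_Eg iEB (itgD (itgZ _ iEA) (itg_cst _ _))) => x.
rewrite -(EgZ _ (iEAx x)) -(Eg_cst J (K * s ^+ 3)) -(EgD (itgZ _ (iEAx x)) (itg_cst _ _)).
exact: (le_Eg (iEBx x) (itgD (itgZ _ (iEAx x)) (itg_cst _ _))).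
Qed.

(** A discrete Gronwall argument with [N] moves of variance [1 / N]: the factors multiply to at most
    [exp (kap / 2)], and the [N] errors of order [N^(-3/2)] add up to a multiple of [N^(-1/2)],
    which vanishes in the limit. *)
Lemma gaussian_comparison :
  Eg (fun y : vec R J => Psi (lin B y)) <= expR (kap / 2) * Eg (fun x : vec R I => Psi (lin A x)).
Proof.
have [K K0 hK] := path_step.
have p1 : path 1 0 = Eg (fun x => Psi (lin A x)).
  congr Eg; apply/funext => x; rewrite -[RHS](Eg_cst J); congr Eg; apply/funext => y; congr Psi.
  by apply/funext => a; rewrite mul1r mul0r addr0.
have path_ge0 : 0 <= path 1 0.
  rewrite p1; have /andP[] // : 0 <= Eg (fun x : vec R I => Psi (lin A x)) <= 1.
  by apply: Eg01 => [|x]; [exact: (measurableT_comp mPsi (measurable_lin A))|exact: Psi01].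
have iter N k : (0 < N)%N -> (k <= N)%N ->
    path (Num.sqrt ((N - k)%:R / N%:R)) (Num.sqrt (k%:R / N%:R)) <=
    (1 + kap / N%:R / 2) ^+ k * (path 1 0 + k%:R * (K * Num.sqrt N%:R^-1 ^+ 3)).
  move=> N0; have N0' : 0 < N%:R :> R by rewrite ltr0n.
  have sN0 : 0 < Num.sqrt N%:R^-1 :> R by rewrite sqrtr_gt0 invr_gt0.
  have sN2 : Num.sqrt N%:R^-1 ^+ 2 = N%:R^-1 :> R by rewrite sqr_sqrtr// invr_ge0 ltW.
  have sN1 : Num.sqrt N%:R^-1 <= 1 :> R.
    by rewrite -[leRHS]sqrtr1 ler_wsqrtr// invf_le1// ler1n.
  have p0 : 0 <= K * Num.sqrt N%:R^-1 ^+ 3 by rewrite mulr_ge0// exprn_ge0// ltW.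
  have q0 : 0 <= kap / N%:R / 2 by rewrite !divr_ge0.
  elim: k => [_|k IH kN].
    by rewrite subn0 divff ?gt_eqF// sqrtr1 mul0r sqrtr0 expr0 mul1r mul0r addr0.
  have := hK (Num.sqrt ((N - k.+1)%:R / N%:R)) (Num.sqrt (k%:R / N%:R)) (Num.sqrt N%:R^-1)
    (sqrtr_ge0 _) (sqrtr_ge0 _) sN0 sN1.
  rewrite sN2 !sqr_sqrtr ?divr_ge0//.
  have -> : k%:R / N%:R + N%:R^-1 = k.+1%:R / N%:R :> R by rewrite -[X in _ + X]mul1r -mulrDl -natr1.
  have -> : (N - k.+1)%:R / N%:R + N%:R^-1 = (N - k)%:R / N%:R :> R.
    by rewrite -[X in _ + X]mul1r -mulrDl natr1 -subSn.
  move=> h; apply: (le_trans h).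
  have IH' := IH (ltnW kN).
  have : (1 + kap / N%:R / 2) * path (Num.sqrt ((N - k)%:R / N%:R)) (Num.sqrt (k%:R / N%:R)) <=
    (1 + kap / N%:R / 2) * ((1 + kap / N%:R / 2) ^+ k * (path 1 0 + k%:R * (K * Num.sqrt N%:R^-1 ^+ 3))).
    by rewrite ler_wpM2l// addr_ge0.
  have : K * Num.sqrt N%:R^-1 ^+ 3 <= (1 + kap / N%:R / 2) ^+ k.+1 * (K * Num.sqrt N%:R^-1 ^+ 3).
    by rewrite ler_peMl// exprn_ege1// lerDl.
  have ek : k.+1%:R = k%:R + 1 :> R by rewrite natr1.
  rewrite ek exprS; set X := K * _ ^+ 3; set c := 1 + kap / N%:R / 2; set q := path _ _; set r := path 1 0.
  rewrite (exprS c k); move: X c q r (c ^+ k) (k%:R) => X c q r D kk h1 h2.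
  have -> : c * D * (r + (kk + 1) * X) = c * (D * (r + kk * X)) + c * D * X by ring.
  exact: lerD.
have lim N : (0 < N)%N -> path 0 1 <= expR (kap / 2) * (path 1 0 + K * Num.sqrt N%:R^-1).
  move=> N0; have N0' : 0 < N%:R :> R by rewrite ltr0n.
  have sN2 : Num.sqrt N%:R^-1 ^+ 2 = N%:R^-1 :> R by rewrite sqr_sqrtr// invr_ge0 ltW.
  have := iter N N N0 (leqnn _); rewrite subnn mul0r sqrtr0 divff ?gt_eqF// sqrtr1.
  move=> h; apply: (le_trans h).
  have -> : N%:R * (K * Num.sqrt N%:R^-1 ^+ 3) = K * Num.sqrt N%:R^-1.
    by rewrite exprSr sN2 mulrCA mulrA mulrA mulrAC -mulrA [X in X * _]mulrC; field; rewrite gt_eqF.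
  rewrite ler_wpM2r//.
    by rewrite addr_ge0 ?mulr_ge0 ?sqrtr_ge0.
  have -> : kap / 2 = N%:R * (kap / N%:R / 2) by field; rewrite gt_eqF.
  rewrite expRM_natl ler_pXn2r ?nnegrE ?expR_ge0 ?expR_ge1Dx//.
  by rewrite addr_ge0// !divr_ge0.
have p2 : path 0 1 = Eg (fun y => Psi (lin B y)).
  rewrite -[RHS](Eg_cst I); congr Eg; apply/funext => x; congr Eg; apply/funext => y; congr Psi.
  by apply/funext => a; rewrite mul1r mul0r add0r.
rewrite -p1 -p2; apply/ler_addgt0Pr => e e0.
pose X := expR (kap / 2) * K.
have X0 : 0 <= X by rewrite mulr_ge0 ?expR_ge0.
pose r := e / (X + 1).
have r0 : 0 < r by rewrite divr_gt0// ltr_wpDl.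
have r2 : 0 <= r ^- 2 by rewrite invr_ge0 exprn_ge0// ltW.
have Nr := archi_boundP r2; set N := Num.bound _ in Nr.
have N0' : 0 < N%:R :> R by exact: le_lt_trans Nr.
have N0 : (0 < N)%N by rewrite -(ltr0n R).
apply: (le_trans (lim N N0)); rewrite mulrDr lerD2l mulrA -/X.
have : Num.sqrt N%:R^-1 <= r.
  rewrite -[leRHS](gtr0_norm r0) -sqrtr_sqr ler_wsqrtr//.
  by rewrite -[leRHS]invrK lef_pV2 ?posrE// ?invr_gt0 ?exprn_gt0// ltW.
move=> h; apply: (@le_trans _ _ (X * r)); first by rewrite ler_wpM2l.
by rewrite /r mulrCA ger_pMr// ler_pdivrMr ?mul1r ?lerDl// ltr_wpDl.
Qed.

End interpolation.
End core.

(** * The smooth minimax function *)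

Section derivatives.
Variable R : realType.
Implicit Types (f g : R -> R) (t a b c : R).

Definition der f t a := is_derive t (1 : R) f a.

Lemma derC c t : der (fun=> c) t 0.
Proof. exact: is_derive_cst. Qed.

Lemma derD f g t a b : der f t a -> der g t b -> der (fun x => f x + g x) t (a + b).
Proof. by move=> hf hg; exact: (is_deriveD hf hg). Qed.

Lemma derM f g t a b : der f t a -> der g t b -> der (fun x => f x * g x) t (a * g t + f t * b).
Proof.
move=> hf hg; have := is_deriveM hf hg.
by rewrite addrC [g t *: a]mulrC.
Qed.

Lemma derZ f t a c : der f t a -> der (fun x => c * f x) t (c * a).
Proof. by move=> hf; have := derM (derC c t) hf; rewrite mul0r add0r. Qed.

Lemma derN f t a : der f t a -> der (fun x => - f x) t (- a).
Proof. by move=> hf; have := derZ (-1) hf; under eq_fun do rewrite mulN1r; rewrite mulN1r. Qed.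

Lemma derV f t a : f t != 0 -> der f t a -> der (fun x => (f x)^-1) t (- a / f t ^+ 2).
Proof. by move=> ft hf; have := is_deriveV ft hf; rewrite /der mulNr -mulrN mulrC. Qed.

Lemma derexp f t a : der f t a -> der (fun x => expR (f x)) t (a * expR (f t)).
Proof. by move=> hf; have := is_derive1_comp (is_derive_expR (f t)) hf; rewrite /der mulrC. Qed.

Lemma derln f t a : 0 < f t -> der f t a -> der (fun x => ln (f x)) t (a / f t).
Proof. by move=> ft hf; have := is_derive1_comp (is_derive1_ln ft) hf; rewrite /der mulrC. Qed.

Lemma der_sum (I : finType) (F : I -> R -> R) t (d : I -> R) :
  (forall i, der (F i) t (d i)) -> der (fun x => \sum_i F i x) t (\sum_i d i).
Proof.
move=> h; elim: (index_enum I) => [|i s IH].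
  by rewrite big_nil; under eq_fun do rewrite big_nil; exact: derC.
by rewrite big_cons; under eq_fun do rewrite big_cons; exact: derD.
Qed.

Lemma der_line a b t : der (fun x => a + x * b) t b.
Proof.
have := derD (derC a t) (derM (@is_derive_id R R t 1) (derC b t)).
by rewrite add0r mulr0 addr0 mul1r.
Qed.

Lemma der_eq f t a b : a = b -> der f t a -> der f t b.
Proof. by move=> ->. Qed.

Lemma der_continuous f (d : R -> R) : (forall t, der f t (d t)) -> continuous f.
Proof.
move=> h t; apply: differentiable_continuous; apply/derivable1_diffP.
by have [] := h t.
Qed.

Lemma der_MVT f (d : R -> R) a b : a <= b -> (forall t, der f t (d t)) ->
  exists2 c, a <= c <= b & f b - f a = d c * (b - a).
Proof.
move=> ab h.
have [//|c] := MVT_segment ab (fun t _ => h t).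
  exact/continuous_subspaceT/der_continuous.
by rewrite in_itv /=; exists c.
Qed.

Lemma der_lipschitz f (d : R -> R) C : (forall t, der f t (d t)) -> (forall t, `|d t| <= C) ->
  forall t s, `|f t - f s| <= C * `|t - s|.
Proof.
move=> h dC; suff H s t : s <= t -> `|f t - f s| <= C * `|t - s|.
  move=> t s; case/orP: (le_total s t) => [/H//|/H].
  by rewrite distrC [X in _ * X]distrC.
move=> st; have [c _ ->] := der_MVT st h.
by rewrite normrM ler_wpM2r.
Qed.

(** The mean value theorem is applied to [f] minus its quadratic part and then to [f1]. A Lipschitz
    second derivative suffices, so no third derivative is ever computed; the constant is not
    sharp. *)
Lemma taylor1 f (f1 f2 : R -> R) C t : 0 <= t -> (forall x, der f x (f1 x)) ->
  (forall x, der f1 x (f2 x)) -> (forall x y, `|f2 x - f2 y| <= C * `|x - y|) ->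
  `|f t - f 0 - t * f1 0 - t ^+ 2 / 2 * f2 0| <= C * t ^+ 3.
Proof.
move=> t0 h1 h2 hC.
pose g x := f x + - (x * f1 0) + - (x * x * (f2 0 / 2)).
have hg x : der g x (f1 x - f1 0 - x * f2 0).
  have idx := @is_derive_id R R x 1.
  have := derD (derD (h1 x) (derN (derM idx (derC (f1 0) x))))
    (derN (derM (derM idx idx) (derC (f2 0 / 2) x))).
  by apply: der_eq; field.
have [c /andP[c0 ct]] := der_MVT t0 hg.
rewrite subr0 /g !mul0r => E.
have -> : f t - f 0 - t * f1 0 - t ^+ 2 / 2 * f2 0 = (f1 c - f1 0 - c * f2 0) * t by rewrite -E; field.
have [e /andP[e0 ec]] := der_MVT c0 h2; rewrite subr0 => ->.
have -> : f2 e * c - c * f2 0 = (f2 e - f2 0) * c by ring.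
have C0 : 0 <= C by have := hC 1 0; rewrite subr0 normr1 mulr1; exact: le_trans.
rewrite !normrM (ger0_norm t0) (ger0_norm c0) exprSr mulrA ler_wpM2r// expr2 mulrA.
apply: (@le_trans _ _ (C * e * c)).
  by rewrite ler_wpM2r//; have := hC e 0; rewrite subr0 (ger0_norm e0).
by rewrite -!mulrA ler_wpM2l// ler_pM// (le_trans ec).
Qed.

End derivatives.

Section bounded_lipschitz.
Variables (R : realType) (A : Type) (P : A -> Prop).
Implicit Types (F G : A -> R -> R).

(** Bounded Lipschitz families with one constant for all parameters in [P]. They form an algebra, so
    the Lipschitz bound on the second derivative of [sm] is assembled from its formula. *)
Definition bl F := exists2 C : R, 0 <= C & forall a, P a -> forall t s,
  `|F a t| <= C /\ `|F a t - F a s| <= C * `|t - s|.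

Lemma bl_const (c : A -> R) (C : R) : (forall a, P a -> `|c a| <= C) -> bl (fun a _ => c a).
Proof.
move=> cC; exists `|C| => // a Pa t s; split.
  by apply: (le_trans (cC a Pa)); exact: ler_norm.
by rewrite subrr normr0 mulr_ge0.
Qed.

Lemma bl_cst (c : R) : bl (fun _ _ => c).
Proof. exact: (@bl_const (fun=> c) `|c|). Qed.

Lemma blD F G : bl F -> bl G -> bl (fun a t => F a t + G a t).
Proof.
move=> [C C0 hF] [D D0 hG]; exists (C + D); first exact: addr_ge0.
move=> a Pa t s; have [f1 f2] := hF a Pa t s; have [g1 g2] := hG a Pa t s; split.
  by apply: (le_trans (ler_normD _ _)); exact: lerD.
rewrite opprD addrACA mulrDl; apply: (le_trans (ler_normD _ _)); exact: lerD.
Qed.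

Lemma blM F G : bl F -> bl G -> bl (fun a t => F a t * G a t).
Proof.
move=> [C C0 hF] [D D0 hG]; exists (2 * C * D + C * D); first by rewrite addr_ge0// !mulr_ge0.
move=> a Pa t s; have [f1 f2] := hF a Pa t s; have [g1 g2] := hG a Pa t s.
have [_ _] := hF a Pa s t; have [f1s _] := hF a Pa s t.
split.
  rewrite normrM; apply: (@le_trans _ _ (C * D)); first exact: ler_pM.
  by rewrite lerDr !mulr_ge0.
have -> : F a t * G a t - F a s * G a s = (F a t - F a s) * G a t + F a s * (G a t - G a s) by ring.
apply: (le_trans (ler_normD _ _)); rewrite !normrM.
apply: (@le_trans _ _ (C * `|t - s| * D + C * (D * `|t - s|))).
  by apply: lerD; apply: ler_pM.
have : 0 <= C * D * `|t - s| by rewrite !mulr_ge0.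
lra.
Qed.

Lemma blN F : bl F -> bl (fun a t => - F a t).
Proof.
move=> [C C0 hF]; exists C => // a Pa t s; have [f1 f2] := hF a Pa t s.
by rewrite normrN -opprD normrN.
Qed.

Lemma bl_sum (I : finType) (F : I -> A -> R -> R) : (forall i, bl (F i)) ->
  bl (fun a t => \sum_i F i a t).
Proof.
move=> h; elim: (index_enum I) => [|i s IH].
  have [C C0 hC] := bl_cst 0; exists C => // a Pa t u.
  rewrite !big_nil.
  exact: (hC a Pa t u).
by have [C C0 hC] := blD (h i) IH; exists C => // a Pa t u; rewrite !big_cons; exact: hC.
Qed.

Lemma bl_der F (d : A -> R -> R) (B C : R) :
  (forall a, P a -> forall t, `|F a t| <= B /\ der (F a) t (d a t) /\ `|d a t| <= C) -> bl F.
Proof.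
move=> h; exists (`|B| + `|C|); first exact: addr_ge0.
move=> a Pa t s; have [b _] := h a Pa t; split.
  by apply: (le_trans b); apply: (le_trans (ler_norm _)); rewrite lerDl.
apply: (@le_trans _ _ (C * `|t - s|)).
  by apply: (der_lipschitz (d := d a)) => u; have [_ []] := h a Pa u.
by rewrite ler_wpM2r//; apply: (le_trans (ler_norm _)); rewrite lerDr.
Qed.

End bounded_lipschitz.

Lemma sum_prod (V : nmodType) (I J : finType) (F : I * J -> V) :
  \sum_a F a = \sum_i \sum_j F (i, j).
Proof. by rewrite (pair_big predT predT (fun i j => F (i, j))) /=; apply: eq_bigr => -[]. Qed.

Section soft_minmax.
Variables (R : realType) (I J : finType) (i0 : I) (j0 : J) (beta theta : R).
Local Notation M := (I * J)%type.
Implicit Types (z v : M -> R) (i : I) (j : J).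

(** [sm_S z i ^ (1 / beta)] approximates the exponential of the largest entry of row [i], and the
    sum of inverses in [sm_T] favours the row where it is smallest. [sm_q z i] and [sm_p z] are the
    matching probability weights on columns and on rows. *)
Definition sm_S z i : R := \sum_j expR (beta * z (i, j)).
Definition sm_q z i j : R := expR (beta * z (i, j)) / sm_S z i.
Definition sm_T z : R := \sum_i (sm_S z i)^-1.
Definition sm_p z i : R := (sm_S z i)^-1 / sm_T z.
(* [sm_T z ^ (1 / beta)] approximates [exp (max_i min_j (- z (i, j)))] within a factor depending on
   [#|I|], [#|J|] and [beta] only, so [sm] is a smooth substitute for the indicator of
   [exists i, forall j, z (i, j) <= 0]. *)
Definition sm z : R := (1 + expR (- (theta * ln (sm_T z))))^-1.
Local Notation lam := (theta * beta).

Definition sm_D1 (a : M) z : R := - (lam * (sm z * (1 - sm z)) * (sm_p z a.1 * sm_q z a.1 a.2)).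
(** For distinct rows only the rank-one part remains, and at [theta = 1] its last factor is
    [- 2 beta sm], so the entry is nonpositive. The correction inside a row has no fixed sign, which
    is why Gordon's inequality needs equal covariances there. *)
Definition sm_D2 (a b : M) z : R :=
  lam * (sm z * (1 - sm z)) *
  (sm_p z a.1 * sm_p z b.1 * (sm_q z a.1 a.2 * sm_q z b.1 b.2) * (lam * (1 - 2 * sm z) - beta)
   + (a.1 == b.1)%:R * (beta * sm_p z a.1 *
       (2 * (sm_q z a.1 a.2 * sm_q z b.1 b.2) - (a.2 == b.2)%:R * sm_q z a.1 a.2))).

Lemma sm_S_gt0 z i : 0 < sm_S z i.
Proof.
rewrite /sm_S (bigD1 j0)//= ltr_pwDl ?expR_gt0//.
by apply: sumr_ge0 => j _; exact: expR_ge0.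
Qed.

Lemma sm_T_gt0 z : 0 < sm_T z.
Proof.
rewrite /sm_T (bigD1 i0)//= ltr_pwDl ?invr_gt0 ?sm_S_gt0//.
by apply: sumr_ge0 => i _; rewrite invr_ge0 ltW// sm_S_gt0.
Qed.

Lemma sm01 z : 0 <= sm z <= 1.
Proof.
have e0 := expR_ge0 (- (theta * ln (sm_T z))).
by rewrite /sm invr_ge0 addr_ge0//= invf_le1 ?lerDl// ltr_wpDr.
Qed.

Lemma sm_q01 z i j : 0 <= sm_q z i j <= 1.
Proof.
rewrite /sm_q divr_ge0 ?expR_ge0 ?(ltW (sm_S_gt0 _ _))//=.
rewrite ler_pdivrMr ?sm_S_gt0// mul1r /sm_S (bigD1 j)//= lerDl.
by apply: sumr_ge0 => k _; exact: expR_ge0.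
Qed.

Lemma sm_p01 z i : 0 <= sm_p z i <= 1.
Proof.
have S0 k := ltW (sm_S_gt0 z k).
rewrite /sm_p divr_ge0 ?invr_ge0 ?(ltW (sm_T_gt0 _))//=.
rewrite ler_pdivrMr ?sm_T_gt0// mul1r /sm_T (bigD1 i)//= lerDl.
by apply: sumr_ge0 => k _; rewrite invr_ge0.
Qed.

Lemma sum_sm_q z i : \sum_j sm_q z i j = 1.
Proof. by rewrite -mulr_suml divff// gt_eqF// sm_S_gt0. Qed.

Lemma sum_sm_p z : \sum_i sm_p z i = 1.
Proof. by rewrite -mulr_suml divff// gt_eqF// sm_T_gt0. Qed.

(* [sm_f2 z v] is the second derivative of [sm] at [z] in the direction [v]. *)
Definition sm_V z v i := \sum_j sm_q z i j * v (i, j).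
Definition sm_U z v := \sum_i sm_p z i * sm_V z v i.
Definition sm_V2 z v i := \sum_j sm_q z i j * v (i, j) ^+ 2.
Definition sm_f2 z v := lam * (sm z * (1 - sm z)) *
  (sm_U z v ^+ 2 * (lam * (1 - 2 * sm z) - beta) + beta * (\sum_i sm_p z i * (2 * sm_V z v i ^+ 2 - sm_V2 z v i))).

Local Notation line z v t := (fun a => z a + t * v a).

Lemma der_sm_S z v i t : der (fun t => sm_S (line z v t) i) t
  (beta * sm_V (line z v t) v i * sm_S (line z v t) i).
Proof.
apply: der_eq (der_sum _); last first.
  by move=> j; apply: derexp; apply: derZ; exact: der_line.
rewrite /sm_V mulr_sumr mulr_suml; apply: eq_bigr => j _ /=; rewrite /sm_q.
by field; rewrite gt_eqF// sm_S_gt0.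
Qed.

Lemma der_sm_q z v i j t : der (fun t => sm_q (line z v t) i j) t
  (beta * (sm_q (line z v t) i j * (v (i, j) - sm_V (line z v t) v i))).
Proof.
have S0 : sm_S (line z v t) i != 0 by rewrite gt_eqF// sm_S_gt0.
apply: der_eq (derM (derexp (derZ beta (der_line _ _ _))) (derV S0 (der_sm_S _ _ _ _))).
by rewrite /sm_q; field.
Qed.

Lemma der_sm_Sinv z v i t : der (fun t => (sm_S (line z v t) i)^-1) t
  (- (beta * sm_V (line z v t) v i / sm_S (line z v t) i)).
Proof.
have S0 : sm_S (line z v t) i != 0 by rewrite gt_eqF// sm_S_gt0.
by apply: der_eq (derV S0 (der_sm_S _ _ _ _)); field.
Qed.

Lemma der_sm_T z v t : der (fun t => sm_T (line z v t)) t
  (- (beta * sm_U (line z v t) v * sm_T (line z v t))).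
Proof.
apply: der_eq (der_sum (fun i => der_sm_Sinv z v i t)).
rewrite sumrN /sm_U mulr_sumr mulr_suml; congr (- _); apply: eq_bigr => i _; rewrite /sm_p.
field; rewrite !gt_eqF ?sm_S_gt0 ?sm_T_gt0//.
Qed.

Lemma der_sm_p z v i t : der (fun t => sm_p (line z v t) i) t
  (beta * (sm_p (line z v t) i * (sm_U (line z v t) v - sm_V (line z v t) v i))).
Proof.
have T0 : sm_T (line z v t) != 0 by rewrite gt_eqF// sm_T_gt0.
have S0 : sm_S (line z v t) i != 0 by rewrite gt_eqF// sm_S_gt0.
apply: der_eq (derM (der_sm_Sinv _ _ _ _) (derV T0 (der_sm_T _ _ _))).
by rewrite /sm_p; field; rewrite T0.
Qed.

Lemma der_sm z v t : der (fun t => sm (line z v t)) t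
  (- (lam * (sm (line z v t) * (1 - sm (line z v t))) * sm_U (line z v t) v)).
Proof.
have T0 := sm_T_gt0 (line z v t).
have e0 : 0 < 1 + expR (- (theta * ln (sm_T (line z v t)))) by rewrite ltr_wpDr// expR_ge0.
have h := derln (f := fun t => sm_T (line z v t)) T0 (der_sm_T z v t).
apply: der_eq (derV _ (derD (derC 1 t) (derexp (derN (derZ theta h))))); last exact: lt0r_neq0.
rewrite /sm; move: e0; set e := expR _ => e0; field.
by rewrite !gt_eqF.
Qed.

Lemma der_sm_V z v i t : der (fun t => sm_V (line z v t) v i) t
  (beta * (sm_V2 (line z v t) v i - sm_V (line z v t) v i ^+ 2)).
Proof.
apply: der_eq (der_sum (fun j => derM (der_sm_q z v i j t) (derC (v (i, j)) t))).
rewrite expr2 {2}/sm_V /sm_V2 mulr_suml -sumrB mulr_sumr; apply: eq_bigr => j _; ring.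
Qed.

Lemma der_sm_U z v t : der (fun t => sm_U (line z v t) v) t
  (beta * (sm_U (line z v t) v ^+ 2 -
    \sum_i sm_p (line z v t) i * (2 * sm_V (line z v t) v i ^+ 2 - sm_V2 (line z v t) v i))).
Proof.
apply: der_eq (der_sum (fun i => derM (der_sm_p z v i t) (der_sm_V z v i t))).
rewrite expr2 {2}/sm_U mulr_suml -sumrB mulr_sumr; apply: eq_bigr => i _; ring.
Qed.

Lemma der2_sm z v t : der (fun t => - (lam * (sm (line z v t) * (1 - sm (line z v t))) * sm_U (line z v t) v)) t
  (sm_f2 (line z v t) v).
Proof.
have h := der_sm z v t.
apply: der_eq (derN (derM (derZ lam (derM h (derD (derC 1 t) (derN h)))) (der_sm_U z v t))).
by rewrite /sm_f2; ring.
Qed.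

Lemma sum_D1 z v : \sum_a v a * sm_D1 a z = - (lam * (sm z * (1 - sm z)) * sm_U z v).
Proof.
rewrite sum_prod /sm_U mulr_sumr -sumrN; apply: eq_bigr => i _.
rewrite /sm_V !mulr_sumr -sumrN; apply: eq_bigr => j _; rewrite /sm_D1 /=; ring.
Qed.

(** Derivatives are only taken along lines; this identity matches the second one with the quadratic
    form of the coefficients [sm_D2]. *)
Lemma sum_D2 z v : \sum_a \sum_b v a * v b * sm_D2 a b z = sm_f2 z v.
Proof.
have UE : \sum_a v a * (sm_p z a.1 * sm_q z a.1 a.2) = sm_U z v.
  rewrite sum_prod; apply: eq_bigr => i _; rewrite /sm_V mulr_sumr; apply: eq_bigr => j _ /=; ring.
pose c := lam * (sm z * (1 - sm z)).
transitivity (\sum_a \sum_b (c * (lam * (1 - 2 * sm z) - beta) *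
   (v a * (sm_p z a.1 * sm_q z a.1 a.2)) * (v b * (sm_p z b.1 * sm_q z b.1 b.2))
   + c * beta * ((a.1 == b.1)%:R * (sm_p z a.1 * (2 * (sm_q z a.1 a.2 * v a) * (sm_q z b.1 b.2 * v b)
      - (a.2 == b.2)%:R * (sm_q z a.1 a.2 * v a * v b)))))).
  by apply: eq_bigr => a _; apply: eq_bigr => b _; rewrite /sm_D2 -/c; ring.
under eq_bigr do rewrite big_split /=; rewrite big_split /=.
rewrite /sm_f2 -/c [RHS]mulrDr; congr (_ + _).
  under eq_bigr do rewrite -mulr_sumr UE; rewrite -mulr_suml -mulr_sumr UE; ring.
under eq_bigr do rewrite -mulr_sumr; rewrite -mulr_sumr mulrA; congr (_ * _).
rewrite sum_prod; apply: eq_bigr => i _.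
transitivity (\sum_j \sum_j' sm_p z i * (2 * (sm_q z i j * v (i, j)) * (sm_q z i j' * v (i, j'))
  - (j == j')%:R * (sm_q z i j * v (i, j) * v (i, j')))).
  apply: eq_bigr => j _; rewrite sum_prod (bigD1 i)//= [X in _ + X]big1 ?addr0 => [|k ki].
    by apply: eq_bigr => j' _; rewrite eqxx mul1r.
  by apply: big1 => j' _; rewrite eq_sym (negbTE ki) mul0r.
under eq_bigr do rewrite -mulr_sumr; rewrite -mulr_sumr; congr (_ * _).
under eq_bigr do rewrite sumrB -mulr_sumr; rewrite sumrB; congr (_ - _).
  by rewrite -mulr_suml -mulr_sumr /sm_V expr2; ring.
rewrite /sm_V2; apply: eq_bigr => j _; rewrite (bigD1 j)//= big1 ?addr0 => [|k kj].
  by rewrite eqxx mul1r expr2 mulrA.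
by rewrite eq_sym (negbTE kj) mul0r.
Qed.

(** Bounded directions make the Lipschitz constants uniform in the base point; general directions
    are recovered by scaling in [sm_taylor]. *)
Let unit_dir (zv : (M -> R) * (M -> R)) := forall a, `|zv.2 a| <= 1.
Local Notation BL F := (bl unit_dir (fun zv t => F (line zv.1 zv.2 t) zv.2)).

Lemma normr01 (x : R) : 0 <= x <= 1 -> `|x| <= 1.
Proof. by move=> /andP[x0 x1]; rewrite ger0_norm. Qed.

Lemma normr_convex_le (K : finType) (w u : K -> R) : (forall k, 0 <= w k <= 1) ->
  \sum_k w k = 1 -> (forall k, `|u k| <= 1) -> `|\sum_k w k * u k| <= 1.
Proof.
move=> w01 w1 u1; apply: (le_trans (ler_norm_sum _ _ _)); rewrite -w1; apply: ler_sum => k _.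
have /andP[wk _] := w01 k.
by rewrite normrM (ger0_norm wk) ler_piMr.
Qed.

Lemma sm_V_le z v i : (forall a, `|v a| <= 1) -> `|sm_V z v i| <= 1.
Proof. by move=> v1; apply: normr_convex_le => [j||j]; [exact: sm_q01|exact: sum_sm_q|exact: v1]. Qed.

Lemma sm_U_le z v : (forall a, `|v a| <= 1) -> `|sm_U z v| <= 1.
Proof. by move=> v1; apply: normr_convex_le => [i||i]; [exact: sm_p01|exact: sum_sm_p|exact: sm_V_le]. Qed.

Lemma bl_sm_q i j : BL (fun z _ => sm_q z i j).
Proof.
apply: (@bl_der _ _ _ _ (fun zv t => let z := line zv.1 zv.2 t in
  beta * (sm_q z i j * (zv.2 (i, j) - sm_V z zv.2 i))) 1 (`|beta| * 2)) => -[z v] v1 t /=; split; last split.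
- exact/normr01/sm_q01.
- exact: der_sm_q.
- rewrite normrM ler_wpM2l// normrM -[leRHS]mul1r ler_pM// ?normr01 ?sm_q01//.
  by apply: (le_trans (ler_normB _ _)); apply: lerD; [exact: v1|exact: sm_V_le].
Qed.

Lemma bl_sm_p i : BL (fun z _ => sm_p z i).
Proof.
apply: (@bl_der _ _ _ _ (fun zv t => let z := line zv.1 zv.2 t in
  beta * (sm_p z i * (sm_U z zv.2 - sm_V z zv.2 i))) 1 (`|beta| * 2)) => -[z v] v1 t /=; split; last split.
- exact/normr01/sm_p01.
- exact: der_sm_p.
- rewrite normrM ler_wpM2l// normrM -[leRHS]mul1r ler_pM// ?normr01 ?sm_p01//.
  by apply: (le_trans (ler_normB _ _)); apply: lerD; [exact: sm_U_le|exact: sm_V_le].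
Qed.

Lemma bl_sm : BL (fun z _ => sm z).
Proof.
apply: (@bl_der _ _ _ _ (fun zv t => let z := line zv.1 zv.2 t in
  - (lam * (sm z * (1 - sm z)) * sm_U z zv.2)) 1 `|lam|) => -[z v] v1 t /=; split; last split.
- exact/normr01/sm01.
- exact: der_sm.
- have /andP[s0 s1] := sm01 (line z v t).
  rewrite normrN -mulrA normrM -[leRHS]mulr1 ler_wpM2l// normrM -[leRHS]mulr1 ler_pM//; last exact: sm_U_le.
  by rewrite normr01// mulr_ge0 ?subr_ge0//= mulr_ile1// ?subr_ge0// lerBlDr lerDl.
Qed.

Lemma bl_sm_f2 : BL sm_f2.
Proof.
have blv a : bl unit_dir (fun (zv : (M -> R) * (M -> R)) (_ : R) => zv.2 a).
  by apply: (@bl_const _ _ _ (fun zv => zv.2 a) 1) => zv; apply.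
have bls := bl_sm.
have bl1s : BL (fun z _ => 1 - sm z) by apply: blD; [exact: bl_cst|exact: blN].
have blV i : BL (fun z v => sm_V z v i) by apply: bl_sum => j; apply: blM; [exact: bl_sm_q|exact: blv].
have blV2 i : BL (fun z v => sm_V2 z v i).
  by apply: bl_sum => j; apply: blM; [exact: bl_sm_q|apply: blM; exact: blv].
have blU : BL sm_U by apply: bl_sum => i; apply: blM; [exact: bl_sm_p|exact: blV].
have blc c : bl unit_dir (fun (zv : (M -> R) * (M -> R)) (_ : R) => c) := bl_cst _ c.
apply: blM; first by apply: blM; [exact: blc|exact: blM].
apply: blD.
  apply: blM; first exact: blM.
  apply: blD; last exact: blc.
  by apply: blM; [exact: blc|apply: blD; [exact: blc|apply: blN; apply: blM; [exact: blc|]]].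
apply: blM; first exact: blc.
apply: bl_sum => i; apply: blM; first exact: bl_sm_p.
apply: blD; last exact: blN.
by apply: blM; [exact: blc|exact: blM].
Qed.

(** Write [v = r w] with [r] the largest [|v a|] and expand along the line of direction [w]. The
    remainder is of order [r^3], which is one of the terms of the sum of cubes. *)
Lemma sm_taylor : exists2 C : R, 0 <= C & forall z v : M -> R,
  `|sm (fun a => z a + v a) - sm z - \sum_a v a * sm_D1 a z
    - 2^-1 * \sum_a \sum_b v a * v b * sm_D2 a b z| <= C * \sum_a `|v a| ^+ 3.
Proof.
have [C C0 hC] := bl_sm_f2.
have max_le : forall v : M -> R, exists2 r, (forall a, `|v a| <= r) & 0 <= r /\ r ^+ 3 <= \sum_a `|v a| ^+ 3.
  move=> v; pose a0 := [arg max_(a > (i0, j0)) `|v a|]%O.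
  exists `|v a0|; last first.
    split => //; rewrite (bigD1 a0)//= lerDl; apply: sumr_ge0 => a _; exact: exprn_ge0.
  by rewrite /a0; case: arg_maxP => // a _ h b; exact: h.
exists C => // z v; have [r vr [r0 r3]] := max_le v.
have [r_eq0|r_neq0] := boolP (r == 0).
  have v0 a : v a = 0 by apply/eqP; rewrite -normr_le0 -(eqP r_eq0).
  have -> : (fun a => z a + v a) = z by apply/funext => a; rewrite v0 addr0.
  rewrite subrr big1 => [|a _]; last by rewrite v0 mul0r.
  rewrite big1 => [|a _]; last by rewrite big1// => b _; rewrite v0 !mul0r.
  rewrite mulr0 !subr0 normr0 mulr_ge0//; apply: sumr_ge0 => a _; exact: exprn_ge0.
have rp : 0 < r by rewrite lt_def r_neq0.
pose w a := v a / r.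
have w1 : unit_dir (z, w) by move=> a; rewrite /= /w normrM normfV (gtr0_norm rp) ler_pdivrMr// mul1r.
have vE a : v a = r * w a by rewrite /w mulrCA divff// mulr1.
have line0 : line z w 0 = z by apply/funext => a; rewrite mul0r addr0.
have := taylor1 r0 (der_sm z w) (der2_sm z w) (fun x y => (hC _ w1 x y).2).
rewrite line0 -sum_D1 -sum_D2.
have -> : line z w r = (fun a => z a + v a) by apply/funext => a; rewrite vE.
have -> : r * \sum_a w a * sm_D1 a z = \sum_a v a * sm_D1 a z.
  by rewrite mulr_sumr; apply: eq_bigr => a _; rewrite vE mulrA.
have -> : r ^+ 2 / 2 * (\sum_a \sum_b w a * w b * sm_D2 a b z) = 2^-1 * \sum_a \sum_b v a * v b * sm_D2 a b z.
  rewrite mulr_sumr [RHS]mulr_sumr; apply: eq_bigr => a _; rewrite mulr_sumr [RHS]mulr_sumr; apply: eq_bigr => b _.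
  by rewrite (vE a) (vE b); ring.
by move=> h; apply: (le_trans h); rewrite ler_wpM2l.
Qed.

Lemma sm_D2_le : exists C : R, forall a b z, `|sm_D2 a b z| <= C.
Proof.
exists (`|lam| * (`|lam| + `|beta| + `|beta| * 2)) => a b z.
have /andP[s0 s1] := sm01 z.
have q0 i j := sm_q01 z i j; have p0 i := sm_p01 z i.
have ss : `|sm z * (1 - sm z)| <= 1.
  by rewrite normr01// mulr_ge0 ?subr_ge0//= mulr_ile1// ?subr_ge0// lerBlDr lerDl.
have nM (x y : R) : `|x| <= 1 -> `|y| <= 1 -> `|x * y| <= 1.
  by move=> x1 y1; rewrite normrM mulr_ile1.
have nb (c : bool) : `|c%:R : R| <= 1 by case: c; rewrite ?normr1 ?normr0.
rewrite /sm_D2 normrM ler_pM//.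
  by rewrite normrM -[leRHS]mulr1 ler_wpM2l.
apply: (le_trans (ler_normD _ _)); apply: lerD.
  rewrite normrM -[leRHS]mul1r ler_pM//.
    by apply: (nM _ _); apply: (nM _ _); rewrite normr01.
  apply: (le_trans (ler_normB _ _)); rewrite lerD2r normrM -[leRHS]mulr1 ler_wpM2l//.
  by rewrite ler_norml; lra.
rewrite normrM -[leRHS]mul1r ler_pM// normrM ler_pM//.
  by rewrite normrM -[leRHS]mulr1 ler_wpM2l// normr01.
have /andP[qa0 qa1] := q0 a.1 a.2; have /andP[qb0 qb1] := q0 b.1 b.2.
have : 0 <= sm_q z a.1 a.2 * sm_q z b.1 b.2 <= 1 by rewrite mulr_ge0//= mulr_ile1.
move=> /andP[h1 h2]; rewrite ler_norml; case: (a.2 == b.2); rewrite ?mul1r ?mul0r; lra.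
Qed.

Lemma measurable_sm : measurable_fun setT (sm : vec R M -> R).
Proof.
have mS i : measurable_fun setT (fun z : vec R M => sm_S z i).
  apply: measurable_sum => j; apply: measurableT_comp => //; apply: measurable_funM => //.
  exact: measurable_coord.
have mV (f : vec R M -> R) : (forall z, 0 < f z) -> measurable_fun setT f -> measurable_fun setT (fun x => (f x)^-1).
  move=> f0 mf; rewrite (_ : (fun x => _) = (fun x => expR (- ln (f x)))); last first.
    by apply/funext => x; rewrite expRN lnK// posrE.
  by apply: measurableT_comp => //; apply: measurable_funN; exact: (measurableT_comp (@measurable_ln R)).
apply: (mV (fun z => 1 + expR (- (theta * ln (sm_T z))))) => [z|]; first by rewrite ltr_wpDr// expR_ge0.
apply: measurable_funD => //; apply: measurableT_comp => //; apply: measurable_funN.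
apply: measurable_funM => //; apply: (measurableT_comp (@measurable_ln R)).
by apply: measurable_sum => i; apply: (mV (fun z => sm_S z i)) => // z; exact: sm_S_gt0.
Qed.

End soft_minmax.

(** * Gordon's inequality *)

Section dot.
Variable R : realType.
Implicit Types (K : finType).

Definition dot K (x y : K -> R) : R := \sum_k x k * y k.
Definition norm2 K (x : K -> R) : R := Num.sqrt (dot x x).

Lemma dotC K (x y : K -> R) : dot x y = dot y x.
Proof. by apply: eq_bigr => k _; rewrite mulrC. Qed.

Lemma dotDl K (x y z : K -> R) : dot (fun k => x k + y k) z = dot x z + dot y z.
Proof. by rewrite -big_split; apply: eq_bigr => k _; rewrite mulrDl. Qed.

Lemma dotDr K (x y z : K -> R) : dot z (fun k => x k + y k) = dot z x + dot z y.
Proof. by rewrite dotC dotDl !(dotC z). Qed.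

Lemma dotZl K c (x z : K -> R) : dot (fun k => c * x k) z = c * dot x z.
Proof. by rewrite mulr_sumr; apply: eq_bigr => k _; rewrite mulrA. Qed.

Lemma dotZr K c (x z : K -> R) : dot z (fun k => c * x k) = c * dot z x.
Proof. by rewrite dotC dotZl dotC. Qed.

Lemma dotNl K (x z : K -> R) : dot (fun k => - x k) z = - dot x z.
Proof. by rewrite -sumrN; apply: eq_bigr => k _; rewrite mulNr. Qed.

Lemma dotNr K (x z : K -> R) : dot z (fun k => - x k) = - dot z x.
Proof. by rewrite dotC dotNl dotC. Qed.

Lemma dot0l K (z : K -> R) : dot (fun=> 0) z = 0.
Proof. by rewrite /dot big1// => k _; rewrite mul0r. Qed.

Lemma dot_ge0 K (x : K -> R) : 0 <= dot x x.
Proof. by apply: sumr_ge0 => k _; rewrite -expr2 sqr_ge0. Qed.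

Lemma norm2_ge0 K (x : K -> R) : 0 <= norm2 x. Proof. exact: sqrtr_ge0. Qed.

Lemma norm2_sq K (x : K -> R) : norm2 x ^+ 2 = dot x x.
Proof. by rewrite sqr_sqrtr// dot_ge0. Qed.

Lemma dot_CS_sq K (x y : K -> R) : dot x y ^+ 2 <= dot x x * dot y y.
Proof.
have h t : 0 <= dot x x - 2 * t * dot x y + t ^+ 2 * dot y y.
  have := dot_ge0 (fun k => x k + - (t * y k)).
  rewrite dotDl !dotDr !dotNl !dotNr !dotZl !dotZr (dotC y x); lra.
have [y0|yn0] := eqVneq (dot y y) 0.
  have [->|xy] := eqVneq (dot x y) 0; first by rewrite expr0n mulr_ge0// dot_ge0.
  (* When [dot y y = 0] the quadratic is affine in [t], and this [t] gives it the value [-1]. *)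
  have := h ((dot x x + 1) / (2 * dot x y)); rewrite y0 mulr0.
  have -> : 2 * ((dot x x + 1) / (2 * dot x y)) * dot x y = dot x x + 1 by field.
  lra.
have yp : 0 < dot y y by rewrite lt_def yn0 dot_ge0.
have := h (dot x y / dot y y).
have -> : dot x x - 2 * (dot x y / dot y y) * dot x y + (dot x y / dot y y) ^+ 2 * dot y y =
  (dot x x * dot y y - dot x y ^+ 2) / dot y y by field.
by rewrite pmulr_lge0 ?invr_gt0// subr_ge0.
Qed.

Lemma dot_CS K (x y : K -> R) : `|dot x y| <= norm2 x * norm2 y.
Proof.
rewrite -[leLHS]ger0_norm// -ler_sqr ?nnegrE ?mulr_ge0 ?norm2_ge0//.
by rewrite normr_id real_normK ?num_real// exprMn !norm2_sq dot_CS_sq.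
Qed.

Lemma dot_le K (x y : K -> R) : dot x y <= norm2 x * norm2 y.
Proof. exact: (le_trans (ler_norm _) (dot_CS _ _)). Qed.

Lemma dot_unit_le1 K (x y : K -> R) : dot x x = 1 -> dot y y = 1 -> dot x y <= 1.
Proof. by move=> x1 y1; apply: (le_trans (dot_le _ _)); rewrite /norm2 x1 y1 sqrtr1 mulr1. Qed.

End dot.

Section events.
Variable R : realType.
Implicit Types (I J K : finType).

Definition Pg K (E : set (vec R K)) : R := fine (gam R K E).

Lemma Pg_fin K (E : set (vec R K)) : measurable E -> (Pg E)%:E = gam R K E.
Proof. by move=> mE; rewrite /Pg fineK// fin_num_measure. Qed.

Lemma Pg_ge0 K (E : set (vec R K)) : 0 <= Pg E.
Proof. exact: fine_ge0. Qed.

Lemma Eg_indic K (E : set (vec R K)) : measurable E -> Eg (\1_E) = Pg E.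
Proof. by move=> mE; rewrite /Eg /Rintegral integral_indic// setIT. Qed.

Lemma indic01 K (E : set (vec R K)) x : 0 <= (\1_E x : R) <= 1.
Proof. by rewrite indicE; case: (_ \in _); rewrite ?ler01 ?lexx. Qed.

Lemma itg_indic K (E : set (vec R K)) : measurable E -> itg (\1_E).
Proof. by move=> mE; apply: itg01 => [|x]; [exact: measurable_indic|exact: indic01]. Qed.

Lemma Pg_le K (E F : set (vec R K)) : measurable E -> measurable F -> E `<=` F -> Pg E <= Pg F.
Proof.
by move=> mE mF EF; rewrite -lee_fin !Pg_fin// le_measure// inE.
Qed.

Lemma Pg_le_U K (E F G : set (vec R K)) : measurable E -> measurable F -> measurable G ->
  E `<=` F `|` G -> Pg E <= Pg F + Pg G.
Proof.
move=> mE mF mG EFG; rewrite -lee_fin EFinD !Pg_fin//.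
apply: (le_trans _ (measureU2 (gam R K) mF mG)).
by rewrite le_measure// inE//; exact: measurableU.
Qed.

Lemma Pg_le_Eg K (E : set (vec R K)) (f : vec R K -> R) c : measurable E -> itg f ->
  (forall x, 0 <= f x) -> (forall x, E x -> c <= f x) -> 0 <= c -> c * Pg E <= Eg f.
Proof.
move=> mE hf f0 fc c0; rewrite -Eg_indic// -EgZ; last exact: itg_indic.
apply: le_Eg => //; first by apply: itgZ; exact: itg_indic.
move=> x; rewrite indicE; case: (boolP (x \in E)) => [/set_mem/fc|_]; rewrite ?mulr1 ?mulr0//.
Qed.

Lemma measurable_le d (T : measurableType d) (f : T -> R) c : measurable_fun setT f ->
  measurable [set x | f x <= c].
Proof.
move=> mf; rewrite (_ : [set _ | _] = f @^-1` `]-oo, c]%classic).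
  by rewrite -[X in measurable X]setTI; exact: mf.
by apply/seteqP; split => x /=; rewrite in_itv.
Qed.

Lemma measurable_lt d (T : measurableType d) (f : T -> R) c : measurable_fun setT f ->
  measurable [set x | f x < c].
Proof.
move=> mf; rewrite (_ : [set _ | _] = f @^-1` `]-oo, c[%classic).
  by rewrite -[X in measurable X]setTI; exact: mf.
by apply/seteqP; split => x /=; rewrite in_itv.
Qed.

Lemma measurable_ge d (T : measurableType d) (f : T -> R) c : measurable_fun setT f ->
  measurable [set x | c <= f x].
Proof.
move=> mf; rewrite (_ : [set _ | _] = f @^-1` `[c, +oo[%classic).
  by rewrite -[X in measurable X]setTI; exact: mf.
by apply/seteqP; split => x /=; rewrite in_itv /= andbT.
Qed.

Lemma measurable_ex_all d (T : measurableType d) I J (E : I -> J -> set T) :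
  (forall i j, measurable (E i j)) -> measurable [set x | exists i, forall j, E i j x].
Proof.
move=> mE; rewrite (_ : [set _ | _] = \bigcup_(i in [set: I]) \bigcap_(j in [set: J]) E i j).
  apply: fin_bigcup_measurable; first exact: finite_finset.
  by move=> i _; apply: fin_bigcap_measurable; first exact: finite_finset.
apply/seteqP; split => x /= [i]; first by move=> h; exists i => // j _; exact: h.
by move=> _ h; exists i => j; exact: h.
Qed.

(** The two closed half-lines have equal mass by symmetry and cover the line. *)
Lemma Pg_coord_le0 : 2^-1 <= Pg [set z : vec R unit | z tt <= 0].
Proof.
have mi := @measurable_coord _ R unit tt.
have mE := measurable_le 0 mi.
have mF := measurable_ge 0 mi.
have mi1 : measurable_fun setT (\1_[set z : vec R unit | z tt <= 0] : _ -> R) by exact: measurable_indic.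
have := @Eg_flip _ unit (fun=> true) _ mi1.
have fE : (fun x : vec R unit => \1_[set z : vec R unit | z tt <= 0] (fun i => (-1) ^+ true * x i) : R) =
    \1_[set z : vec R unit | 0 <= z tt].
  apply/funext => x; rewrite !indicE; congr ((nat_of_bool _)%:R).
  by apply/idP/idP; rewrite !inE /= expr1 mulN1r oppr_le0.
rewrite fE => /(_ (itg_indic mF)); rewrite !Eg_indic// => e.
have : 1 <= Pg [set z : vec R unit | 0 <= z tt] + Pg [set z : vec R unit | z tt <= 0].
  apply: le_trans (Pg_le_U measurableT mF mE _).
    by rewrite -lee_fin Pg_fin// (@probability_setT _ _ _ (gam R unit)).
  by move=> z _ /=; case/orP: (le_total 0 (z tt)); [left|right].
by rewrite e; clear; move: (Pg _) => p; lra.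
Qed.

End events.

Section sm_comparison.
Variables (R : realType) (I J U V : finType) (i0 : I) (j0 : J).
Let M := (I * J)%type.
Variables (A : M -> U -> R) (B : M -> V -> R) (o : M -> R) (beta theta kap : R).

Lemma measurable_sm_shift :
  measurable_fun setT (fun z : vec R M => sm beta theta (fun a => z a + o a)).
Proof.
have ms : measurable_fun setT (fun z : vec R M => (fun a => z a + o a) : vec R M).
  by apply: measurable_vecP => a; apply: measurable_funD => //; exact: measurable_coord.
exact: (measurableT_comp (measurable_sm j0 beta theta) ms).
Qed.

(** The Hessian inequality is only asked at points that the two processes can reach, shifted by [o];
    the concentration argument uses the additive structure of these points. *)
Lemma sm_comparison : 0 <= kap ->
  (forall x y z, (forall a, z a = lin A x a + lin B y a + o a) ->
    hess (sm_D2 beta theta) B z - hess (sm_D2 beta theta) A z <= kap * sm beta theta z) ->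
  Eg (fun y : vec R V => sm beta theta (fun a => lin B y a + o a)) <=
  expR (kap / 2) * Eg (fun x : vec R U => sm beta theta (fun a => lin A x a + o a)).
Proof.
move=> kap0 hess_le; have [C C0 tay] := @sm_taylor R I J i0 j0 beta theta.
have [C' D2le] := @sm_D2_le R I J i0 j0 beta theta.
pose Psi (z : M -> R) := sm beta theta (fun a => z a + o a).
pose D1 (a : M) (z : M -> R) := sm_D1 beta theta a (fun a => z a + o a).
pose D2 (a b : M) (z : M -> R) := sm_D2 beta theta a b (fun a => z a + o a).
have h1 z v : `|Psi (fun a => z a + v a) - Psi z - \sum_a v a * D1 a z
    - 2^-1 * \sum_a \sum_b v a * v b * D2 a b z| <= Num.max C C' * \sum_a `|v a| ^+ 3.
  have -> : Psi (fun a => z a + v a) = sm beta theta (fun a => (z a + o a) + v a).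
    by congr sm; apply/funext => a; rewrite addrAC.
  apply: (le_trans (tay _ _)); rewrite ler_wpM2r ?le_max ?lexx//.
  by apply: sumr_ge0 => a _; exact: exprn_ge0.
have h2 a b z : `|D2 a b z| <= Num.max C C'.
  by apply: (le_trans (D2le _ _ _)); rewrite le_max lexx orbT.
have h4 z : 0 <= Psi z <= 1 by exact: sm01.
apply: (gaussian_comparison h1 h2 measurable_sm_shift h4 kap0) => x y.
exact: (hess_le x y).
Qed.

End sm_comparison.

Section gordon.
Variables (R : realType) (I J Rw Cl : finType) (i0 : I) (j0 : J).
Variables (w : I -> J -> Rw -> R) (mu : I -> J -> Cl -> R) (o : I -> J -> R) (eta : R).
Hypothesis w1 : forall i j, dot (w i j) (w i j) = 1.
Hypothesis mu1 : forall i j, dot (mu i j) (mu i j) = 1.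
(** Inside a row one of the two vectors is constant, which makes the two covariances agree there.
    The upper inclusion fixes [mu] along rows, the lower one fixes [w]. *)
Hypothesis wmu : forall i j j', dot (w i j) (w i j') = 1 \/ dot (mu i j) (mu i j') = 1.
Hypothesis eta0 : 0 < eta.

Definition bil (u : Rw -> R) (G : Rw * Cl -> R) (x : Cl -> R) := \sum_r \sum_c u r * G (r, c) * x c.

Let M := (I * J)%type.
Let AX (a : M) (k : Rw * Cl + unit) : R :=
  match k with inl rc => w a.1 a.2 rc.1 * mu a.1 a.2 rc.2 | inr _ => 1 end.
Let AY (a : M) (k : Cl + Rw) : R :=
  match k with inl c => mu a.1 a.2 c | inr r => w a.1 a.2 r end.

(** The thresholds [- eta] here and [eta] in [EY] leave a gap in which the smooth min-max replaces
    the indicator. *)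
Let EX := [set G : vec R (Rw * Cl)%type | exists i, forall j, bil (w i j) G (mu i j) + o i j <= - eta].
Let EY := [set y : vec R (Cl + Rw)%type | exists i, forall j,
  dot (mu i j) (fun c => y (inl c)) + dot (w i j) (fun r => y (inr r)) + o i j < eta].

Lemma linAX (x : Rw * Cl -> R) (z : unit -> R) a :
  lin AX (fun k => match k with inl i => x i | inr i => z i end) a = bil (w a.1 a.2) x (mu a.1 a.2) + z tt.
Proof.
rewrite /lin big_sumType /= (big_pred1 tt) => [|[]//]; rewrite mul1r; congr (_ + _).
by rewrite sum_prod; apply: eq_bigr => r _; apply: eq_bigr => c _ /=; rewrite mulrAC.
Qed.

Lemma linAY y a : lin AY y a = dot (mu a.1 a.2) (fun c => y (inl c)) + dot (w a.1 a.2) (fun r => y (inr r)).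
Proof. by rewrite /lin big_sumType. Qed.

Lemma gramAX a b : gram AX a b = dot (w a.1 a.2) (w b.1 b.2) * dot (mu a.1 a.2) (mu b.1 b.2) + 1.
Proof.
rewrite /gram big_sumType /= (big_pred1 tt) => [|[]//]; rewrite mulr1; congr (_ + _).
rewrite sum_prod /dot mulr_suml; apply: eq_bigr => r _.
by rewrite mulr_sumr; apply: eq_bigr => c _ /=; rewrite mulrACA.
Qed.

Lemma gramAY a b : gram AY a b = dot (mu a.1 a.2) (mu b.1 b.2) + dot (w a.1 a.2) (w b.1 b.2).
Proof. by rewrite /gram big_sumType. Qed.

Section beta.
Variable beta : R.
Hypothesis beta0 : 0 < beta.
Let Psi (z : M -> R) := sm beta 1 (fun a => z a + o a.1 a.2).

(** The difference of the covariances is [(1 - <w, w'>) (1 - <mu, mu'>)], which is nonnegative and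
    vanishes inside rows. Across rows it multiplies nonpositive second derivatives, so the
    comparison holds with [kap = 0]. *)
Lemma gordon_smooth : Eg (fun x => Psi (lin AX x)) <= Eg (fun y => Psi (lin AY y)).
Proof.
have h5 x y z : (forall a, z a = lin AY x a + lin AX y a + o a.1 a.2) ->
    hess (sm_D2 beta 1) AX z - hess (sm_D2 beta 1) AY z <= 0 * sm beta 1 z.
  move=> _; rewrite mul0r /hess -sumrB; apply: sumr_le0 => a _.
  rewrite -sumrB; apply: sumr_le0 => b _; rewrite -mulrBl.
  have -> : gram AX a b - gram AY a b =
      (1 - dot (w a.1 a.2) (w b.1 b.2)) * (1 - dot (mu a.1 a.2) (mu b.1 b.2)).
    by rewrite gramAX gramAY; ring.
  have g0 : 0 <= (1 - dot (w a.1 a.2) (w b.1 b.2)) * (1 - dot (mu a.1 a.2) (mu b.1 b.2)).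
    by rewrite mulr_ge0// subr_ge0 dot_unit_le1.
  rewrite /sm_D2; have [ab|ab] := eqVneq a.1 b.1.
    rewrite ab; have [->|->] := wmu b.1 a.2 b.2.
      by rewrite subrr mul0r mul0r.
    by rewrite subrr mulr0 mul0r.
  rewrite mul0r addr0; set s := sm _ _ _; set p := sm_p _ _ _; set p' := sm_p _ _ _.
  have /andP[s0 s1] : 0 <= s <= 1 by exact: sm01.
  have /andP[p0 _] : 0 <= p <= 1 by exact: sm_p01.
  have /andP[p'0 _] : 0 <= p' <= 1 by exact: sm_p01.
  set q := sm_q _ _ _ _; set q' := sm_q _ _ _ _.
  have /andP[q0 _] : 0 <= q <= 1 by exact: sm_q01.
  have /andP[q'0 _] : 0 <= q' <= 1 by exact: sm_q01.
  clearbody s p p' q q'.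
  apply: mulr_ge0_le0 => //; apply: mulr_ge0_le0.
    by rewrite mul1r !mulr_ge0 ?subr_ge0// ltW.
  apply: mulr_ge0_le0; first by rewrite !mulr_ge0.
  rewrite mul1r.
  have -> : beta * (1 - 2 * s) - beta = - (2 * beta * s) by ring.
  by rewrite oppr_le0 !mulr_ge0// ltW.
by have := sm_comparison i0 j0 (lexx 0) h5; rewrite mul0r expR0 mul1r.
Qed.
End beta.

(** A row with all entries at most [- eta] has [sm_S <= 1] once [exp (beta eta)] exceeds its length,
    so [sm_T >= 1], the level at which [sm] reaches one half. *)
Lemma sm_ge_half (beta theta : R) (z : M -> R) : 0 <= theta -> 0 < beta -> #|J|%:R <= expR (beta * eta) ->
  (exists i, forall j, z (i, j) <= - eta) -> 2^-1 <= sm beta theta z.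
Proof.
move=> th0 be0 hb [i hi].
have Si : sm_S beta z i <= 1.
  rewrite /sm_S; apply: (@le_trans _ _ (\sum_(j : J) expR (- (beta * eta)))).
    by apply: ler_sum => j _; rewrite ler_expR -mulrN ler_wpM2l// ltW.
  rewrite sumr_const -mulr_natl; apply: (@le_trans _ _ (expR (beta * eta) * expR (- (beta * eta)))).
    by rewrite ler_wpM2r// expR_ge0.
  by rewrite -expRD subrr expR0.
have T1 : 1 <= sm_T beta z.
  rewrite /sm_T (bigD1 i)//=; apply: (@le_trans _ _ (sm_S beta z i)^-1).
    by rewrite invf_ge1// sm_S_gt0.
  by rewrite lerDl; apply: sumr_ge0 => k _; rewrite invr_ge0 ltW// sm_S_gt0.
rewrite /sm lef_pV2 ?posrE ?ltr_wpDr ?expR_ge0//.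
have -> : 2 = 1 + 1 :> R by [].
by rewrite lerD2l -expR0 ler_expR oppr_le0 mulr_ge0// ln_ge0.
Qed.

Lemma sm_le_exp (beta theta : R) (z : M -> R) : sm beta theta z <= expR (theta * ln (sm_T beta z)).
Proof.
rewrite /sm; set x := theta * _.
rewrite -[leRHS]invrK -expRN lef_pV2 ?posrE ?expR_gt0 ?ltr_wpDr ?expR_ge0//.
by rewrite lerDr.
Qed.

(** One entry at least [eta] in each row bounds every [sm_S] below by [exp (beta eta)]; the
    resulting error vanishes as [beta] grows. *)
Lemma sm_le_of_ge (beta : R) (z : M -> R) : 0 < beta ->
  (forall i, exists j, eta <= z (i, j)) -> sm beta 1 z <= #|I|%:R * expR (- (beta * eta)).
Proof.
move=> be0 h; apply: (le_trans (sm_le_exp _ _ _)); rewrite mul1r lnK ?posrE ?sm_T_gt0//.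
rewrite /sm_T mulr_natl -sumr_const; apply: ler_sum => i _.
have [j hj] := h i.
rewrite expRN lef_pV2 ?posrE ?sm_S_gt0 ?expR_gt0//.
apply: (@le_trans _ _ (expR (beta * z (i, j)))); first by rewrite ler_expR ler_wpM2l// ltW.
by rewrite /sm_S (bigD1 j)//= lerDl; apply: sumr_ge0 => k _; exact: expR_ge0.
Qed.

Lemma measurable_bil u x : measurable_fun setT (fun G : vec R (Rw * Cl)%type => bil u G x).
Proof.
apply: measurable_sum => r; apply: measurable_sum => c.
by apply: measurable_funM => //; apply: measurable_funM => //; exact: measurable_coord.
Qed.

Lemma measurable_EX : measurable EX.
Proof.
apply: measurable_ex_all => i j.
apply: (@measurable_le R _ (vec R (Rw * Cl)%type) (fun G => bil (w i j) G (mu i j) + o i j)).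
by apply: measurable_funD => //; exact: measurable_bil.
Qed.

Lemma measurable_EY : measurable EY.
Proof.
apply: measurable_ex_all => i j.
apply: (@measurable_lt R _ (vec R (Cl + Rw)%type) (fun y => dot (mu i j) (fun c => y (inl c)) + dot (w i j) (fun r => y (inr r)) + o i j)).
apply: measurable_funD => //; apply: measurable_funD; apply: measurable_sum => k.
  by apply: measurable_funM => //; exact: measurable_coord.
by apply: measurable_funM => //; exact: measurable_coord.
Qed.

(* The comparison is between [w^T G mu + z] and [<g, mu> + <h, w>], with an extra independent
   Gaussian [z] making the variances agree; [z] is removed at the cost of a factor 2 by
   restricting to [z <= 0]. *)
Theorem gordon : Pg EX <= 4 * Pg EY.
Proof.
apply/ler_addgt0Pr => e e0.
pose nI : R := #|I|%:R; pose nJ : R := #|J|%:R.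
have nI0 : 0 <= nI by rewrite ler0n.
have nJ0 : 0 <= nJ by rewrite ler0n.
(* Through [1 + x <= exp x] this makes [exp (beta eta)] exceed both [#|J|] and [4 #|I| / e], as the
   two smoothing estimates require. *)
pose beta := (nJ + 4 * nI / e + 1) / eta.
have be : beta * eta = nJ + 4 * nI / e + 1 by rewrite divfK// gt_eqF.
have q0 : 0 <= 4 * nI / e by rewrite divr_ge0 ?mulr_ge0// ltW.
have be0 : 0 < beta by rewrite divr_gt0// ltr_wpDl// addr_ge0.
have hJ : nJ <= expR (beta * eta).
  by apply: le_trans (expR_ge1Dx _); rewrite be; lra.
have hI : 4 * (nI * expR (- (beta * eta))) <= e.
  have h : 4 * nI / e <= expR (beta * eta) by apply: le_trans (expR_ge1Dx _); rewrite be; lra.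
  rewrite expRN mulrA ler_pdivrMr ?expR_gt0//.
  by move: h; rewrite ler_pdivrMr// (mulrC _ e).
pose Psi (z : M -> R) := sm beta 1 (fun a => z a + o a.1 a.2).
have mPsi : measurable_fun (setT : set (vec R M)) Psi.
  exact: (measurable_sm_shift j0 (fun a => o a.1 a.2)).
have Psi01 z : 0 <= Psi z <= 1 by exact: sm01.
have mE0 : measurable [set z : vec R unit | z tt <= 0].
  exact: (measurable_le 0 (measurable_coord tt)).
(* The factor 4 is one half for [sm] on the event times one half for the auxiliary variable being
   nonpositive. *)
have low : Pg EX / 4 <= Eg (fun x => Psi (lin AX x)).
  have mf := measurableT_comp mPsi (measurable_lin AX).
  rewrite (Eg_law_prod mf (fun _ => Psi01 _)).
  have mg : measurable_fun setT (fun t : vec R (Rw * Cl)%type * vec R unit => Psi (lin AX (vcat t.1 t.2))).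
    exact: (measurableT_comp mf (@measurable_vcat _ _ _)).
  have mgx x : measurable_fun setT (fun z : vec R unit => Psi (lin AX (vcat x z))).
    exact: (measurableT_comp mg (measurable_pair1 x)).
  have igx x : itg (fun z : vec R unit => Psi (lin AX (vcat x z))).
    exact: (itg01 (mgx x) (fun _ => Psi01 _)).
  rewrite mulrC; apply: Pg_le_Eg measurable_EX _ _ _ _; rewrite ?invr_ge0//.
  - apply: itg01 => [|x]; last exact: (Eg01 (mgx x) (fun _ => Psi01 _)).
    exact: (measurable_Eg01 mg (fun _ _ => Psi01 _)).
  - by move=> x; have /andP[] := Eg01 (mgx x) (fun _ => Psi01 _).
  - move=> x [i hi]; apply: (@le_trans _ _ (2^-1 * Pg [set z : vec R unit | z tt <= 0])).
      have := Pg_coord_le0 R; have -> : 4^-1 = 2^-1 * 2^-1 :> R by field.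
      by move=> h; rewrite ler_wpM2l// invr_ge0.
    apply: (Pg_le_Eg mE0 (igx x)); [|move=> z /= z0|by rewrite invr_ge0].
      by move=> z; have /andP[] := Psi01 (lin AX (vcat x z)).
    apply: sm_ge_half => //; exists i => j.
    rewrite linAX /=; apply: le_trans (hi j); lra.
have up : Eg (fun y => Psi (lin AY y)) <= Pg EY + nI * expR (- (beta * eta)).
  rewrite -Eg_indic; last exact: measurable_EY.
  rewrite -(Eg_cst (Cl + Rw)%type (nI * expR (- (beta * eta)))) -EgD; [|exact: (itg_indic measurable_EY)|exact: itg_cst].
  apply: le_Eg.
  - apply: itg01 => [|y]; last exact: Psi01.
    exact: (measurableT_comp mPsi (measurable_lin AY)).
  - by apply: itgD; [exact: (itg_indic measurable_EY)|exact: itg_cst].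
  - move=> y; rewrite indicE; case: (boolP (y \in EY)) => [_|/negP h].
      by have /andP[_ h1] := Psi01 (lin AY y); apply: (le_trans h1); rewrite lerDl mulr_ge0// expR_ge0.
    rewrite add0r; apply: sm_le_of_ge => // i; apply: contrapT => hn; apply: h; rewrite inE /=.
    exists i => j; rewrite ltNge; apply/negP => hj; apply: hn; exists j.
    by rewrite linAY.
have := gordon_smooth be0; rewrite -/Psi => mid.
have : Pg EX / 4 <= Pg EY + nI * expR (- (beta * eta)).
  exact: (le_trans low (le_trans mid up)).
rewrite ler_pdivrMr// mulrC mulrDr => h; apply: (le_trans h).
by rewrite lerD2l.
Qed.

End gordon.

(** * Gaussian concentration *)

(** Splits the trace over the independent coordinates: each term is a second derivative in one
    direction, which [sum_D2] evaluates. *)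
Lemma hess_sum_sq (R : realType) (M N : finType) (F : M -> N -> R) (D2 : M -> M -> (M -> R) -> R) z :
  hess D2 F z = \sum_n \sum_a \sum_b F a n * F b n * D2 a b z.
Proof.
rewrite exchange_big /=; apply: eq_bigr => a _; rewrite exchange_big /=; apply: eq_bigr => b _.
by rewrite /gram mulr_suml.
Qed.

Section two_copies.
Variables (R : realType) (K J : finType) (j0 : J) (v : J -> K -> R).
Hypothesis v1 : forall j, dot (v j) (v j) <= 1.

Let M := (J * J)%type.
(** [lin A x] at [(i, j)] is [<v_j, x> - <v_i, x>], whose minimum over [i] of the maximum over [j]
    is exactly 0. [B] uses independent copies for the two terms, and the same min-max becomes the
    difference of the two maxima. *)
Let A (a : M) (k : K) : R := v a.2 k - v a.1 k.
Let B (a : M) (k : K + K) : R := match k with inl k => - v a.1 k | inr k => v a.2 k end.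

Lemma linA x a : lin A x a = dot (v a.2) x - dot (v a.1) x.
Proof. by rewrite /dot -sumrB; apply: eq_bigr => k _; rewrite mulrBl. Qed.

Lemma linB x a : lin B x a = dot (v a.2) (fun k => x (inr k)) - dot (v a.1) (fun k => x (inl k)).
Proof.
rewrite /lin big_sumType addrC; congr (_ + _).
by rewrite -sumrN; apply: eq_bigr => k _ /=; rewrite mulNr.
Qed.

Lemma dot_v_le i j : `|dot (v i) (v j)| <= 1.
Proof.
apply: (le_trans (dot_CS _ _)); rewrite -[leRHS]mulr1 ler_pM ?norm2_ge0//.
  by rewrite -sqrtr1 ler_wsqrtr.
by rewrite -sqrtr1 ler_wsqrtr.
Qed.


Variables (beta theta t : R).
Hypothesis beta0 : 0 < beta.
Hypothesis theta0 : 0 <= theta.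
Let lam := theta * beta.
Let Psi (z : M -> R) := sm beta theta (fun a => z a + t).

(** An additive splitting of [z] makes the column weights independent of the row, since the row term
    cancels in the quotient. *)
Lemma sm_q_split (b c : J -> R) (z : M -> R) i j : (forall a, z a = b a.2 - c a.1 + t) ->
  sm_q beta z i j = expR (beta * b j) / \sum_j expR (beta * b j).
Proof.
move=> zE; rewrite /sm_q /sm_S.
under eq_bigr do rewrite zE; rewrite zE /=.
have e j' : expR (beta * (b j' - c i + t)) = expR (beta * b j') * expR (beta * (t - c i)).
  by rewrite -expRD; congr expR; ring.
rewrite e; under eq_bigr do rewrite e; rewrite -mulr_suml.
have : 0 < \sum_j expR (beta * b j).
  by rewrite (bigD1 j0)//= ltr_pwDl ?expR_gt0//; apply: sumr_ge0 => k _; exact: expR_ge0.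
by move=> h; field; rewrite !gt_eqF// expR_gt0.
Qed.

(** Within each copy [A] and [B] have equal covariances, so only cross terms between the copies
    survive. All terms carrying [beta] alone cancel, and [kap] depends only on [lam = theta beta],
    which lets [beta] grow with [lam] fixed. *)
Lemma hess_two_copies (b c : J -> R) (z : M -> R) : (forall a, z a = b a.2 - c a.1 + t) ->
  hess (sm_D2 beta theta) B z - hess (sm_D2 beta theta) A z <= 2 * lam ^+ 2 * sm beta theta z.
Proof.
move=> zE; rewrite !hess_sum_sq big_sumType /=.
rewrite -big_split -sumrB /=.
pose p := sm_p beta z; pose q j := sm_q beta z j0 j; pose s := sm beta theta z.
have qE i j : sm_q beta z i j = q j by rewrite /q !(sm_q_split _ _ zE).
have p1 : \sum_i p i = 1 by exact: (sum_sm_p j0 j0).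
have q1 : \sum_j q j = 1 by exact: (sum_sm_q j0).
have q01 j : 0 <= q j <= 1 by exact: (sm_q01 j0).
clearbody q.
pose P k := \sum_i p i * v i k; pose Q k := \sum_j q j * v j k.
have termE k : \sum_a \sum_b B a (inl k) * B b (inl k) * sm_D2 beta theta a b z +
    \sum_a \sum_b B a (inr k) * B b (inr k) * sm_D2 beta theta a b z -
    \sum_a \sum_b A a k * A b k * sm_D2 beta theta a b z =
    2 * lam ^+ 2 * (s * (1 - s) * (1 - 2 * s)) * (P k * Q k).
  rewrite (sum_D2 beta theta z (fun a => B a (inl k))) (sum_D2 beta theta z (fun a => B a (inr k))).
  rewrite (sum_D2 beta theta z (fun a => A a k)).
  pose P2 := \sum_i p i * v i k ^+ 2; pose Q2 := \sum_j q j * v j k ^+ 2.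
  have V1 i : sm_V beta z (fun a => B a (inl k)) i = - v i k.
    rewrite /sm_V /=; under eq_bigr do rewrite qE.
    by rewrite -mulr_suml q1 mul1r.
  have V2 i : sm_V beta z (fun a => B a (inr k)) i = Q k.
    by rewrite /sm_V /=; under eq_bigr do rewrite qE.
  have V3 i : sm_V beta z (fun a => A a k) i = Q k - v i k.
    rewrite /sm_V /=; under eq_bigr do rewrite qE mulrBr.
    by rewrite sumrB /= -mulr_suml q1 mul1r.
  have W1 i : sm_V2 beta z (fun a => B a (inl k)) i = v i k ^+ 2.
    rewrite /sm_V2 /=; under eq_bigr do rewrite qE sqrrN.
    by rewrite -mulr_suml q1 mul1r.
  have W2 i : sm_V2 beta z (fun a => B a (inr k)) i = Q2.
    by rewrite /sm_V2 /=; under eq_bigr do rewrite qE.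
  have W3 i : sm_V2 beta z (fun a => A a k) i = Q2 - 2 * Q k * v i k + v i k ^+ 2.
    rewrite /sm_V2 /=.
    rewrite (eq_bigr (fun j => q j * v j k ^+ 2 - 2 * (q j * v j k) * v i k + q j * v i k ^+ 2)); last first.
      by move=> j _; rewrite qE /A /=; ring.
    by rewrite big_split sumrB /= -/Q2 -!mulr_suml q1 mul1r -mulr_sumr.
  have U1 : sm_U beta z (fun a => B a (inl k)) = - P k.
    by rewrite /sm_U -sumrN; apply: eq_bigr => i _; rewrite V1 mulrN.
  have U2 : sm_U beta z (fun a => B a (inr k)) = Q k.
    by rewrite /sm_U; under eq_bigr do rewrite V2; rewrite -mulr_suml p1 mul1r.
  have U3 : sm_U beta z (fun a => A a k) = Q k - P k.
    rewrite /sm_U; under eq_bigr do rewrite V3 mulrBr.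
    by rewrite sumrB -mulr_suml p1 mul1r.
  have X1 : \sum_i p i * (2 * sm_V beta z (fun a => B a (inl k)) i ^+ 2 - sm_V2 beta z (fun a => B a (inl k)) i) = P2.
    by apply: eq_bigr => i _; rewrite V1 W1 sqrrN; congr (_ * _); ring.
  have X2 : \sum_i p i * (2 * sm_V beta z (fun a => B a (inr k)) i ^+ 2 - sm_V2 beta z (fun a => B a (inr k)) i) = 2 * Q k ^+ 2 - Q2.
    by under eq_bigr do rewrite V2 W2; rewrite -mulr_suml p1 mul1r.
  have X3 : \sum_i p i * (2 * sm_V beta z (fun a => A a k) i ^+ 2 - sm_V2 beta z (fun a => A a k) i) = 2 * Q k ^+ 2 - Q2 - 2 * Q k * P k + P2.
    rewrite (eq_bigr (fun i => p i * (2 * Q k ^+ 2 - Q2) - 2 * Q k * (p i * v i k) + p i * v i k ^+ 2)); last first.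
      by move=> i _; rewrite V3 W3; ring.
    by rewrite big_split sumrB /= -mulr_suml -mulr_sumr p1 mul1r.
  rewrite /sm_f2 U1 U2 U3 [X in beta * X]X1 [X in _ + _ * (_ + beta * X) - _]X2 [X in _ - _ * (_ + beta * X)]X3 -/s /lam.
  ring.
rewrite (eq_bigr _ (fun k _ => termE k)) -mulr_sumr.
(* The sum is an average of the inner products [<v_i, v_j>] under the weights [p] and [q]. *)
have PQ : `|\sum_k P k * Q k| <= 1.
  have -> : \sum_k P k * Q k = \sum_i p i * \sum_j q j * dot (v i) (v j).
    rewrite [RHS](eq_bigr (fun i => \sum_k p i * v i k * Q k)); last first.
      move=> i _; rewrite mulr_sumr /Q.
      under [RHS]eq_bigr do rewrite mulr_sumr.
      rewrite exchange_big /=; apply: eq_bigr => j _.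
      by rewrite /dot !mulr_sumr; apply: eq_bigr => k _; ring.
    by rewrite exchange_big /=; apply: eq_bigr => k _; rewrite mulr_suml.
  apply: normr_convex_le => // [i|i]; first exact: (sm_p01 j0 j0).
  by apply: normr_convex_le => // j; exact: dot_v_le.
have /andP[s0 s1] : 0 <= s <= 1 by exact: sm01.
rewrite -/s; move: (\sum_k P k * Q k) PQ => X PQ.
have l0 : 0 <= 2 * lam ^+ 2 by apply: mulr_ge0 => //; exact: sqr_ge0.
rewrite -mulrA; apply: (ler_wpM2l l0).
rewrite -[leRHS]mulr1 -!mulrA; apply: (ler_wpM2l s0).
apply: (le_trans (ler_norm _)); rewrite !normrM -[leRHS]mulr1 ler_pM//.
  by rewrite ger0_norm; lra.
rewrite -[leRHS]mulr1 ler_pM// ler_norml; apply/andP; split; lra.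
Qed.

(** With a single copy the sums over rows and over columns cancel, so that no randomness is left on
    the side compared with. *)
Lemma sm_T_diff (b : J -> R) : sm_T beta (fun a : M => b a.2 - b a.1 + t) = expR (- (beta * t)).
Proof.
have Sp : 0 < \sum_j expR (beta * b j).
  by rewrite (bigD1 j0)//= ltr_pwDl ?expR_gt0//; apply: sumr_ge0 => k _; exact: expR_ge0.
rewrite /sm_T (eq_bigr (fun i => expR (beta * b i) * ((\sum_j expR (beta * b j))^-1 * expR (- (beta * t))))).
  by rewrite -mulr_suml mulrA mulfV ?mul1r// gt_eqF.
move=> i _; rewrite /sm_S /=.
rewrite (eq_bigr (fun j => expR (beta * b j) * expR (beta * t - beta * b i))); last first.
  by move=> j _; rewrite -expRD; congr expR; ring.
rewrite -mulr_suml invfM -[(expR _)^-1]expRN opprB expRD expRN.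
by rewrite mulrCA.
Qed.

Lemma two_copies_smooth : Eg (fun z => Psi (lin B z)) <= expR (lam ^+ 2 - lam * t).
Proof.
have kap0 : 0 <= 2 * lam ^+ 2 by apply: mulr_ge0 => //; exact: sqr_ge0.
have h5 x y z : (forall a, z a = lin A x a + lin B y a + t) ->
    hess (sm_D2 beta theta) B z - hess (sm_D2 beta theta) A z <= 2 * lam ^+ 2 * sm beta theta z.
  move=> zE; apply: (@hess_two_copies (fun j => dot (v j) x + dot (v j) (fun k => y (inr k)))
    (fun j => dot (v j) x + dot (v j) (fun k => y (inl k)))) => a.
  by rewrite zE linA linB; ring.
have := sm_comparison j0 j0 kap0 h5.
have -> : 2 * lam ^+ 2 / 2 = lam ^+ 2 by field.
move=> h; apply: (le_trans h); rewrite expRD; apply: ler_wpM2l; first exact: expR_ge0.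
rewrite -(Eg_cst K (expR (- (lam * t)))); apply: le_Eg; [|exact: itg_cst|].
  by apply: itg01 => [|y]; [exact: (measurableT_comp (measurable_sm_shift j0 (fun=> t) beta theta) (measurable_lin A))|exact: sm01].
move=> x; apply: (le_trans (sm_le_exp _ _ _)).
have -> : (fun a => lin A x a + t) = (fun a : M => dot (v a.2) x - dot (v a.1) x + t).
  by apply/funext => a; rewrite linA.
by rewrite (sm_T_diff (fun j => dot (v j) x)) expRK ler_expR mulrN mulrA.
Qed.

End two_copies.

(** The reverse triangle inequality in L2 after expansion: [v] is the L2 distance of a variable to
    the constant [n], and [e] the mean of the difference. *)
Lemma normr_sqrt_sub_le (R : realType) (v e n b : R) : `|e| <= v -> v <= b -> 0 <= n ->
  `|Num.sqrt (v ^+ 2 + (2 * n * e + n ^+ 2)) - n| <= b.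
Proof.
rewrite ler_norml => /andP[e1 e2] vb n0.
have v0 : 0 <= v by lra.
rewrite ler_norml; apply/andP; split.
  rewrite lerBrDr; have [h|h] := leP n b; first by apply: (le_trans _ (sqrtr_ge0 _)); lra.
  rewrite -[leLHS]ger0_norm; last by lra.
  by rewrite -sqrtr_sqr ler_wsqrtr//; nra.
rewrite lerBlDr -[leRHS]ger0_norm; last by lra.
by rewrite -sqrtr_sqr ler_wsqrtr//; nra.
Qed.

(** * Limits of finite maxima of linear forms *)

Section nets.
Variables (R : realType) (K : finType).

(** Describes support functions of subsets of the unit ball through finite nets. It is all that
    concentration needs, and covers both [|Pi_K x|] and the norm of a block of coordinates. *)
Definition sublin_approx (F : (K -> R) -> R) : Prop := forall e, 0 < e ->
  exists (J : finType) (j0 : J) (v : J -> K -> R), [/\ forall j, dot (v j) (v j) <= 1,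
    forall x j, dot (v j) x <= F x & forall x, exists j, F x <= dot (v j) x + e * norm2 x].

Variable F : (K -> R) -> R.
Hypothesis FA : sublin_approx F.

Lemma norm2_le1 (v : K -> R) : dot v v <= 1 -> norm2 v <= 1.
Proof. by move=> h; rewrite -sqrtr1; exact: ler_wsqrtr. Qed.

Lemma dot_le_norm2 (v x : K -> R) : dot v v <= 1 -> dot v x <= norm2 x.
Proof.
move=> h; apply: (le_trans (dot_le _ _)); rewrite -[leRHS]mul1r ler_wpM2r ?norm2_ge0//.
exact: norm2_le1.
Qed.

Lemma sublin_le_norm2 x : F x <= norm2 x.
Proof.
apply/ler_addgt0Pr => e e0.
have e1 : 0 < e / (1 + norm2 x) by rewrite divr_gt0// ltr_pwDl// norm2_ge0.
have [J [j0 [v [v1 _ /(_ x)[j hj]]]]] := FA e1.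
apply: (le_trans hj); rewrite lerD ?dot_le_norm2//.
rewrite mulrAC ler_pdivrMr ?ltr_pwDl ?norm2_ge0// ler_wpM2l ?(ltW e0)//.
by rewrite lerDr.
Qed.

Lemma sublin_ge_norm2 x : - norm2 x <= F x.
Proof.
have [J [j0 [v [v1 h _]]]] := FA ltr01.
apply: (le_trans _ (h x j0)); rewrite lerNl -dotNl dot_le_norm2//.
by rewrite dotNl dotNr opprK.
Qed.

Lemma measurable_dot (v : K -> R) : measurable_fun setT (fun x : vec R K => dot v x).
Proof.
by apply: measurable_sum => k; apply: measurable_funM => //; exact: measurable_coord.
Qed.

Lemma measurable_dotxx : measurable_fun setT (fun x : vec R K => dot x x).
Proof.
by apply: measurable_sum => k; apply: measurable_funM; exact: measurable_coord.
Qed.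

(** [F > c] is the union over [n] of the finite unions of half-spaces [c < <v_j, x>] given by nets
    of mesh [1 / (n + 1)]. *)
Lemma measurable_sublin : measurable_fun (setT : set (vec R K)) F.
Proof.
have e0 (n : nat) : 0 < n.+1%:R^-1 :> R by rewrite invr_gt0.
move=> _; apply: (measurability _ (RGenOInfty.measurableE R)) => //.
move=> _ [_ [c ->] <-]; rewrite setTI.
have /choice[E hE] : forall n : nat, exists E : set (vec R K), [/\ measurable E,
    forall x, E x -> c < F x & forall x, c + n.+1%:R^-1 * norm2 x < F x -> E x].
  move=> n; have [J [j0 [v [v1 vF Fv]]]] := FA (e0 n).
  exists (\bigcup_(j in [set: J]) [set x : vec R K | c < dot (v j) x]); split.
  - apply: fin_bigcup_measurable; first exact: finite_finset.
    move=> j _; rewrite -[X in measurable X]setTI.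
    have := measurable_dot (v j) measurableT (measurable_itv `]c, +oo[).
    by congr (measurable _); apply/seteqP; split => x /=; rewrite in_itv /= andbT.
  - by move=> x [j _] /= h; exact: (lt_le_trans h (vF _ _)).
  - move=> x h; have [j hj] := Fv x; exists j => //=.
    by rewrite -(ltrD2r (n.+1%:R^-1 * norm2 x)); exact: (lt_le_trans h hj).
rewrite (_ : _ @^-1` _ = \bigcup_n E n).
  by apply: bigcupT_measurable => n; have [] := hE n.
apply/seteqP; split => [x /=|x [n _] Ex].
  rewrite in_itv /= andbT => cF; have d0 : 0 < F x - c by rewrite subr_gt0.
  have n0 := norm2_ge0 x.
  pose n := Num.bound (norm2 x / (F x - c)).
  have hn : norm2 x / (F x - c) < n%:R.
    by apply: archi_boundP; rewrite divr_ge0// ltW.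
  exists n => //; have [_ _] := hE n; apply.
  rewrite addrC -ltrBrDr mulrC ltr_pdivrMr//.
  move: hn; rewrite ltr_pdivrMr// mulrC => hn; apply: (lt_trans hn).
  by rewrite ltr_pM2l// ltr_nat.
by have [_ /(_ _ Ex) h _] := hE n; rewrite /= in_itv /= h.
Qed.

Lemma itg_dotxx : itg (fun x : vec R K => dot x x).
Proof.
apply: itg_sum => k; have := @itg_coord2 R K k.
by congr itg; apply/funext => x; rewrite expr2.
Qed.

Lemma Eg_dotxx : Eg (fun x : vec R K => dot x x) = #|K|%:R.
Proof.
rewrite Eg_sum => [|k]; last exact: itg_coordM.
by under eq_bigr do rewrite Eg_coordM eqxx; rewrite sumr_const.
Qed.

Lemma Pg_norm2_ge M : 0 < M -> Pg [set x : vec R K | M ^+ 2 <= dot x x] <= #|K|%:R / M ^+ 2.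
Proof.
move=> M0; rewrite ler_pdivlMr ?exprn_gt0// mulrC -Eg_dotxx.
apply: Pg_le_Eg => //; [exact: (measurable_ge (M ^+ 2) measurable_dotxx)|exact: itg_dotxx|exact: dot_ge0|exact: sqr_ge0].
Qed.

Lemma itg_sublin_sq : itg (fun x => F x ^+ 2).
Proof.
apply: (itg_le _ itg_dotxx); first by apply: measurable_funX; exact: measurable_sublin.
move=> x; rewrite !ger0_norm ?sqr_ge0 ?dot_ge0// -norm2_sq -[leLHS]real_normK ?num_real//.
rewrite ler_sqr ?nnegrE ?norm2_ge0//.
by rewrite ler_norml sublin_le_norm2 sublin_ge_norm2.
Qed.

End nets.

Section concentration.
Variables (R : realType) (K : finType) (F : (K -> R) -> R).
Hypothesis FA : sublin_approx F.

Lemma measurable_inl (I J : finType) : measurable_fun setT (fun z : vec R (I + J)%type => (fun i => z (inl i)) : vec R I).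
Proof. by apply: measurable_vecP => i; exact: measurable_coord. Qed.

Lemma measurable_inr (I J : finType) : measurable_fun setT (fun z : vec R (I + J)%type => (fun i => z (inr i)) : vec R J).
Proof. by apply: measurable_vecP => i; exact: measurable_coord. Qed.

Lemma dot_inl_le (I J : finType) (z : I + J -> R) : dot (fun i => z (inl i)) (fun i => z (inl i)) <= dot z z.
Proof. by rewrite {2}/dot big_sumType lerDl; apply: sumr_ge0 => k _; rewrite -expr2 sqr_ge0. Qed.

Lemma measurable_Fdiff t : measurable [set z : vec R (K + K)%type | F (fun i => z (inr i)) + t <= F (fun i => z (inl i))].
Proof.
have mr := measurableT_comp (measurable_sublin FA) (@measurable_inr K K).
have ml := measurableT_comp (measurable_sublin FA) (@measurable_inl K K).
rewrite (_ : [set _ | _] = [set z : vec R (K + K)%type | t <= F (fun i => z (inl i)) - F (fun i => z (inr i))]).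
  exact: (measurable_ge t (measurable_funB ml mr)).
by apply/seteqP; split => z /=; rewrite lerBrDl.
Qed.

(** A Chernoff bound for the difference over two independent copies. Truncating at norm [M] makes
    the net error uniform, and the mass cut off is the arbitrary [e]. *)
Lemma Pg_Fdiff t : 0 < t ->
  Pg [set z : vec R (K + K)%type | F (fun i => z (inr i)) + t <= F (fun i => z (inl i))] <= 2 * expR (- (t ^+ 2 / 8)).
Proof.
move=> t0; apply/ler_addgt0Pr => e e0.
pose n : R := #|{: K + K}|%:R; have n0 : 0 <= n by rewrite ler0n.
(* Gives [n / M^2 <= e], the Markov bound on the event that the norm is at least [M]. *)
pose M := n / e + 1; have q0 : 0 <= n / e by rewrite divr_ge0// ltW.
have M0 : 0 < M by rewrite /M ltr_wpDl.
have hM : n / M ^+ 2 <= e.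
  rewrite ler_pdivrMr ?exprn_gt0// mulrC.
  have : n = (n / e) * e by rewrite divfK// gt_eqF.
  move: q0; rewrite /M; move: (n / e) => q q0 ->; rewrite ler_pM2r//; nra.
have t8 : 0 < t / 8 by rewrite divr_gt0.
have [J [j0 [v [v1 vF Fv]]]] := FA (divr_gt0 t8 M0).
have J0 : 0 < #|J|%:R :> R by rewrite ltr0n; apply/card_gt0P; exists j0.
pose beta := #|J|%:R / (t / 8); have be0 : 0 < beta by rewrite divr_gt0.
(* This sets [lam = t / 2]. Of the gap [t], one eighth goes to the net and one eighth to the
   smoothing; the remaining [3 t / 4] gives the exponent [lam^2 - 3 lam t / 4 = - t^2 / 8]. *)
pose theta := t / 2 / beta; have th0 : 0 <= theta by rewrite !divr_ge0// ltW.
pose B (a : J * J) (k : K + K) : R := match k with inl k => - v a.1 k | inr k => v a.2 k end.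
pose Psi z := sm beta theta (fun a => lin B z a + t * (3 / 4)).
have mPsi : measurable_fun (setT : set (vec R (K + K)%type)) Psi.
  exact: (measurableT_comp (measurable_sm_shift j0 (fun=> t * (3 / 4)) beta theta) (measurable_lin B)).
have P01 z : 0 <= Psi z <= 1 by exact: sm01.
pose N := [set z : vec R (K + K)%type | exists i, forall j, lin B z (i, j) <= - (t / 8) - t * (3 / 4)].
have mN : measurable N.
  apply: measurable_ex_all => i j.
  exact: (measurable_le _ (measurableT_comp (measurable_coord (i, j)) (measurable_lin B))).
have PN : Pg N <= 2 * expR (- (t ^+ 2 / 8)).
  have := two_copies_smooth j0 v1 beta theta (t * (3 / 4)); rewrite -/B -/Psi => up.
  have low : 2^-1 * Pg N <= Eg Psi.
    apply: (Pg_le_Eg mN (itg01 mPsi P01)) => [z|z [i hi]|//]; first by have /andP[] := P01 z.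
    apply: (@sm_ge_half _ _ _ j0 (t / 8)) => //.
      by apply: le_trans (expR_ge1Dx _); rewrite divfK ?gt_eqF// lerDr.
    by exists i => j /=; rewrite -lerBrDr.
  rewrite -ler_pdivrMl//; apply: (le_trans low); apply: (le_trans up).
  rewrite ler_expR /theta divfK ?gt_eqF//; lra.
have mD := measurable_ge (M ^+ 2) (@measurable_dotxx R (K + K)%type).
apply: (le_trans (Pg_le_U (measurable_Fdiff t) mN mD _)).
  move=> z /= hz; have [hM'|hM'] := leP (M ^+ 2) (dot z z); [by right|left].
  have zM : norm2 (fun i => z (inl i)) <= M.
    rewrite -ler_sqr ?nnegrE ?norm2_ge0 ?(ltW M0)// norm2_sq.
    exact: (le_trans (dot_inl_le z) (ltW hM')).
  have [i hi] := Fv (fun i => z (inl i)); exists i => j.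
  rewrite /B linB /=; have := vF (fun i => z (inr i)) j.
  have : t / 8 / M * norm2 (fun i => z (inl i)) <= t / 8.
    by rewrite mulrAC ler_pdivrMr// ler_wpM2l// ltW.
  by move: hi hz; clear; move: (dot _ _) (dot _ _) (F _) (F _) (t / 8 / M * _) => a b c d f; lra.
by apply: lerD => //; apply: (le_trans (Pg_norm2_ge _ M0)).
Qed.

Lemma Pg_prod (I J : finType) (A : set (vec R I)) (B : set (vec R J)) : measurable A -> measurable B ->
  Pg [set z : vec R (I + J)%type | A (fun i => z (inl i)) /\ B (fun j => z (inr j))] = Pg A * Pg B.
Proof.
move=> mA mB; apply/EFin_inj; rewrite EFinM !Pg_fin//; last first.
  apply: measurableI; rewrite -[X in measurable X]setTI; first exact: measurable_inl.
  exact: measurable_inr.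
rewrite -(gam_law (iid_prod (@gamP R I) (@gamP R J))).
  rewrite -product_measure1E//; congr (_ _); apply/seteqP; split => [[x y]|[x y]] //=.
apply: measurableI; rewrite -[X in measurable X]setTI; first exact: measurable_inl.
exact: measurable_inr.
Qed.

Lemma measurable_F_le c : measurable [set x : vec R K | F x <= c].
Proof. exact: (measurable_le c (measurable_sublin FA)). Qed.

Lemma measurable_F_ge c : measurable [set x : vec R K | c <= F x].
Proof. exact: (measurable_ge c (measurable_sublin FA)). Qed.

(** Independence of the two copies factorises the event that one is above [b] and the other below
    [a]; a lower bound on either factor then bounds the other. *)
Lemma tail_of_median a b t : 0 < t -> a + t <= b ->
  Pg [set x : vec R K | b <= F x] * Pg [set x : vec R K | F x <= a] <= 2 * expR (- (t ^+ 2 / 8)).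
Proof.
move=> t0 ab; rewrite -Pg_prod; [|exact: measurable_F_ge|exact: measurable_F_le].
apply: le_trans (Pg_Fdiff t0); apply: Pg_le; last first.
- by move=> z /= [h1 h2]; apply: le_trans h1; apply: le_trans ab; rewrite lerD2r.
- exact: measurable_Fdiff.
apply: measurableI; rewrite -[X in measurable X]setTI.
  exact: (measurable_inl measurableT (measurable_F_ge b)).
exact: (measurable_inr measurableT (measurable_F_le a)).
Qed.

Hypothesis F0 : forall x, 0 <= F x.

Lemma Pg_setT : Pg [set: vec R K] = 1.
Proof. by apply/EFin_inj; rewrite Pg_fin// (@probability_setT _ _ _ (gam R K)). Qed.

Lemma Pg_le1 (E : set (vec R K)) : measurable E -> Pg E <= 1.
Proof. by move=> mE; rewrite -[leRHS]Pg_setT; exact: Pg_le. Qed.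

(* An integer median up to an error 1, which spares the regularity of the law of [F] that an exact
   median would require. *)
Lemma approx_median : exists N : nat,
  2^-1 <= Pg [set x : vec R K | F x <= N%:R] /\ 2^-1 <= Pg [set x : vec R K | N%:R - 1 <= F x].
Proof.
have cover a b : a <= b -> 1 <= Pg [set x : vec R K | F x <= b] + Pg [set x : vec R K | a <= F x].
  move=> ab; rewrite -[X in X <= _]Pg_setT; apply: Pg_le_U => //; [exact: measurable_F_le|exact: measurable_F_ge|].
  by move=> x _ /=; case: (leP (F x) b) => h; [left|right; exact: (le_trans ab (ltW h))].
have ex : exists N : nat, 2^-1 <= Pg [set x : vec R K | F x <= N%:R].
  pose N := (#|K| + #|K|).+1; exists N.
  have N0 : 0 < N%:R :> R by rewrite ltr0n.
  have h1 : 1 <= Pg [set x : vec R K | F x <= N%:R] + Pg [set x : vec R K | N%:R ^+ 2 <= dot x x].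
    rewrite -[X in X <= _]Pg_setT; apply: Pg_le_U => //; first exact: measurable_F_le.
      exact: (measurable_ge _ (@measurable_dotxx R K)).
    move=> x _ /=; case: (leP (N%:R ^+ 2) (dot x x)) => h; [by right|left].
    apply: (le_trans (sublin_le_norm2 FA x)).
    by rewrite -ler_sqr ?nnegrE ?norm2_ge0 ?ler0n// norm2_sq ltW.
  have h2 : Pg [set x : vec R K | N%:R ^+ 2 <= dot x x] <= 2^-1.
    apply: (le_trans (Pg_norm2_ge _ N0)); rewrite ler_pdivrMr ?exprn_gt0//.
    have : 0 <= #|K|%:R :> R by rewrite ler0n.
    have -> : N%:R = #|K|%:R + #|K|%:R + 1 :> R by rewrite /N -addn1 !natrD.
    by move: (#|K|%:R) => u; nra.
  by move: h1 h2; move: (Pg _) (Pg _) => p q; lra.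
case: (ex_minnP ex) => n hn hmin; exists n; split; first exact: hn.
case: n hn hmin => [|N] hN hmin.
  rewrite [X in Pg X](_ : _ = setT) ?Pg_setT; first by rewrite invf_le1// ler1n.
  by apply/seteqP; split => // x _ /=; apply: le_trans (F0 x); rewrite sub0r lerN10.
have h : ~ (2^-1 <= Pg [set x : vec R K | F x <= N%:R]).
  by move=> /hmin; rewrite ltnn.
have := cover N%:R N%:R (lexx _).
rewrite [X in X - 1]mulrSr addrK; move/negP: h; rewrite -ltNge; move: (Pg _) (Pg _) => p q; lra.
Qed.

Section median.
Variable N : nat.
Hypothesis hN1 : 2^-1 <= Pg [set x : vec R K | F x <= N%:R].
Hypothesis hN2 : 2^-1 <= Pg [set x : vec R K | N%:R - 1 <= F x].

Lemma median_upper t : 0 < t -> Pg [set x : vec R K | N%:R + t <= F x] <= 4 * expR (- (t ^+ 2 / 8)).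
Proof.
move=> t0; have := @tail_of_median N%:R (N%:R + t) t t0 (lexx _).
have := Pg_ge0 [set x : vec R K | N%:R + t <= F x].
move: hN1; move: (Pg _) (Pg _) (expR _) => p q e; nra.
Qed.

Lemma median_lower t : 0 < t -> Pg [set x : vec R K | F x <= N%:R - 1 - t] <= 4 * expR (- (t ^+ 2 / 8)).
Proof.
move=> t0; have := @tail_of_median (N%:R - 1 - t) (N%:R - 1) t t0.
rewrite subrK => /(_ (lexx _)).
have := Pg_ge0 [set x : vec R K | F x <= N%:R - 1 - t].
move: hN2; move: (Pg _) (Pg _) (expR _) => p q e; nra.
Qed.

(** Subtracting 1 absorbs the gap between [N - 1] and [N], so that both tails of [F] apply to [Y]
    directly. *)
Let Y (x : vec R K) : R := (Num.max 0 (`|F x - N%:R| - 1)) ^+ 2.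

Lemma measurable_Y : measurable_fun setT Y.
Proof.
apply: measurable_funX; apply: measurable_maxr => //.
apply: measurable_funB => //; apply: measurableT_comp => //.
by apply: measurable_funB => //; exact: measurable_sublin.
Qed.

Lemma Y_tail (u : R) : 0 <= u -> Pg [set x | u < Y x] <= 8 * expR (- (u / 8)).
Proof.
have mY : measurable [set x | u < Y x].
  rewrite -[X in measurable X]setTI; have := measurable_Y measurableT (measurable_itv `]u, +oo[).
  by congr (measurable _); apply/seteqP; split => x /=; rewrite in_itv /= andbT.
rewrite le_eqVlt => /orP[/eqP u0|u0].
  rewrite -[in leRHS]u0 mul0r oppr0 expR0 mulr1; apply: (@le_trans _ _ 1); last by rewrite ler1n.
  exact: Pg_le1.
have su : 0 < Num.sqrt u by rewrite sqrtr_gt0.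
have uE : u = Num.sqrt u ^+ 2 by rewrite sqr_sqrtr// ltW.
apply: (@le_trans _ _ (Pg [set x : vec R K | N%:R + Num.sqrt u <= F x] + Pg [set x : vec R K | F x <= N%:R - 1 - Num.sqrt u])).
  apply: Pg_le_U => //; [exact: measurable_F_ge|exact: measurable_F_le|].
  move=> x /=; rewrite /Y {1}uE ltr_sqr ?nnegrE ?le_max ?lexx ?(ltW su)//.
  rewrite lt_max [X in X || _]ltNge (ltW su) /= => h.
  have [hh|hh] := leP 0 (F x - N%:R); [left|right]; move: h.
    by rewrite ger0_norm//; lra.
  by rewrite ltr0_norm//; lra.
by have := median_upper su; have := median_lower su; rewrite -uE; lra.
Qed.

Lemma Y_ge x : (F x - N%:R) ^+ 2 <= 2 + 2 * Y x.
Proof.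
rewrite /Y -[leLHS]real_normK ?num_real//.
move: (`|F x - N%:R| : R) (normr_ge0 (F x - N%:R)) => u u0.
have := sqr_ge0 (u - 2); have := sqr_ge0 (u : R).
by have [h|h] := leP (u - 1) 0; nra.
Qed.

(** The tail formula for expectations: the bound [8 exp (- u / 8)] is 64 times the exponential
    density of rate [1/8]. *)
Lemma EY_le : (\int[gam R K]_x (Y x)%:E <= 64%:E)%E.
Proof.
have mY := measurable_Y.
pose X : {RV (gam R K) >-> R} := mfun_Sub (mem_set mY).
have X0 x : 0 <= X x by rewrite sqr_ge0.
have := ge0_expectation_ccdf X0; rewrite unlock => ->.
have e8 : 0 <= 8^-1 :> R by rewrite invr_ge0.
have e8' : 0 < 8^-1 :> R by rewrite invr_gt0.
pose h (u : R) : \bar R := (64%:E * (exponential_pdf 8^-1 u)%:E)%E.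
apply: (@le_trans _ _ (\int[lebesgue_measure]_(u in `[0%R, +oo[) h u)%E).
  apply: ge0_le_integral; first exact: measurable_itv.
  - by move=> u _; exact: measure_ge0.
  - exact: (measurable_funTS (ccdf_measurable X)).
  - apply: measurable_funTS; apply: measurable_funeM; apply/measurable_EFinP.
    exact: measurable_exponential_pdf.
  move=> u /=; rewrite in_itv /= andbT => u0.
  have -> : h u = (8 * expR (- (u / 8)))%:E.
    rewrite /h -EFinM; congr EFin; rewrite exponential_pdfE// mulrA; congr (_ * expR _); first by field.
    by rewrite mulNr mulrC.
  have -> : ccdf X u = (Pg [set x | u < Y x])%:E.
    rewrite Pg_fin; last first.
      rewrite -[X in measurable X]setTI; have := mY measurableT _ (measurable_itv `]u, +oo[).
      by congr (measurable _); apply/seteqP; split => x /=; rewrite in_itv /= andbT.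
    congr (gam R K _); apply/seteqP; split => x /=; rewrite in_itv /= andbT//.
  by rewrite lee_fin; exact: Y_tail.
apply: (@le_trans _ _ (\int[lebesgue_measure]_u h u)%E).
  apply: ge0_subset_integral => //.
    apply: measurable_funeM; apply/measurable_EFinP; exact: measurable_exponential_pdf.
  by move=> u _; rewrite mule_ge0// lee_fin exponential_pdf_ge0.
rewrite ge0_integralZl//=; last 2 first.
  by apply/measurable_EFinP; exact: measurable_exponential_pdf.
  by move=> u _; rewrite lee_fin exponential_pdf_ge0.
by rewrite integral_exponential_pdf// mule1.
Qed.

(** [E (F - N)^2] is at most [2 + 2 * 64], hence at most [12^2]. Centring at the root mean square is
    what brings in [sqrt delta]. *)
Lemma second_moment_median : `|Num.sqrt (Eg (fun x => F x ^+ 2)) - N%:R| <= 12.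
Proof.
have N0 : 0 <= N%:R :> R by rewrite ler0n.
have mF := measurable_sublin FA.
have iY : itg Y.
  apply/integrableP; split; first by apply/measurable_EFinP; exact: measurable_Y.
  apply: (@le_lt_trans _ _ 64%:E); last exact: ltry.
  apply: le_trans EY_le; apply: ge0_le_integral => //.
  - by apply: measurableT_comp => //; apply/measurable_EFinP; exact: measurable_Y.
  - by apply/measurable_EFinP; exact: measurable_Y.
  - by move=> x _ /=; rewrite lee_fin ger0_norm// sqr_ge0.
have EY : Eg Y <= 64.
  rewrite -lee_fin; apply: le_trans EY_le.
  by rewrite /Eg /Rintegral fineK//; exact: (integrable_fin_num measurableT iY).
have iF2 := itg_sublin_sq FA.
have iF : itg F.
  apply: (itg_le mF (itgD (itg_cst K 1) iF2)) => x.
  by rewrite !ger0_norm ?addr_ge0 ?sqr_ge0//; move: (F x) => u; nra.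
pose e := Eg (fun x => F x - N%:R); pose V := Eg (fun x => (F x - N%:R) ^+ 2).
have iFN : itg (fun x => F x - N%:R) by apply: itgD => //; exact: itg_cst.
have iV : itg (fun x => (F x - N%:R) ^+ 2).
  apply: (itg_le _ (itgD (itg_cst K 2) (itgZ 2 iY))).
    by apply: measurable_funX; apply: measurable_funB.
  move=> x; rewrite [leLHS]ger0_norm ?sqr_ge0//; apply: (le_trans (Y_ge x)).
  exact: ler_norm.
have V_le : V <= 144.
  apply: (@le_trans _ _ (Eg (fun x => 2 + 2 * Y x))).
    by apply: (le_Eg iV (itgD (itg_cst K 2) (itgZ 2 iY))) => x; exact: Y_ge.
  rewrite EgD; [|exact: itg_cst|exact: itgZ].
  by rewrite Eg_cst EgZ//; lra.
have DE : Eg (fun x => F x ^+ 2) = V + (2 * N%:R * e + N%:R ^+ 2).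
  rewrite /V /e -EgZ// -(Eg_cst K (N%:R ^+ 2)) -EgD; [|exact: itgZ|exact: itg_cst].
  rewrite -EgD//; last by apply: itgD; [exact: itgZ|exact: itg_cst].
  by congr Eg; apply/funext => x; ring.
have eV : e ^+ 2 <= V.
  have : 0 <= Eg (fun x => (F x - N%:R) ^+ 2 + (- (2 * e) * (F x - N%:R) + e ^+ 2)).
    rewrite -(Eg_cst K 0); apply: le_Eg; first exact: itg_cst.
      by apply: itgD => //; apply: itgD; [exact: itgZ|exact: itg_cst].
    by move=> x; have := sqr_ge0 (F x - N%:R - e); lra.
  rewrite EgD//; last by apply: itgD; [exact: itgZ|exact: itg_cst].
  rewrite EgD; [|exact: itgZ|exact: itg_cst].
  by rewrite EgZ// Eg_cst -/V -/e; lra.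
have e12 : `|e| <= Num.sqrt V by rewrite -sqrtr_sqr ler_wsqrtr.
have V0 : 0 <= V by apply: le_trans eV; exact: sqr_ge0.
have v12 : Num.sqrt V <= 12.
  by rewrite -[leRHS]ger0_norm// -sqrtr_sqr ler_wsqrtr//; move: V_le; lra.
have vV : V = Num.sqrt V ^+ 2 by rewrite sqr_sqrtr.
by rewrite DE vV; apply: normr_sqrt_sub_le.
Qed.
End median.

(** The constant 13 is 12 for the distance between [D] and [N], plus 1 for the approximate
    median. *)
Theorem sublin_concentration (D := Num.sqrt (Eg (fun x => F x ^+ 2))) t : 0 < t ->
  Pg [set x : vec R K | D + 13 + t <= F x] <= 4 * expR (- (t ^+ 2 / 8)) /\
  Pg [set x : vec R K | F x <= D - 13 - t] <= 4 * expR (- (t ^+ 2 / 8)).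
Proof.
move=> t0; have [N [h1 h2]] := approx_median.
have := second_moment_median h1 h2; rewrite -/D ler_norml => /andP[d1 d2].
split.
  apply: le_trans (median_upper h1 t0); apply: Pg_le; [exact: measurable_F_ge..|].
  by move=> x /=; apply: le_trans; lra.
apply: le_trans (median_lower h2 t0); apply: Pg_le; [exact: measurable_F_le..|].
by move=> x /= h; apply: (le_trans h); lra.
Qed.

End concentration.

(** * Nets, metric projections and separation *)

Section finite_nets.
Variables (R : realType) (K : finType).

(** Points of [S] in the same cell of a cubic grid are close. One representative is taken per cell
    that [S] meets, and [s0] for the others, so the net lies inside [S]. *)
Lemma finite_net (S : set (K -> R)) (s0 : K -> R) (e : R) : S s0 -> (forall x, S x -> dot x x <= 1) -> 0 < e ->
  exists (J : finType) (j0 : J) (v : J -> K -> R),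
    (forall j, S (v j)) /\ forall x, S x -> exists j, norm2 (fun k => x k - v j k) <= e.
Proof.
move=> Ss0 S1 e0.
pose n := (Num.bound (#|K|%:R / e)).+1.
have n0 : 0 < n%:R :> R by rewrite ltr0n.
have hn : #|K|%:R / e <= n%:R.
  apply: (@le_trans _ _ (Num.bound (#|K|%:R / e))%:R); last by rewrite ler_nat.
  by apply: ltW; apply: archi_boundP; rewrite divr_ge0// ltW.
(* Coordinates lie in [[-1, 1]], so the shifted and scaled ones lie in [[0, 2 n]], which gives
   [2 n + 1] possible integer parts. *)
pose cell (x : K -> R) : {ffun K -> 'I_(n + n).+1} := [ffun k => inord (Num.truncn ((x k + 1) * n%:R))].
have cellP x y : S x -> S y -> cell x = cell y -> norm2 (fun k => x k - y k) <= e.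
  move=> Sx Sy /ffunP xy.
  have coord z k : S z -> -1 <= z k <= 1.
    move=> /S1 h; rewrite -ler_norml -[leRHS]sqrtr1 -sqrtr_sqr ler_wsqrtr//.
    by apply: le_trans h; rewrite /dot (bigD1 k)//= -expr2 lerDl; apply: sumr_ge0 => i _; rewrite -expr2 sqr_ge0.
  have tr z k (u := (z k + 1) * n%:R) : S z -> (Num.truncn u < (n + n).+1)%N /\ (Num.truncn u)%:R <= u < (Num.truncn u).+1%:R.
    move=> /(coord _ k)/andP[z1 z2].
    have u0 : 0 <= u by rewrite mulr_ge0// -lerBlDr sub0r.
    have h := truncn_itv u0; split => //.
    rewrite ltnS -(ler_nat R); case/andP: h => h _; apply: (le_trans h).
    rewrite /u natrD; nra.
  have h k : `|x k - y k| <= n%:R^-1.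
    have [hx /andP[x1 x2]] := tr x k Sx; have [hy /andP[y1 y2]] := tr y k Sy.
    have := xy k; rewrite !ffunE => /(congr1 (@nat_of_ord _)); rewrite (inordK hx) (inordK hy) => E.
    move: x1 x2 y1 y2; rewrite E; move: (Num.truncn _) => a.
    rewrite -natr1; move: (a%:R : R) => b x1 x2 y1 y2.
    rewrite -[_^-1]mul1r ler_pdivlMr// -[X in _ * X]ger0_norm ?(ltW n0)// -normrM ler_norml; apply/andP; split; lra.
  rewrite /norm2 -[leRHS](ger0_norm (ltW e0)) -sqrtr_sqr ler_wsqrtr//.
  apply: (@le_trans _ _ (\sum_(k : K) n%:R^-1 ^+ 2)).
    by apply: ler_sum => k _; rewrite -expr2 -real_normK ?num_real// ler_sqr ?nnegrE// invr_ge0 ltW.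
  rewrite sumr_const -[leLHS]mulr_natl exprVn ler_pdivrMr ?exprn_gt0// -exprMn.
  have : #|K|%:R <= e * n%:R by rewrite mulrC -ler_pdivrMr.
  have [|Kn0] := posnP #|K|; first by move=> ->; rewrite sqr_ge0.
  have : 1 <= #|K|%:R :> R by rewrite ler1n.
  by move: (e * n%:R) (#|K|%:R : R) => p q; nra.
exists {ffun K -> 'I_(n + n).+1}, [ffun=> ord0].
exists (fun c => xget s0 [set x | S x /\ cell x = c]); split=> [c|x Sx].
  by case: xgetP => // x _ [].
exists (cell x); case: xgetP => [y _ [Sy xy]|/(_ x)[]//].
exact: cellP.
Qed.

Lemma sublin_approx_max (S : set (K -> R)) (s0 : K -> R) (F : (K -> R) -> R) : S s0 ->
  (forall x, S x -> dot x x <= 1) -> (forall x v, S v -> dot v x <= F x) ->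
  (forall x, exists2 v, S v & F x <= dot v x) -> sublin_approx F.
Proof.
move=> Ss0 S1 SF FS e e0; have [J [j0 [v [vS net]]]] := finite_net Ss0 S1 e0.
exists J, j0, v; split=> [j|x j|x]; [exact: S1|exact: SF|].
have [w Sw Fw] := FS x; have [j hj] := net w Sw; exists j.
apply: (le_trans Fw); rewrite -lerBlDl.
apply: (@le_trans _ _ (dot (fun k => w k - v j k) x)).
  by rewrite /dot -sumrB; apply: ler_sum => k _; rewrite mulrBl.
by apply: (le_trans (dot_le _ _)); rewrite ler_wpM2r// norm2_ge0.
Qed.

End finite_nets.

Section restriction.
Variables (R : realType) (K : finType) (p : pred K).

(** Zeroing coordinates instead of changing the index type keeps blocks and their sums in one
    space. *)
Definition restr (x : K -> R) (k : K) : R := if p k then x k else 0.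

Lemma dot_restr x y : dot (restr x) y = dot x (restr y).
Proof. by apply: eq_bigr => k _; rewrite /restr; case: ifP; rewrite ?mul0r ?mulr0. Qed.

Lemma restr_id x : restr (restr x) = restr x.
Proof. by apply/funext => k; rewrite /restr; case: (p k). Qed.

Lemma restrZ c x : restr (fun k => c * x k) = fun k => c * restr x k.
Proof. by apply/funext => k; rewrite /restr; case: (p k); rewrite ?mulr0. Qed.

Lemma dot_restr2 x y : dot (restr x) (restr y) = dot (restr x) y.
Proof. by rewrite -dot_restr restr_id. Qed.

Lemma dot_normalize (x : K -> R) : 0 < norm2 x -> dot (fun k => (norm2 x)^-1 * x k) (fun k => (norm2 x)^-1 * x k) = 1.
Proof.
by move=> x0; rewrite dotZl dotZr -norm2_sq; field; rewrite gt_eqF.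
Qed.

Lemma restr_approx : sublin_approx (fun x : K -> R => norm2 (restr x)).
Proof.
apply: (@sublin_approx_max _ _ [set v | restr v = v /\ dot v v <= 1] (fun=> 0)) => /=.
- split; first by apply/funext => k; rewrite /restr; case: (p k).
  by rewrite dot0l.
- by move=> x [].
- move=> x v [<- v1]; rewrite dot_restr -{1}restr_id -dot_restr.
  exact: dot_le_norm2.
- move=> x; have := norm2_ge0 (restr x); rewrite le_eqVlt => /orP[/eqP<-|x0].
    exists (fun=> 0); last by rewrite dot0l.
    by split; [apply/funext => k; rewrite /restr; case: (p k)|rewrite dot0l].
  exists (fun k => (norm2 (restr x))^-1 * restr x k).
    split; last by rewrite dot_normalize.
    by apply/funext => k; rewrite /restr; case: (p k) => //; rewrite mulr0.
  by rewrite dotZl -dot_restr2 -norm2_sq expr2 mulrA mulVf ?mul1r// gt_eqF.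
Qed.

Lemma Eg_restr_sq : Eg (fun x : vec R K => norm2 (restr x) ^+ 2) = #|p|%:R.
Proof.
transitivity (Eg (fun x : vec R K => \sum_k (p k)%:R * (x k * x k))).
  congr Eg; apply/funext => x; rewrite norm2_sq; apply: eq_bigr => k _.
  by rewrite /restr; case: ifP; rewrite ?mul1r ?mul0r.
rewrite Eg_sum => [|k]; last by apply: itgZ; exact: itg_coordM.
rewrite (eq_bigr (fun k => (p k)%:R)) => [|k _]; last first.
  by rewrite EgZ ?Eg_coordM ?eqxx ?mulr1//; exact: itg_coordM.
rewrite -natr_sum; congr (_%:R); rewrite -sum1_card [RHS]big_mkcond /=.
by apply: eq_bigr => k _; rewrite unfold_in; case: (p k).
Qed.

End restriction.

Section frobenius.
Variables (R : realType) (Rw Cl : finType).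

Definition app (G : Rw * Cl -> R) (x : Cl -> R) (i : Rw) : R := \sum_c G (i, c) * x c.

Lemma bilE u (G : Rw * Cl -> R) x : bil u G x = dot u (app G x).
Proof.
apply: eq_bigr => i _; rewrite /app mulr_sumr; apply: eq_bigr => c _.
by rewrite mulrA.
Qed.

(** Cauchy-Schwarz row by row: the Frobenius norm dominates the operator norm. Its size is harmless
    because the mesh is chosen after it. *)
Lemma app_le (G : Rw * Cl -> R) x : norm2 (app G x) <= norm2 G * norm2 x.
Proof.
rewrite -ler_sqr ?nnegrE ?mulr_ge0 ?norm2_ge0// exprMn !norm2_sq {2}/dot sum_prod mulr_suml.
by apply: ler_sum => i _; rewrite -expr2; exact: (dot_CS_sq (fun c => G (i, c)) x).
Qed.

Lemma bil_le u (G : Rw * Cl -> R) x : `|bil u G x| <= norm2 u * (norm2 G * norm2 x).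
Proof.
rewrite bilE; apply: (le_trans (dot_CS _ _)); rewrite ler_wpM2l ?norm2_ge0//.
exact: app_le.
Qed.

End frobenius.

Section compactness.
Variables (R : realType) (n : nat).
Implicit Types (x y : 'cV[R]_n) (K : set 'cV[R]_n).

Definition cvf x (i : 'I_n) : R := x i 0.

Lemma enormE x : enorm x = norm2 (cvf x).
Proof. by congr Num.sqrt; apply: eq_bigr => i _; rewrite expr2. Qed.

Lemma continuous_trmx : continuous (fun x : 'rV[R]_n => x^T : 'cV[R]_n).
Proof.
move=> /= x s /nbhs_ballP[e e0 es]; apply/nbhs_ballP; exists e => //= y [_ xy].
by apply: es; split => // i j; rewrite !mxE.
Qed.

Lemma compact_box (b : R) : compact [set x : 'cV[R]_n | forall i, `[-b, b]%classic (x i 0)].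
Proof.
have := @rV_compact R n (fun=> `[-b, b]%classic) (fun _ => @segment_compact R (- b) b).
move=> h; have := continuous_compact (continuous_subspaceT continuous_trmx) h.
congr (compact _); apply/seteqP; split => [_ [y hy <-] i|x hx].
  by rewrite mxE; exact: hy.
by exists x^T; [move=> i; rewrite mxE; exact: hx|rewrite trmxK].
Qed.

Lemma continuous_enorm_sq : continuous (fun x : 'cV[R]_n => dot (cvf x) (cvf x)).
Proof.
apply: (continuous_big (@add_continuous R)) => i _ x.
have h := @coord_continuous R n 1 i 0.
exact: (cvgM (h x) (h x)).
Qed.

Lemma eball_sq (r : R) x : 0 <= r -> @eball R n r x = (dot (cvf x) (cvf x) <= r ^+ 2 : Prop).
Proof.
move=> r0; rewrite /eball /= enormE; congr is_true.
by rewrite -norm2_sq ler_sqr ?nnegrE ?norm2_ge0.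
Qed.

Lemma closed_eball (r : R) : 0 <= r -> closed (@eball R n r).
Proof.
move=> r0; rewrite (_ : @eball R n r = (fun x => dot (cvf x) (cvf x)) @^-1` [set y | y <= r ^+ 2]).
  apply: closed_comp; first by move=> x _; exact: continuous_enorm_sq.
  exact: closed_le.
by apply/seteqP; split => x; rewrite eball_sq.
Qed.

Lemma closed_eball_min K (r : R) (phi : 'cV[R]_n -> R) x0 : closed K -> 0 <= r -> K x0 -> @eball R n r x0 ->
  continuous phi -> exists x, [/\ K x, @eball R n r x & forall y, K y -> @eball R n r y -> phi x <= phi y].
Proof.
move=> Kc r0 Kx0 rx0 cphi.
have cpt : compact (K `&` @eball R n r).
  have cl : closed (K `&` @eball R n r) by apply: closedI => //; exact: closed_eball.
  apply: (subclosed_compact cl (compact_box (b := r))).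
  move=> x [_]; rewrite /eball /= enormE => h i; rewrite in_itv /= -ler_norml.
  apply: le_trans h; rewrite -sqrtr_sqr ler_wsqrtr// expr2 /dot (bigD1 i)//= lerDl.
  by apply: sumr_ge0 => j _; rewrite -expr2 sqr_ge0.
have [|x /set_mem[Kx rx] h] := compact_EVT_min _ cpt (continuous_subspaceT cphi); first by exists x0.
by exists x; split => // y Ky ry; apply: h; rewrite inE.
Qed.

End compactness.

(** * Metric projection onto a cone and separation *)

Section projection.
Variables (R : realType) (n : nat) (K : set 'cV[R]_n).
Hypothesis Kcl : closed K.
Hypothesis Kcone : is_cone K.
Hypothesis Kconv : is_convex_set K.

Definition colf (x : 'I_n -> R) : 'cV[R]_n := \col_i x i.

Lemma cvfK x : cvf (colf x) = x.
Proof. by apply/funext => i; rewrite /cvf mxE. Qed.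

Lemma cvfB (x y : 'cV[R]_n) : cvf (x - y) = (fun i => cvf x i + - cvf y i).
Proof. by apply/funext => i; rewrite /cvf !mxE. Qed.

Lemma cvf_comb (t : R) (x y : 'cV[R]_n) : cvf (t *: x + (1 - t) *: y) = (fun i => t * cvf x i + (1 - t) * cvf y i).
Proof. by apply/funext => i; rewrite /cvf !mxE. Qed.

Lemma cvfZ (t : R) (x : 'cV[R]_n) : cvf (t *: x) = (fun i => t * cvf x i).
Proof. by apply/funext => i; rewrite /cvf !mxE. Qed.

Lemma cvf0 : cvf (0 : 'cV[R]_n) = fun=> 0.
Proof. by apply/funext => i; rewrite /cvf mxE. Qed.

Lemma K0 : K 0. Proof. by have [] := Kcone. Qed.

(* First-order optimality: [t = a / (a + b)] violates the hypothesis if [0 < a]. *)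
Lemma first_order_le0 (a b : R) : 0 <= b -> (forall t, 0 <= t <= 1 -> 0 <= - (2 * t * a) + t ^+ 2 * b) -> a <= 0.
Proof.
move=> b0 h; rewrite leNgt; apply/negP => a0.
have ab : 0 < a + b by rewrite ltr_wpDr.
have /h : 0 <= a / (a + b) <= 1.
  by rewrite divr_ge0 ?(ltW a0) ?(ltW ab)//= ler_pdivrMr// mul1r lerDl.
have -> : - (2 * (a / (a + b)) * a) + (a / (a + b)) ^+ 2 * b = - (a ^+ 2 * (2 * a + b)) / (a + b) ^+ 2.
  by field; rewrite gt_eqF.
rewrite pmulr_lge0 ?invr_gt0 ?exprn_gt0// oppr_ge0 leNgt mulr_gt0 ?exprn_gt0//.
by rewrite ltr_wpDr// mulr_gt0.
Qed.

Lemma continuous_cvf_shift (x : 'cV[R]_n) : continuous (fun y : 'cV[R]_n => dot (cvf (x - y)) (cvf (x - y))).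
Proof.
move=> y; apply: (@continuous_comp _ _ _ (fun y : 'cV[R]_n => x - y) (fun z => dot (cvf z) (cvf z))); last exact: continuous_enorm_sq.
by apply: continuousB => //; exact: cst_continuous.
Qed.

(** A point of norm above [2 |x|] is farther from [x] than the origin is, so a minimiser over the
    compact part of [K] within that radius is a global one. *)
Lemma metric_projP x : K (metric_proj K x) /\ forall z, K z -> enorm (x - metric_proj K x) <= enorm (x - z).
Proof.
suff [y hy] : exists y, K y /\ forall z, K z -> enorm (x - y) <= enorm (x - z).
  by rewrite /metric_proj; case: xgetP => [z _ //|/(_ y)].
have r0 : 0 <= 2 * enorm x by rewrite mulr_ge0// sqrtr_ge0.
have B0 : @eball R n (2 * enorm x) 0.
  by rewrite /eball /= {1}enormE cvf0 /norm2 dot0l sqrtr0.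
have [y [Ky _ ymin]] := closed_eball_min Kcl r0 K0 B0 (@continuous_cvf_shift x).
exists y; split => // z Kz; rewrite !enormE ler_wsqrtr//.
have [hz|hz] := leP (enorm z) (2 * enorm x); first exact: ymin.
apply: (le_trans (ymin 0 K0 B0)); rewrite subr0 cvfB dotDl !dotDr !dotNl !dotNr (dotC (cvf z)).
have := dot_le (cvf x) (cvf z); rewrite -!norm2_sq -!enormE.
have := sqrtr_ge0 (\sum_i x i 0 ^+ 2); rewrite -/(enorm x) => x0.
by move: hz; clear -x0; move: (enorm x) (enorm z) (dot _ _) x0 => a b c a0; nra.
Qed.

(** Moreau's decomposition. The variational inequality, tested at [2 y] and at 0, makes the residual
    orthogonal to the projection [y], and then puts it in the polar cone. *)
Lemma metric_proj_le0 x z : K z -> dot (cvf (x - metric_proj K x)) (cvf z) <= 0 /\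
  dot (cvf (x - metric_proj K x)) (cvf (metric_proj K x)) = 0.
Proof.
have [Ky ymin] := metric_projP x; set y := metric_proj K x in Ky ymin *.
have var w : K w -> dot (cvf (x - y)) (cvf (w - y)) <= 0.
  move=> Kw; apply: (@first_order_le0 _ (dot (cvf (w - y)) (cvf (w - y)))); first exact: dot_ge0.
  move=> t t01; have := ymin _ (Kconv Kw Ky t01).
  rewrite !enormE ler_sqrt ?dot_ge0//.
  have -> : cvf (x - (t *: w + (1 - t) *: y)) = (fun i => cvf (x - y) i + - (t * cvf (w - y) i)).
    by apply/funext => i; rewrite /cvf !mxE; ring.
  rewrite dotDl !dotDr !dotNl !dotNr !dotZl !dotZr (dotC (cvf (w - y))).
  by move: (dot _ _) (dot _ _) (dot _ _) => a b c; lra.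
have [_ KZ] := Kcone.
have yy : dot (cvf (x - y)) (cvf y) = 0.
  apply/eqP; rewrite eq_le; apply/andP; split.
    have := var _ (KZ y Ky 2 (ler0n _ 2)).
    by rewrite (_ : 2 *: y - y = y)// scaler_nat mulr2n addrK.
  by have := var _ K0; rewrite sub0r -scaleN1r cvfZ dotZr mulN1r oppr_le0.
move=> Kz; split=> //; have := var _ Kz.
by rewrite [cvf (z - y)]cvfB dotDr dotNr yy oppr0 addr0.
Qed.

Definition projn (x : 'I_n -> R) : R := enorm (metric_proj K (colf x)).

Lemma projn_ge0 x : 0 <= projn x. Proof. exact: sqrtr_ge0. Qed.

Lemma dot_projn x : dot x (cvf (metric_proj K (colf x))) = projn x ^+ 2.
Proof.
have [Ky _] := metric_projP (colf x); have [_] := metric_proj_le0 (colf x) Ky.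
by rewrite cvfB dotDl dotNl cvfK /projn enormE norm2_sq => /subr0_eq.
Qed.

(** With [projn_attained], this identifies [|Pi_K x|] with the maximum of [<mu, x>] over [K]
    intersected with the unit ball. *)
Lemma dot_le_projn x mu : K mu -> enorm mu <= 1 -> dot (cvf mu) x <= projn x.
Proof.
move=> Kmu mu1; have [h _] := metric_proj_le0 (colf x) Kmu; move: h.
rewrite cvfB dotDl dotNl cvfK subr_le0 dotC => h; apply: (le_trans h).
apply: (le_trans (dot_le _ _)); rewrite -!enormE -[leRHS]mulr1 ler_wpM2l//.
exact: sqrtr_ge0.
Qed.

Lemma projn_attained x : 0 < projn x ->
  exists mu, [/\ K mu, dot (cvf mu) (cvf mu) = 1 & projn x = dot (cvf mu) x].
Proof.
move=> p0; have [Ky _] := metric_projP (colf x); have [_ KZ] := Kcone.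
exists ((projn x)^-1 *: metric_proj K (colf x)); split.
- by apply: KZ => //; rewrite invr_ge0 ltW.
- by rewrite cvfZ; move: p0; rewrite /projn enormE => p0; exact: dot_normalize.
- by rewrite cvfZ dotZl dotC dot_projn expr2 mulrA mulVf ?mul1r// gt_eqF.
Qed.

Lemma projn_approx : sublin_approx projn.
Proof.
apply: (@sublin_approx_max _ _ [set cvf mu | mu in [set mu | K mu /\ enorm mu <= 1]] (fun=> 0)).
- exists 0; last exact: cvf0.
  by split; [exact: K0|rewrite enormE cvf0 /norm2 dot0l sqrtr0].
- move=> _ [mu [_ h] <-]; by rewrite -norm2_sq -enormE expr_le1// sqrtr_ge0.
- by move=> x _ [mu [Kmu mu1] <-]; exact: dot_le_projn.
- move=> x; have := projn_ge0 x; rewrite le_eqVlt => /orP[/eqP<-|x0].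
    exists (fun=> 0); last by rewrite dot0l.
    exists 0; last exact: cvf0.
    by split; [exact: K0|rewrite enormE cvf0 /norm2 dot0l sqrtr0].
  have [mu [Kmu mu1 ->]] := projn_attained x0; exists (cvf mu) => //.
  by exists mu => //; split => //; rewrite enormE /norm2 mu1 sqrtr1.
Qed.


Section separation.
Variables (Rw : finType) (p : pred Rw) (G : Rw * 'I_n -> R) (y : Rw -> R).

Let res (x : 'cV[R]_n) := restr p (fun i => y i - app G (cvf x) i).

Lemma continuous_res : continuous (fun x => dot (res x) (res x)).
Proof.
have c i : continuous (fun x => res x i).
  have cG : continuous (fun x : 'cV[R]_n => app G (cvf x) i).
    apply: (continuous_big (@add_continuous R)) => j _ x.
    exact: (cvgM (cvg_cst (G (i, j))) (@coord_continuous R n 1 j 0 x)).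
  rewrite /res /restr; case: (p i); last exact: cst_continuous.
  by move=> x; exact: (cvgB (cvg_cst (y i)) (cG x)).
apply: (continuous_big (@add_continuous R)) => i _ x.
exact: (cvgM (c i x) (c i x)).
Qed.

Lemma norm2_comb (t : R) (x z : 'cV[R]_n) : 0 <= t <= 1 -> @eball R n 1 x -> @eball R n 1 z ->
  @eball R n 1 (t *: x + (1 - t) *: z).
Proof.
move=> /andP[t0 t1]; rewrite !eball_sq// expr1n => hx hz.
rewrite cvf_comb dotDl !dotDr !dotZl !dotZr (dotC (cvf z)).
have xz : dot (cvf x) (cvf z) <= 1.
  apply: (le_trans (dot_le _ _)); rewrite -[leRHS]mulr1 ler_pM ?norm2_ge0 ?norm2_le1//.
have s0 : 0 <= 1 - t by rewrite subr_ge0.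
have := mulr_ge0 t0 t0; have := mulr_ge0 t0 s0; have := mulr_ge0 s0 s0.
by move: (dot _ _) (dot _ _) (dot _ _) hx hz xz => a b c; nra.
Qed.

Lemma separation : (exists mu, [/\ K mu, @eball R n 1 mu & restr p (app G (cvf mu)) = restr p y]) \/
  exists w, [/\ restr p w = w, dot w w = 1 &
    forall mu, K mu -> @eball R n 1 mu -> dot w (app G (cvf mu)) < dot w y].
Proof.
have B0 : @eball R n 1 0 by rewrite /eball /= enormE cvf0 /norm2 dot0l sqrtr0.
have [x [Kx Bx xmin]] := closed_eball_min Kcl ler01 K0 B0 continuous_res.
have [w0|w0] := eqVneq (dot (res x) (res x)) 0.
  left; exists x; split => //; apply/funext => i.
  have h0 k : true -> 0 <= res x k * res x k by rewrite -expr2 sqr_ge0.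
  have /eqP := psumr_eq0P h0 w0 (i := i) isT; rewrite mulf_eq0 orbb /res /restr; case: (p i) => //.
  by rewrite subr_eq0 => /eqP.
right; have wp : 0 < norm2 (res x) by rewrite sqrtr_gt0 lt_def w0 dot_ge0.
have mr : restr p (res x) = res x by rewrite /res restr_id.
exists (fun k => (norm2 (res x))^-1 * res x k); split.
- by rewrite restrZ mr.
- exact: dot_normalize.
move=> mu Kmu Bmu; rewrite !dotZl ltr_pM2l ?invr_gt0//.
suff : dot (res x) (fun i => app G (cvf mu) i + - app G (cvf x) i) <= 0.
  rewrite dotDr dotNr subr_le0 => h; apply: (le_lt_trans h).
  have : dot (res x) (res x) = dot (res x) y - dot (res x) (app G (cvf x)).
    by rewrite {2}/res -dot_restr mr dotDr dotNr.
  have : 0 < dot (res x) (res x) by rewrite lt_def w0 dot_ge0.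
  by move=> ? E; rewrite -subr_gt0 -E.
set u := (fun i => app G (cvf mu) i + - app G (cvf x) i).
apply: (@first_order_le0 _ (dot (restr p u) (restr p u))); first exact: dot_ge0.
move=> t t01; have := xmin _ (Kconv Kmu Kx t01) (norm2_comb t01 Bmu Bx).
have -> : res (t *: mu + (1 - t) *: x) = (fun i => res x i + - (t * restr p u i)).
  apply/funext => i; rewrite /res /restr /u; case: (p i); last by rewrite mulr0 subrr.
  have -> : app G (cvf (t *: mu + (1 - t) *: x)) i = t * app G (cvf mu) i + (1 - t) * app G (cvf x) i.
    rewrite /app !mulr_sumr -big_split; apply: eq_bigr => j _ /=.
    by rewrite /cvf !mxE; ring.
  by ring.
clearbody u.
rewrite dotDl !dotDr !dotNl !dotNr !dotZl !dotZr (dotC (restr p u)) -(dot_restr p (res x)) mr.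
by move: (dot _ _) (dot _ _) (dot _ _) => a b c; lra.
Qed.

End separation.

End projection.

(** * The two comparison events *)

Section sphere.
Variables (R : realType) (I : finType).

(** The case [c = 0] covers an empty block, which occurs for the last rows when [l = m]. *)
Lemma sphere_neq0 (p : pred I) (c : R) : c = 0 \/ (exists i, p i) ->
  exists u : I -> R, restr p u = u /\ dot u u = c ^+ 2.
Proof.
case=> [->|[i pi]].
  exists (fun=> 0); split; last by rewrite dot0l expr0n.
  by apply/funext => k; rewrite /restr; case: (p k).
exists (fun k => if k == i then c else 0); split.
  by apply/funext => k; rewrite /restr; case: eqP => [->|_]; rewrite ?pi//; case: (p k).
rewrite /dot (bigD1 i)//= eqxx big1 ?addr0 ?expr2// => k /negPf ->.
by rewrite mulr0.
Qed.

Lemma norm2_restr_le (p : pred I) (x : I -> R) : norm2 (restr p x) <= norm2 x.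
Proof.
rewrite ler_wsqrtr//; apply: ler_sum => k _; rewrite /restr; case: (p k) => //.
by rewrite mul0r -expr2 sqr_ge0.
Qed.

Lemma dotBl (x y z : I -> R) : dot (fun k => x k - y k) z = dot x z - dot y z.
Proof. by rewrite dotDl dotNl. Qed.

Lemma dotBr (x y z : I -> R) : dot z (fun k => x k - y k) = dot z x - dot z y.
Proof. by rewrite dotDr dotNr. Qed.

Lemma restrB (p : pred I) (x y : I -> R) : restr p (fun k => x k - y k) = fun k => restr p x k - restr p y k.
Proof. by apply/funext => k; rewrite /restr; case: (p k); rewrite ?subr0. Qed.

Lemma norm2_eq (x : I -> R) b : 0 <= b -> dot x x = b ^+ 2 -> norm2 x = b.
Proof. by move=> b0 h; rewrite /norm2 h sqrtr_sqr ger0_norm. Qed.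

Lemma dot_restr_le (p : pred I) (u x : I -> R) : restr p u = u -> dot u x <= norm2 u * norm2 (restr p x).
Proof. by move=> <-; rewrite -dot_restr2; exact: dot_le. Qed.

Lemma dot_restr_ge (p : pred I) (u x : I -> R) : restr p u = u -> - (norm2 u * norm2 (restr p x)) <= dot u x.
Proof.
move=> <-; rewrite -dot_restr2 lerNl; apply: (le_trans _ (dot_CS _ _)).
by rewrite -normrN ler_norm.
Qed.

Lemma dot_restr_disjoint (p p' : pred I) (u v : I -> R) : (forall i, p i -> p' i -> False) ->
  restr p u = u -> restr p' v = v -> dot u v = 0.
Proof.
move=> dis <- <-; rewrite /dot big1// => k _; rewrite /restr.
by case: (boolP (p k)) => [pk|_]; rewrite ?mul0r//; case: (boolP (p' k)) => [p'k|_]; rewrite ?mulr0//; have := dis k pk p'k.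
Qed.

(** Equality in Cauchy-Schwarz on the sphere of radius [b] in the block; [v0] serves when [x]
    vanishes on it. *)
Lemma dot_aligned (p : pred I) (b : R) (x v0 : I -> R) : restr p v0 = v0 -> dot v0 v0 = b ^+ 2 ->
  exists v, [/\ restr p v = v, dot v v = b ^+ 2 & dot v x = b * norm2 (restr p x)].
Proof.
move=> mv0 v0b; have := norm2_ge0 (restr p x); rewrite le_eqVlt => /orP[/eqP x0|x0].
  exists v0; split => //; rewrite -x0 mulr0 -mv0 dot_restr.
  have /eqP : dot (restr p x) (restr p x) = 0 by rewrite -norm2_sq -x0 expr0n.
  have := dot_CS v0 (restr p x); rewrite -x0 mulr0 => h _.
  by apply/eqP; rewrite -normr_le0.
exists (fun k => b / norm2 (restr p x) * restr p x k); split.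
- by rewrite restrZ restr_id.
- by rewrite dotZl dotZr -norm2_sq; field; rewrite gt_eqF.
- by rewrite dotZl -dot_restr2 -norm2_sq; field; rewrite gt_eqF.
Qed.

End sphere.

Section linear_maps.
Variables (R : realType) (Rw Cl : finType) (G : Rw * Cl -> R).

Lemma appB (x y : Cl -> R) : app G (fun c => x c - y c) = fun i => app G x i - app G y i.
Proof. by apply/funext => i; rewrite -sumrB; apply: eq_bigr => c _; rewrite mulrBr. Qed.

Lemma appZ b (x : Cl -> R) : app G (fun c => b * x c) = fun i => b * app G x i.
Proof. by apply/funext => i; rewrite /app mulr_sumr; apply: eq_bigr => c _; rewrite mulrCA. Qed.

Lemma appN (x : Cl -> R) : app G (fun c => - x c) = fun i => - app G x i.
Proof. by apply/funext => i; rewrite -sumrN; apply: eq_bigr => c _; rewrite mulrN. Qed.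

Lemma bil_bound (u : Rw -> R) (x : Cl -> R) a M b : 0 <= a -> 0 <= M -> 0 <= b ->
  norm2 u <= a -> norm2 G <= M -> norm2 x <= b -> `|bil u G x| <= a * (M * b).
Proof.
move=> a0 M0 b0 ua GM xb; apply: (le_trans (bil_le _ _ _)).
by rewrite !ler_pM ?mulr_ge0 ?norm2_ge0.
Qed.

End linear_maps.

(** The budget of the upper event: [39 + 3 t] is three deviations [13 + t], for [|Pi_K g|] and for
    the two blocks of [h]. Of [2 eta], one part pays the net of the [v] and the other the threshold
    of [EY]. *)
Lemma upper_arith (R : realType) (K' U V a eta Fg sd t al be N1 N3 e sk sq r : R) :
  - K' + (U + V) + a < eta -> K' <= Fg -> Fg < sd + 13 + t -> - (al * N1) <= U ->
  be * N3 - e * N3 <= V -> N1 < sk + 13 + t -> sq - 13 - t < N3 -> N3 < sq + 13 + t ->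
  e * (sq + 13 + t) <= eta -> 0 < al -> al <= 1 -> 0 <= be -> be <= 1 -> 0 < e -> 0 < t ->
  sd - be * sq = al * r -> a = al * r + sk + 39 + 3 * t + 2 * eta -> 0 <= N1 -> False.
Proof.
move=> h1 h2 h3 h4 h5 h6 h7 h8 h9 a0 a1 b0 b1 e0 t0 h10 h11 n1.
have x1 : al * N1 <= N1 by rewrite ler_piMl.
have x2 : be * (sq - 13 - t) <= be * N3 by rewrite ler_wpM2l// ltW.
have x3 : be * (13 + t) <= 13 + t by rewrite ler_piMl//; lra.
have x4 : e * N3 <= e * (sq + 13 + t) by rewrite ler_wpM2l// ltW.
have x5 : be * (sq - 13 - t) = be * sq - be * (13 + t) by ring.
move: x1 x2 x3 x4 x5 h1 h2 h3 h4 h5 h6 h9 h10 h11; clear.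
move: (al * N1) (be * (sq - 13 - t)) (be * N3) (be * (13 + t)) (e * N3) (e * (sq + 13 + t)) (be * sq) (al * r).
by move=> *; lra.
Qed.

(** The budget of the lower event, again with three deviations. Of [4 eta], two parts cancel the
    offset, one pays the net of the [mu], and one the threshold of [EY]. *)
Lemma lower_arith (R : realType) (KJ W eta Fg sd t nu nv N1 N3 Ng e sk sq sn R1 SQ : R) :
  KJ + W + (- (nu * R1) - 2 * eta) < eta -> Fg - e * Ng <= KJ -> Ng < sn + 13 + t ->
  e * (sn + 13 + t) <= eta -> - (nu * N1) - nv * N3 <= W -> N1 < sk + 13 + t -> N3 < sq + 13 + t ->
  0 <= nu -> nu <= 1 -> 0 <= nv -> nv <= 1 -> 0 < e -> 0 < t -> 0 <= sk ->
  nu * R1 + nv * sq <= SQ -> sd - 13 - t < Fg -> SQ + 4 * eta + sk + 39 + 3 * t <= sd -> False.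
Proof.
move=> h1 h2 h3 h4 h5 h6 h7 u0 u1 v0 v1 e0 t0 sk0 h8 h9 h10.
have x1 : e * Ng <= e * (sn + 13 + t) by rewrite ler_wpM2l// ltW.
have x2 : nu * N1 <= nu * (sk + 13 + t) by rewrite ler_wpM2l// ltW.
have x3 : nu * (sk + 13 + t) <= sk + 13 + t by rewrite ler_piMl//; lra.
have x4 : nv * N3 <= nv * (sq + 13 + t) by rewrite ler_wpM2l// ltW.
have x5 : nv * (13 + t) <= 13 + t by rewrite ler_piMl//; lra.
have x6 : nv * (sq + 13 + t) = nv * sq + nv * (13 + t) by ring.
move: x1 x2 x3 x4 x5 x6 h1 h2 h4 h5 h8 h9 h10; clear.
move: (e * Ng) (e * (sn + 13 + t)) (nu * N1) (nu * (sk + 13 + t)) (nv * N3) (nv * (13 + t)) (nv * sq) (nv * (sq + 13 + t)) (nu * R1).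
by move=> *; lra.
Qed.

Lemma le_sub_arith (R : realType) (SQ eta sk t sd : R) : SQ + 4 * eta + sk + 39 + 3 * t <= sd ->
  0 <= SQ -> 0 <= sk -> 0 <= eta -> 0 <= t -> 0 <= sd - 13 - t.
Proof. by lra. Qed.

Lemma lower_arith2 (R : realType) (B d d0 d1 d2 m0 m1 m2 eta : R) :
  d2 < d1 -> d1 = d0 + d -> d0 <= m0 -> d <= m2 -> - m1 <= B -> m1 + m2 <= eta ->
  d2 - B + (- m0 - 2 * eta) <= - eta.
Proof. by lra. Qed.

Lemma cauchy2 (R : realType) (a b c d : R) : 0 <= a -> 0 <= b -> 0 <= c -> 0 <= d -> a ^+ 2 + b ^+ 2 = 1 ->
  a * c + b * d <= Num.sqrt (d ^+ 2 + c ^+ 2).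
Proof.
move=> a0 b0 c0 d0 ab; rewrite -[leLHS]ger0_norm ?addr_ge0 ?mulr_ge0// -sqrtr_sqr ler_wsqrtr//.
have : 0 <= (a * d - b * c) ^+ 2 by exact: sqr_ge0.
have : (d ^+ 2 + c ^+ 2) = (d ^+ 2 + c ^+ 2) * (a ^+ 2 + b ^+ 2) by rewrite ab mulr1.
by move=> ->; lra.
Qed.

Section events.
Variables (R : realType) (n : nat) (K : set 'cV[R]_n) (Rw : finType) (p1 p3 : pred Rw).
Hypothesis Kcl : closed K.
Hypothesis Kcone : is_cone K.
Hypothesis Kconv : is_convex_set K.
Hypothesis Kn0 : exists2 mu0, K mu0 & mu0 != 0.
Hypothesis p13 : forall i, p1 i -> p3 i -> False.
Hypothesis p1n0 : exists i, p1 i.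

Let F := projn K.
Let delta := Eg (fun x : vec R 'I_n => F x ^+ 2).
Let k : R := #|p1|%:R.
Let q : R := #|p3|%:R.
Variables (t eta M r e : R).
Hypothesis t0 : 0 < t.

Let tail := expR (- (t ^+ 2 / 8)).

(** Each of the two min-max events uses four of these six deviations; the norm of [g] only serves to
    control a net error. *)
Let bad (z : vec R ('I_n + Rw)%type) :=
  [\/ Num.sqrt delta + 13 + t <= F (fun c => z (inl c)),
      F (fun c => z (inl c)) <= Num.sqrt delta - 13 - t |
   [\/ Num.sqrt n%:R + 13 + t <= norm2 (restr predT (fun c => z (inl c))),
       Num.sqrt k + 13 + t <= norm2 (restr p1 (fun i => z (inr i))),
       Num.sqrt q + 13 + t <= norm2 (restr p3 (fun i => z (inr i))) |
       norm2 (restr p3 (fun i => z (inr i))) <= Num.sqrt q - 13 - t]].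

Lemma Pg_inl (I J : finType) (A : set (vec R I)) : measurable A ->
  Pg [set z : vec R (I + J)%type | A (fun i => z (inl i))] = Pg A.
Proof.
move=> mA; have := Pg_prod mA (@measurableT _ (vec R J)); rewrite Pg_setT mulr1 => <-.
by congr Pg; apply/seteqP; split => z //= [].
Qed.

Lemma Pg_inr (I J : finType) (A : set (vec R J)) : measurable A ->
  Pg [set z : vec R (I + J)%type | A (fun i => z (inr i))] = Pg A.
Proof.
move=> mA; have := Pg_prod (@measurableT _ (vec R I)) mA; rewrite Pg_setT mul1r => <-.
by congr Pg; apply/seteqP; split => z //= [].
Qed.

Lemma Pg_bad (E : set (vec R ('I_n + Rw)%type)) : measurable E -> (forall z, E z -> bad z) ->
  Pg E <= 24 * tail.
Proof.
move=> mE Ebad.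
have Fa := projn_approx Kcl Kcone Kconv.
have [F1 F2] := sublin_concentration Fa (@projn_ge0 _ _ K) t0.
have cm (I : finType) (p : pred I) : let D := Num.sqrt #|p|%:R in
    Pg [set x : vec R I | D + 13 + t <= norm2 (restr p x)] <= 4 * tail /\
    Pg [set x : vec R I | norm2 (restr p x) <= D - 13 - t] <= 4 * tail.
  have := sublin_concentration (@restr_approx R I p) (fun x => norm2_ge0 _) t0.
  by rewrite /= Eg_restr_sq.
have [A1 _] := cm 'I_n predT; rewrite card_ord in A1.
have [A2 _] := cm Rw p1; have [A3 A4] := cm Rw p3.
have mE1 := measurable_F_ge Fa (Num.sqrt delta + 13 + t).
have mE2 := measurable_F_le Fa (Num.sqrt delta - 13 - t).
have mE3 := measurable_F_ge (@restr_approx R 'I_n predT) (Num.sqrt n%:R + 13 + t).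
have mE4 := measurable_F_ge (@restr_approx R Rw p1) (Num.sqrt k + 13 + t).
have mE5 := measurable_F_ge (@restr_approx R Rw p3) (Num.sqrt q + 13 + t).
have mE6 := measurable_F_le (@restr_approx R Rw p3) (Num.sqrt q - 13 - t).
have ml (A : set (vec R 'I_n)) : measurable A -> measurable [set z : vec R ('I_n + Rw)%type | A (fun i => z (inl i))].
  by move=> mA; rewrite -[X in measurable X]setTI; exact: measurable_inl.
have mr (A : set (vec R Rw)) : measurable A -> measurable [set z : vec R ('I_n + Rw)%type | A (fun i => z (inr i))].
  by move=> mA; rewrite -[X in measurable X]setTI; exact: measurable_inr.
have PU (B C : set (vec R ('I_n + Rw)%type)) a b : measurable B -> measurable C ->
    Pg B <= a -> Pg C <= b -> measurable (B `|` C) /\ Pg (B `|` C) <= a + b.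
  move=> mB mC hB hC; split; first exact: measurableU.
  by apply: (le_trans (Pg_le_U _ mB mC _)) => //; [exact: measurableU|exact: lerD].
have B1 := F1; rewrite -(Pg_inl Rw mE1) in B1.
have B2 := F2; rewrite -(Pg_inl Rw mE2) in B2.
have B3 := A1; rewrite -(Pg_inl Rw mE3) in B3.
have B4 := A2; rewrite -(Pg_inr 'I_n mE4) in B4.
have B5 := A3; rewrite -(Pg_inr 'I_n mE5) in B5.
have B6 := A4; rewrite -(Pg_inr 'I_n mE6) in B6.
have [m2 P2] := PU _ _ _ _ (ml _ mE1) (ml _ mE2) B1 B2.
have [m3 P3] := PU _ _ _ _ m2 (ml _ mE3) P2 B3.
have [m4 P4] := PU _ _ _ _ m3 (mr _ mE4) P3 B4.
have [m5 P5] := PU _ _ _ _ m4 (mr _ mE5) P4 B5.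
have [m6 P6] := PU _ _ _ _ m5 (mr _ mE6) P5 B6.
have -> : 24 * tail = 4 * tail + 4 * tail + 4 * tail + 4 * tail + 4 * tail + 4 * tail.
  by rewrite -!mulrDl; congr (_ * _); ring.
apply: le_trans P6; apply: Pg_le => // z /Ebad [h|h|[h|h|h|h]].
- by do 5 left.
- by do 4 left; right.
- by do 3 left; right.
- by do 2 left; right.
- by left; right.
- by right.
Qed.

Hypothesis delta0 : 0 < delta.
Hypothesis r0 : 0 < r.
Hypothesis rE : r ^+ 2 = delta - q.
Hypothesis eta0 : 0 < eta.
Hypothesis M0 : 0 < M.
Hypothesis e0 : 0 < e.
Hypothesis e_q : e * (Num.sqrt q + 13 + t) <= eta.
Hypothesis e_n : e * (Num.sqrt n%:R + 13 + t) <= eta.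
Hypothesis e_M : e * (2 * M) <= eta.
Hypothesis e_r : e * (M + r) <= eta.

(** Gordon's comparison needs vectors of norm exactly 1; other points of the cone are reached by
    scaling. *)
Let unitK := [set cvf mu | mu in [set mu | K mu /\ dot (cvf mu) (cvf mu) = 1]].

Lemma unitK_neq0 : exists x, unitK x.
Proof.
have [mu Kmu mun0] := Kn0; have [_ KZ] := Kcone.
have mup : 0 < norm2 (cvf mu).
  rewrite lt_def norm2_ge0 andbT; apply/negP => /eqP mu0; move/negP: mun0; apply; apply/eqP/matrixP => i j.
  rewrite ord1 mxE; have mm : dot (cvf mu) (cvf mu) = 0 by rewrite -norm2_sq mu0 expr0n.
  have h c : true -> 0 <= cvf mu c * cvf mu c by rewrite -expr2 sqr_ge0.
  have /eqP := psumr_eq0P h mm (i := i) isT; rewrite mulf_eq0 orbb => /eqP; apply.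
exists (cvf ((norm2 (cvf mu))^-1 *: mu)), ((norm2 (cvf mu))^-1 *: mu) => //; split.
  by apply: KZ => //; rewrite invr_ge0 ltW.
by rewrite cvfZ dot_normalize.
Qed.

Let sd := Num.sqrt delta.
Let alpha := r / sd.
Let beta := Num.sqrt q / sd.

Lemma sd0 : 0 < sd. Proof. by rewrite sqrtr_gt0. Qed.
Lemma q0 : 0 <= q. Proof. exact: ler0n. Qed.

(** Everything comes from [r^2 = delta - q]. The last identity gives the upper min-max its limiting
    value [alpha r]. *)
Lemma alpha_beta : [/\ 0 < alpha <= 1, 0 <= beta <= 1, alpha ^+ 2 + beta ^+ 2 = 1 &
  sd - beta * Num.sqrt q = alpha * r].
Proof.
have s0 := sd0; have sE : sd ^+ 2 = delta by rewrite sqr_sqrtr// ltW.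
have qE : Num.sqrt q ^+ 2 = q by rewrite sqr_sqrtr// q0.
have a0 : 0 < alpha by rewrite divr_gt0.
have b0 : 0 <= beta by rewrite divr_ge0 ?sqrtr_ge0 ?(ltW s0).
have ab : alpha ^+ 2 + beta ^+ 2 = 1.
  rewrite !expr_div_n -mulrDl rE qE subrK sE divff//.
  by rewrite gt_eqF.
split => //.
- by rewrite a0 -(@ler_pXn2r _ 2) ?nnegrE ?(ltW a0)// expr1n -ab lerDl sqr_ge0.
- by rewrite b0 -(@ler_pXn2r _ 2) ?nnegrE// expr1n -ab lerDr sqr_ge0.
- have -> : beta * Num.sqrt q = q / sd by rewrite /beta mulrAC -expr2 qE.
  have -> : alpha * r = (delta - q) / sd by rewrite /alpha mulrAC -expr2 rE.
  by rewrite -sE; field; rewrite gt_eqF.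
Qed.

Variable eps : R.
Hypothesis eps01 : 0 < eps < 1.

(* [w = u + v] with [u], [v] of norms [alpha] and [beta]: maximising over [mu] and [u] and
   minimising over [v] isolates the points of [GK_n] whose coordinates in [p3] vanish. *)
Lemma upper_event : Num.sqrt k + 39 + 3 * t + 4 * eta <= alpha * (eps * r) ->
  exists2 E : set (vec R (Rw * 'I_n)%type), measurable E /\ Pg E <= 96 * tail &
  forall G, ~ E G -> norm2 G <= M -> forall mu, K mu -> @eball R n 1 mu ->
    (forall i, p3 i -> app G (cvf mu) i = 0) -> norm2 (restr p1 (app G (cvf mu))) <= (1 + eps) * r.
Proof.
move=> num; have s0 := sd0; have [/andP[a0 a1] /andP[b0 b1] ab abr] := alpha_beta.
have [x0 Kx0] := unitK_neq0.
have [u0 Su0] := @sphere_neq0 R Rw p1 alpha (or_intror p1n0).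
(* With no row in [p3], [q] and hence [beta] vanish, and the sphere reduces to the origin. *)
have [v0 Sv0] : exists v, restr p3 v = v /\ dot v v = beta ^+ 2.
  apply: sphere_neq0; have [p3n|p3n] := pselect (exists i, p3 i); [by right|left].
  rewrite /beta /q eq_card0 ?sqrtr0 ?mul0r// => i.
  by apply/negP => h; apply: p3n; exists i.
have unitK1 x : unitK x -> dot x x <= 1 by case=> mu [_ <-] <-.
have [JK [jK0 [fK [fKS netK]]]] := finite_net Kx0 unitK1 e0.
have Su1 (u : Rw -> R) : restr p1 u = u /\ dot u u = alpha ^+ 2 -> dot u u <= 1.
  by move=> [_ ->]; rewrite expr_le1// ltW.
have Sv1 (v : Rw -> R) : restr p3 v = v /\ dot v v = beta ^+ 2 -> dot v v <= 1.
  by move=> [_ ->]; rewrite expr_le1.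
have [JU [jU0 [fU [fUS netU]]]] := @finite_net _ _ [set u | restr p1 u = u /\ dot u u = alpha ^+ 2] _ _ Su0 Su1 e0.
have [JV [jV0 [fV [fVS netV]]]] := @finite_net _ _ [set v | restr p3 v = v /\ dot v v = beta ^+ 2] _ _ Sv0 Sv1 e0.
have KS j : dot (fK j) (fK j) = 1 by have [mu [_ h] <-] := fKS j.
pose w (i : JK * JU) (j : JV) := fun c => fU i.2 c + fV j c.
pose mu (i : JK * JU) (j : JV) := fun c => - fK i.1 c.
(* The predicted value plus the whole error budget of [upper_arith]. *)
pose a := alpha * r + Num.sqrt k + 39 + 3 * t + 2 * eta.
have w1 i j : dot (w i j) (w i j) = 1.
  have [U1 U2] := fUS i.2; have [V1 V2] := fVS j.
  rewrite dotDl !dotDr U2 V2 (dotC (fV j)) (dot_restr_disjoint p13 U1 V1) -ab; ring.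
have mu1 i j : dot (mu i j) (mu i j) = 1 by rewrite dotNl dotNr opprK KS.
exists [set G : vec R (Rw * 'I_n)%type | exists i, forall j, bil (w i j) G (mu i j) + a <= - eta].
  split; first exact: (@measurable_EX _ _ _ _ _ w mu (fun _ _ => a) eta).
  have := @gordon R _ _ _ _ (jK0, jU0) jV0 w mu (fun _ _ => a) eta w1 mu1 (fun i j j' => or_intror (mu1 i j)) eta0.
  move=> gor; apply: (le_trans gor) => {gor}.
  have -> : 96 * tail = 4 * (24 * tail) by rewrite mulrA -natrM.
  apply: ler_wpM2l => //; apply: Pg_bad.
    exact: (@measurable_EY _ _ _ _ _ w mu (fun _ _ => a) eta).
  move=> z [[jK jU] hz]; apply: contrapT => nb.
  move: nb; rewrite /bad; move: hz; rewrite /mu /w /=.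
  set g := fun c => z (inl c); set h := fun i => z (inr i) => hz nb.
  have [v [v1 v2 v3]] := dot_aligned h Sv0.1 Sv0.2.
  have [jV hjV] := netV v (conj v1 v2).
  have [f1 f2] := fVS jV; have [g1 g2] := fUS jU; have [nu [Knu nu1] nuE] := fKS jK.
  have hV : beta * norm2 (restr p3 h) - e * norm2 (restr p3 h) <= dot (fV jV) h.
    rewrite -v3 lerBlDl -lerBlDr -dotBl; apply: (le_trans (@dot_restr_le _ _ p3 _ _ _)).
      by rewrite restrB v1 f1.
    by rewrite ler_wpM2r// norm2_ge0.
  have hU : - (alpha * norm2 (restr p1 h)) <= dot (fU jU) h.
    by rewrite -(norm2_eq (ltW a0) g2); exact: dot_restr_ge.
  have hK : dot (fK jK) g <= F g.
    by rewrite -nuE; apply: dot_le_projn => //; rewrite enormE norm2_le1// nu1.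
  have := hz jV; rewrite dotNl dotDl => hz'.
  have nF : F g < sd + 13 + t by rewrite ltNge; apply/negP => ?; apply: nb; constructor 1.
  have n1 : norm2 (restr p1 h) < Num.sqrt k + 13 + t.
    by rewrite ltNge; apply/negP => ?; apply: nb; constructor 3; constructor 2.
  have n3 : norm2 (restr p3 h) < Num.sqrt q + 13 + t.
    by rewrite ltNge; apply/negP => ?; apply: nb; constructor 3; constructor 3.
  have n4 : Num.sqrt q - 13 - t < norm2 (restr p3 h).
    by rewrite ltNge; apply/negP => ?; apply: nb; constructor 3; constructor 4.
  exact: (upper_arith hz' hK nF hU hV n1 n4 n3 e_q a0 a1 b0 b1 e0 t0 abr erefl (norm2_ge0 _)).
(* Deterministic part: normalising [nu] only increases the form, [u] is aligned with the first block
   of [G nu], and every [v] contributes 0 because [G nu] vanishes on [p3]. The form then exceeds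
   [alpha (1 + eps) r] for all [v] at once, up to net errors. *)
move=> G nE GM nu Knu Bnu nu3; rewrite leNgt; apply/negP => big; apply: nE.
set y := app G (cvf nu) in nu3 big.
have eps0 : 0 < eps by case/andP: eps01.
have X0 : 0 < norm2 (restr p1 y) by apply: le_lt_trans big; rewrite mulr_ge0 ?(ltW r0)// addr_ge0// ltW.
have rho1 : norm2 (cvf nu) <= 1 by rewrite -enormE.
have rho0 : 0 < norm2 (cvf nu).
  rewrite lt_def norm2_ge0 andbT; apply/negP => /eqP rho0.
  have := app_le G (cvf nu); rewrite rho0 mulr0 -/y => h.
  by have := lt_le_trans X0 (le_trans (norm2_restr_le p1 y) h); rewrite ltxx.
have [_ KZ] := Kcone.
pose nus := (norm2 (cvf nu))^-1 *: nu.
have Unus : unitK (cvf nus).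
  exists nus => //; split; first by apply: KZ => //; rewrite invr_ge0 ltW.
  by rewrite cvfZ dot_normalize.
have [u [U1 U2 U3]] := dot_aligned y Su0.1 Su0.2.
have [jK hjK] := netK _ Unus; have [jU hjU] := netU u (conj U1 U2).
exists (jK, jU) => j; rewrite /w /mu /=.
have [V1 V2] := fVS j.
have uv1 : norm2 (fun i => u i + fV j i) <= 1.
  rewrite norm2_le1// dotDl !dotDr U2 V2 (dotC (fV j)) (dot_restr_disjoint p13 U1 V1) -ab.
  by rewrite addr0 add0r.
have vy : dot (fV j) y = 0.
  rewrite -V1 dot_restr /dot big1// => i _; rewrite /restr.
  by case: (boolP (p3 i)) => [/nu3 ->|_]; rewrite mulr0.
have E1 : bil (fun i => u i + fV j i) G (cvf nus) = (norm2 (cvf nu))^-1 * (alpha * norm2 (restr p1 y)).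
  by rewrite bilE cvfZ appZ dotZr -/y dotDl vy addr0 U3.
have E2 : alpha * norm2 (restr p1 y) <= bil (fun i => u i + fV j i) G (cvf nus).
  rewrite E1 ler_peMl ?invf_ge1// mulr_ge0 ?norm2_ge0 ?(ltW a0)//.
have E3 := bil_bound (ltW e0) (ltW M0) ler01 hjU GM (norm2_le1 (unitK1 _ (fKS jK))).
have E4 := bil_bound ler01 (ltW M0) (ltW e0) uv1 GM hjK.
have E5 : bil (fun i => fU jU i + fV j i) G (fun c => - fK jK c) =
    bil (fun i => u i - fU jU i) G (fK jK) - bil (fun i => u i + fV j i) G (cvf nus)
    + bil (fun i => u i + fV j i) G (fun c => cvf nus c - fK jK c).
  by rewrite !bilE appN appB !dotBr dotNr !dotBl !dotDl; ring.
rewrite E5; move: E2 E3 E4; rewrite !ler_norml mul1r mulr1 (mulrC M) => E2 /andP[_ E3] /andP[_ E4].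
have E6 : alpha * ((1 + eps) * r) <= alpha * norm2 (restr p1 y) by rewrite ler_wpM2l// ltW.
have E7 : alpha * ((1 + eps) * r) = alpha * r + alpha * (eps * r) by ring.
have E8 : e * (2 * M) = 2 * (e * M) by ring.
rewrite /a; move: E2 E3 E4 E6 E7 E8 e_M num; clear.
move: (bil _ _ _) (bil _ _ _) (bil _ _ _) (alpha * ((1 + eps) * r)) (alpha * norm2 _) (e * (2 * M)) (e * M) (alpha * r) (alpha * (eps * r)).
by move=> *; lra.
Qed.

(** Outside the event, for each [w] of the net some [mu] makes [<w, G mu>] larger than [<w, y>] for
    all admissible [y] together, with a margin [eta] that extends this to every [w]. No direction
    then separates [y], so [y] is attained on the rows of [p1] and [p3]. *)
Lemma lower_event (R1 := (1 - eps) * r) :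
  Num.sqrt (q + R1 ^+ 2) + 4 * eta + Num.sqrt k + 39 + 3 * t <= sd ->
  exists2 E : set (vec R (Rw * 'I_n)%type), measurable E /\ Pg E <= 96 * tail &
  forall G, ~ E G -> norm2 G <= M -> forall y, restr p1 y = y -> norm2 y <= R1 ->
    exists mu, [/\ K mu, @eball R n 1 mu & restr [pred i | p1 i || p3 i] (app G (cvf mu)) = y].
Proof.
move=> num; have s0 := sd0.
have /andP[eps0 eps1] := eps01.
have R10 : 0 <= R1 by rewrite mulr_ge0 ?(ltW r0)// subr_ge0 ltW.
have R1r : R1 <= r by rewrite ler_piMl ?(ltW r0)// lerBlDr lerDl ltW.
set p : pred Rw := [pred i | p1 i || p3 i].
have [x0 Kx0] := unitK_neq0.
have pn0 : exists i, p i by have [i pi] := p1n0; exists i; rewrite /p /= pi.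
have [w0 Sw0] := @sphere_neq0 R Rw p 1 (or_intror pn0).
have unitK1 x : unitK x -> dot x x <= 1 by case=> mu [_ <-] <-.
have [JK [jK0 [fK [fKS netK]]]] := finite_net Kx0 unitK1 e0.
have Sw1 (w : Rw -> R) : restr p w = w /\ dot w w = 1 ^+ 2 -> dot w w <= 1.
  by move=> [_ ->]; rewrite expr1n.
have [JW [jW0 [fW [fWS netW]]]] := @finite_net _ _ [set w | restr p w = w /\ dot w w = 1 ^+ 2] _ _ Sw0 Sw1 e0.
have p1p w : restr p1 (restr p w) = restr p1 w.
  by apply/funext => i; rewrite /restr /p /=; case: (p1 i).
have p3p w : restr p3 (restr p w) = restr p3 w.
  by apply/funext => i; rewrite /restr /p /=; case: (p3 i) => //; rewrite orbT.
have KS j : dot (fK j) (fK j) = 1 by have [mu [_ h] <-] := fKS j.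
have WS i : dot (fW i) (fW i) = 1 by have [_ ->] := fWS i; rewrite expr1n.
pose w (i : JW) (j : JK) := fW i.
pose mu (i : JW) (j : JK) := fK j.
(* [|w_1| R1] is the largest [<w, y>] over admissible [y]. One [eta] covers the nets and the other
   the threshold [- eta] of Gordon's event. *)
pose o (i : JW) (j : JK) := - (norm2 (restr p1 (fW i)) * R1) - 2 * eta.
exists [set G : vec R (Rw * 'I_n)%type | exists i, forall j, bil (w i j) G (mu i j) + o i j <= - eta].
  split; first exact: (@measurable_EX _ _ _ _ _ w mu o eta).
  have := @gordon R _ _ _ _ jW0 jK0 w mu o eta (fun i _ => WS i) (fun _ j => KS j) (fun i j j' => or_introl (WS i)) eta0.
  move=> gor; apply: (le_trans gor) => {gor}.
  have -> : 96 * tail = 4 * (24 * tail) by rewrite mulrA -natrM.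
  apply: ler_wpM2l => //; apply: Pg_bad.
    exact: (@measurable_EY _ _ _ _ _ w mu o eta).
  move=> z [i hz]; apply: contrapT => nb.
  move: nb; rewrite /bad; move: hz; rewrite /mu /w /o /=.
  set g := fun c => z (inl c); set h := fun i => z (inr i) => hz nb.
  have nF : sd - 13 - t < F g by rewrite ltNge; apply/negP => ?; apply: nb; constructor 2.
  have ng : norm2 g < Num.sqrt n%:R + 13 + t.
    have -> : norm2 g = norm2 (restr predT g) by [].
    by rewrite ltNge; apply/negP => ?; apply: nb; constructor 3; constructor 1.
  have n1 : norm2 (restr p1 h) < Num.sqrt k + 13 + t.
    by rewrite ltNge; apply/negP => ?; apply: nb; constructor 3; constructor 2.
  have n3 : norm2 (restr p3 h) < Num.sqrt q + 13 + t.
    by rewrite ltNge; apply/negP => ?; apply: nb; constructor 3; constructor 3.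
  have F0 : 0 < F g.
    apply: le_lt_trans nF.
    exact: (le_sub_arith num (sqrtr_ge0 _) (sqrtr_ge0 _) (ltW eta0) (ltW t0)).
  have [nu [Knu nu1 nuE]] := projn_attained Kcl Kcone Kconv F0.
  have [j hj] := netK (cvf nu) (ex_intro2 _ _ nu (conj Knu nu1) erefl).
  have hK : F g - e * norm2 g <= dot (fK j) g.
    rewrite /F nuE lerBlDr -lerBlDl -dotBl; apply: (le_trans (dot_le _ _)).
    by rewrite ler_wpM2r// norm2_ge0.
  have [W1 _] := fWS i; have Wi := WS i.
  have Wsplit : fW i = fun c => restr p1 (fW i) c + restr p3 (fW i) c.
    rewrite -{1}W1; apply/funext => c; rewrite /restr /p /=.
    case: (boolP (p1 c)) => [c1|_]; last by rewrite add0r.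
    by case: (boolP (p3 c)) => [c3|_]; [case: (p13 c1 c3)|rewrite addr0].
  have W2 : norm2 (restr p1 (fW i)) ^+ 2 + norm2 (restr p3 (fW i)) ^+ 2 = 1.
    rewrite !norm2_sq -Wi {5 6}Wsplit dotDl !dotDr (dotC (restr p3 (fW i)) (restr p1 (fW i))).
    by rewrite (dot_restr_disjoint p13 (restr_id _ _) (restr_id _ _)); ring.
  have hW : - (norm2 (restr p1 (fW i)) * norm2 (restr p1 h)) - norm2 (restr p3 (fW i)) * norm2 (restr p3 h) <= dot (fW i) h.
    rewrite {3}Wsplit dotDl lerD//.
      exact: (dot_restr_ge _ (restr_id _ _)).
    exact: (dot_restr_ge _ (restr_id _ _)).
  have le1 p' : norm2 (restr p' (fW i)) <= 1.
    by apply: (le_trans (norm2_restr_le _ _)); rewrite norm2_le1// Wi.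
  (* Since [|w_1|^2 + |w_3|^2 = 1], the sum [|w_1| R1 + |w_3| sqrt q] is at most [sqrt (q + R1^2)],
     uniformly in the direction. *)
  have cs := cauchy2 (norm2_ge0 (restr p1 (fW i))) (norm2_ge0 (restr p3 (fW i))) R10 (sqrtr_ge0 q) W2.
  rewrite sqr_sqrtr ?q0// in cs.
  exact: (lower_arith (hz j) hK ng e_n hW n1 n3 (norm2_ge0 _) (le1 p1) (norm2_ge0 _) (le1 p3) e0 t0 (sqrtr_ge0 _) cs nF num).
move=> G nE GM y p1y yR.
have py : restr p y = y.
  rewrite -p1y; apply/funext => i; rewrite /restr /p /=; case: (p1 i) => //=; by case: (p3 i).
have [[nu [Knu Bnu E]]|[v [v1 v2 v3]]] := separation Kcl Kcone Kconv p G y.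
  by exists nu; split => //; rewrite E.
exfalso; apply: nE; have [i hi] := netW v (conj v1 (etrans v2 (esym (expr1n _ _)))).
exists i => j; rewrite /w /mu /o.
have [nu [Knu nu1] nuE] := fKS j.
have := v3 nu Knu; rewrite nuE => v3'.
have Bnu : @eball R n 1 nu by rewrite /eball /= enormE norm2_le1// nu1.
have {v3'} h1 := v3' Bnu.
have h2 : dot v y = dot (fW i) y + dot (fun c => v c - fW i c) y by rewrite dotBl; ring.
have h3 : dot (fW i) y <= norm2 (restr p1 (fW i)) * R1.
  rewrite -p1y -dot_restr; apply: (le_trans (dot_le _ _)).
  by rewrite ler_wpM2l// norm2_ge0.
have h4 : dot (fun c => v c - fW i c) y <= e * r.
  apply: (le_trans (dot_le _ _)); rewrite ler_pM ?norm2_ge0//.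
  exact: (le_trans yR).
have h5 := bil_bound (ltW e0) (ltW M0) ler01 hi GM (norm2_le1 (unitK1 _ (fKS j))).
have h6 : bil (fW i) G (fK j) = dot v (app G (fK j)) - bil (fun c => v c - fW i c) G (fK j).
  by rewrite !bilE dotBl; ring.
rewrite h6; move: h5; rewrite ler_norml mulr1 => /andP[h5 _].
have e_r' := e_r; rewrite mulrDr in e_r'.
exact: (lower_arith2 h1 h2 h3 h4 h5 e_r').
Qed.

End events.

(** * Laws, coordinates and constants *)

Section laws.
Variables (R : realType) (d : measure_display) (T : measurableType d) (P : probability T R).

Lemma gaussian_matrix_iid (m n : nat) (G : T -> 'M[R]_(m, n)) : std_gaussian_matrix P G ->
  iid (@gauss1 R) P (fun w => (fun ij => G w ij.1 ij.2) : vec R ('I_m * 'I_n)%type).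
Proof.
move=> [mG [lawG indG]]; split=> [[i j]|B mB]; first exact: mG.
have := indG (fun i j => B (i, j)) (fun i j => mB (i, j)).
rewrite (_ : [set w | _] = (fun w => (fun ij => G w ij.1 ij.2)) @^-1` box B); last first.
  by apply/seteqP; split => w /= h; [move=> [i j]; exact: h|move=> i j; exact: (h (i, j))].
move=> ->; rewrite pair_big; apply: eq_bigr => -[i j] _ /=.
by rewrite (lawG i j _ (mB (i, j))).
Qed.

(** The expectation depends on the law of [g] only, so it can be computed on the canonical Gaussian
    space. *)
Lemma stat_dimE (n : nat) (K : set 'cV[R]_n) (g : T -> 'cV[R]_n) :
  closed K -> is_cone K -> is_convex_set K -> std_gaussian_matrix P g ->
  stat_dim P K g = Eg (fun x => projn K x ^+ 2).
Proof.
move=> Kcl Kcone Kconv sg.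
have gi := gaussian_matrix_iid sg.
have gW : iid (@gauss1 R) P (fun w => cvf (g w) : vec R 'I_n).
  have inj : injective (fun i : 'I_n => (i, 0 : 'I_1)) by move=> i j [].
  exact: (iid_reindex inj gi).
rewrite /stat_dim /Eg /Rintegral; congr fine.
rewrite (ge0_integral_gam gW).
- apply: eq_integral => w _; rewrite /projn; congr ((enorm (metric_proj K _) ^+ 2)%:E).
  by apply/matrixP => i j; rewrite !mxE ord1.
- apply/measurable_EFinP; apply: measurable_funX; apply: measurable_sublin.
  exact: projn_approx.
- by move=> x; rewrite lee_fin sqr_ge0.
Qed.

Lemma mulmx_app (m n : nat) (A : 'M[R]_(m, n)) (mu : 'cV[R]_n) i :
  (A *m mu) i 0 = app (fun ij => A ij.1 ij.2) (cvf mu) i.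
Proof. by rewrite mxE. Qed.

(** The logarithm is taken of a number at least [e], hence is at least 1. *)
Lemma scrL_le (x : R) : 0 <= x -> scrL x <= x.
Proof.
move=> x0; rewrite /scrL; have h : 1 <= ln (Num.max (expR 1) x^-1) :> R.
  by rewrite -[leLHS]expRK ler_ln ?posrE ?expR_gt0 ?lt_max ?expR_gt0// le_max lexx.
rewrite ler_pdivrMr; last exact: lt_le_trans h.
by rewrite ler_peMr.
Qed.

End laws.

Section coordinates.
Variables (R : realType) (m k l : nat).
Hypothesis kl : (k <= l)%N.
Hypothesis lm : (l <= m)%N.

Let p1 : pred 'I_m := fun i => (i < k)%N.
Let p3 : pred 'I_m := fun i => (l <= i)%N.

Lemma card_first : #|p1| = k.
Proof.
have km := leq_trans kl lm.
by rewrite -sum1_card -(big_ord_widen _ (fun=> 1%N) km) sum1_card card_ord.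
Qed.

Lemma card_last : #|p3|%:R = m%:R - l%:R :> R.
Proof.
have h : #|[pred i : 'I_m | (i < l)%N]| = l.
  by rewrite -sum1_card -(big_ord_widen _ (fun=> 1%N) lm) sum1_card card_ord.
have := cardC [pred i : 'I_m | (i < l)%N]; rewrite h card_ord.
have -> : #|[predC [pred i : 'I_m | (i < l)%N]]| = #|p3|.
  by apply: eq_card => i; rewrite !inE -leqNgt.
by move=> /(congr1 (fun j => j%:R : R)) <-; rewrite natrD addrC addKr.
Qed.

Lemma coord_nat_ord n (x : 'cV[R]_n) (i : 'I_n) : coord_nat x i = x i 0.
Proof. by rewrite /coord_nat valK. Qed.

Lemma coord_nat_out n (x : 'cV[R]_n) i : (n <= i)%N -> coord_nat x i = 0.
Proof. by move=> h; rewrite /coord_nat insubF// ltnNge h. Qed.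

Lemma enorm_proj_first (x : 'cV[R]_m) : enorm (@proj_first R m k x) = norm2 (restr p1 (cvf x)).
Proof.
have km := leq_trans kl lm; congr Num.sqrt.
under eq_bigr do rewrite mxE.
rewrite (big_ord_widen _ (fun i => coord_nat x i ^+ 2) km) /dot big_mkcond /=.
apply: eq_bigr => i _; rewrite /restr /p1; case: (i < k)%N; last by rewrite mul0r.
by rewrite coord_nat_ord expr2.
Qed.

(** Padding by zeros: [coord_nat] has default value 0 beyond the length of [y]. *)
Definition extend (y : 'cV[R]_k) (i : 'I_m) : R := coord_nat y i.

Lemma extend_restr y : restr p1 (extend y) = extend y.
Proof.
apply/funext => i; rewrite /restr /p1 /extend; case: (ltnP i k) => // h.
by rewrite coord_nat_out.
Qed.

Lemma proj_first_extend (y : 'cV[R]_k) (x : 'cV[R]_m) : restr p1 (cvf x) = extend y -> @proj_first R m k x = y.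
Proof.
move=> h; apply/matrixP => i j; rewrite ord1 mxE.
have im : (i < m)%N := leq_trans (ltn_ord i) (leq_trans kl lm).
have := congr1 (fun f => f (Ordinal im)) h; rewrite /restr /p1 /extend /= ltn_ord coord_nat_ord => <-.
exact: (coord_nat_ord x (Ordinal im)).
Qed.

Lemma norm2_extend y : norm2 (extend y) = enorm y.
Proof.
have E : cvf (\col_i extend y i) = extend y by apply/funext => i; rewrite /cvf mxE.
have Ey : restr p1 (cvf (\col_i extend y i)) = extend y by rewrite E extend_restr.
by rewrite -[in RHS](proj_first_extend Ey) enorm_proj_first Ey.
Qed.

End coordinates.

(** A single denominator above the four quantities that the mesh multiplies, so that [e = eta / den]
    meets all requirements. *)
Lemma mesh_bounds (R : realFieldType) (M r sq sn t : R) (den := 3 * M + r + sq + sn + 13 + t) :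
  0 < M -> 0 < r -> 0 <= sq -> 0 <= sn -> 0 < t ->
  [/\ 0 < den, sq + 13 + t <= den, sn + 13 + t <= den, 2 * M <= den & M + r <= den].
Proof. by rewrite /den => *; split; lra. Qed.

Lemma le_mul_sqr_succ (R : realFieldType) (y a : R) : 0 <= y -> 0 <= a -> y * a <= a * (y + 1) ^+ 2.
Proof. by move=> y0 a0; rewrite mulrC ler_wpM2l//; nra. Qed.

(** * Choice of the numerical constants *)

Section numerics.
Variables (R : realType) (tau delta q eps k : R).
Hypothesis tau01 : 0 < tau < 1 / 2.
Hypothesis eps01 : 0 < eps < 1 / 2.
Hypothesis delta0 : 0 < delta.
Hypothesis q0 : 0 <= q.
Hypothesis qd : q <= (1 - tau) * delta.
Hypothesis k1 : 1 <= k.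
Hypothesis kc : k <= (tau / 1024) ^+ 2 * (eps ^+ 2 * delta).

Let r := Num.sqrt (delta - q).
Let u := tau * (eps * Num.sqrt delta).
Let t := u / 16.
Let eta := u / 64.

Lemma u_sq : u ^+ 2 = tau ^+ 2 * (eps ^+ 2 * delta).
Proof. by rewrite !exprMn sqr_sqrtr// ltW. Qed.

Lemma u_ge0 : 0 <= u.
Proof.
by case/andP: tau01 => t1 _; case/andP: eps01 => e1 _; rewrite !mulr_ge0 ?sqrtr_ge0 ?ltW.
Qed.

Lemma k_le_u : k <= (u / 1024) ^+ 2.
Proof.
by apply: (le_trans kc); rewrite [(u / _) ^+ 2]expr_div_n u_sq expr_div_n mulrAC.
Qed.

(** Because [1 <= k <= (u / 1024)^2]; the additive constant 39 thus becomes a small fraction of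
    [u]. *)
Lemma u_ge : 1024 <= u.
Proof.
have := le_trans k1 k_le_u; have := u_ge0; nra.
Qed.

Lemma sqrt_k_le : Num.sqrt k <= u / 1024.
Proof.
have h : 0 <= u / 1024 := divr_ge0 u_ge0 (ler0n R 1024).
by rewrite -[leRHS](ger0_norm h) -sqrtr_sqr; exact: (ler_wsqrtr k_le_u).
Qed.

Lemma sum_small : 4 * eta + Num.sqrt k + 39 + 3 * t <= u / 2.
Proof.
have := sqrt_k_le; have := u_ge; rewrite /eta /t; lra.
Qed.

Lemma r2_ge : tau * delta <= delta - q.
Proof. by move: qd; rewrite mulrBl mul1r; lra. Qed.

Lemma r_gt0 : 0 < r.
Proof.
rewrite sqrtr_gt0; apply: lt_le_trans r2_ge.
by case/andP: tau01 => t1 _; rewrite mulr_gt0.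
Qed.

Lemma r_sq : r ^+ 2 = delta - q.
Proof. by rewrite sqr_sqrtr// ltW// -sqrtr_gt0 r_gt0. Qed.

(** The right side equals [eps (delta - q) / sqrt delta], which is at least [u] because
    [delta - q >= tau delta]. *)
Lemma upper_numeric : Num.sqrt k + 39 + 3 * t + 4 * eta <= r / Num.sqrt delta * (eps * r).
Proof.
have s0 : 0 < Num.sqrt delta by rewrite sqrtr_gt0.
have e0 : 0 <= eps by case/andP: eps01 => e1 _; exact: ltW.
apply: (@le_trans _ _ u); first by have := sum_small; have := u_ge0; lra.
have -> : r / Num.sqrt delta * (eps * r) = eps * r ^+ 2 / Num.sqrt delta by ring.
rewrite r_sq ler_pdivlMr//.
have -> : u * Num.sqrt delta = eps * (tau * delta).
  by rewrite -{2}(sqr_sqrtr (ltW delta0)) /u; ring.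
by rewrite ler_wpM2l// r2_ge.
Qed.

(** Shrinking [r] by [1 - eps] lowers [q + r^2 = delta] by at least
    [eps r^2 >= eps tau delta = u sqrt delta]. What is left is at most [(sqrt delta - u / 2)^2], and
    [u / 2] pays for all errors. *)
Lemma lower_numeric :
  Num.sqrt (q + ((1 - eps) * r) ^+ 2) + 4 * eta + Num.sqrt k + 39 + 3 * t <= Num.sqrt delta.
Proof.
have s0 := sqrtr_ge0 delta.
have [t1 t2] := andP tau01; have [e1 e2] := andP eps01.
suff : Num.sqrt (q + ((1 - eps) * r) ^+ 2) <= Num.sqrt delta - u / 2.
  by have := sum_small; lra.
have us : u <= Num.sqrt delta.
  by rewrite /u mulrA ler_piMl//; nra.
rewrite -[leRHS]ger0_norm; last by have := u_ge0; lra.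
rewrite -sqrtr_sqr ler_wsqrtr// exprMn r_sq.
have dE : Num.sqrt delta ^+ 2 = delta by rewrite sqr_sqrtr// ltW.
have uE : u * Num.sqrt delta = tau * eps * delta.
  by rewrite -{2}dE /u; ring.
have -> : (Num.sqrt delta - u / 2) ^+ 2 = Num.sqrt delta ^+ 2 - u * Num.sqrt delta + (u / 2) ^+ 2 by field.
rewrite uE dE; have -> : tau * eps * delta = eps * (tau * delta) by ring.
have td : 0 <= tau * delta by rewrite mulr_ge0// ltW.
have h1 : 0 <= eps * (delta - q - tau * delta) by rewrite mulr_ge0 ?(ltW e1)// subr_ge0 r2_ge.
have h2 : 0 <= eps * (1 - eps) * (delta - q).
  by rewrite mulr_ge0 ?(le_trans td r2_ge)// mulr_ge0 ?(ltW e1)// subr_ge0; lra.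
have := sqr_ge0 (u / 2); move: h1 h2; lra.
Qed.

(** [t^2 / 8 = u^2 / 2048] is far larger than [(u / 1024)^2]; for [u >= 1024] the difference is at
    least 511, and its exponential exceeds 193. *)
Lemma exp_numeric : 193 * expR (- (t ^+ 2 / 8)) <= expR (- ((tau / 1024) ^+ 2 * eps ^+ 2 * delta)).
Proof.
have := u_ge => h.
have -> : (tau / 1024) ^+ 2 * eps ^+ 2 * delta = (u / 1024) ^+ 2.
  by rewrite [RHS]expr_div_n u_sq expr_div_n; ring.
have -> : - ((u / 1024) ^+ 2) = (u ^+ 2 / 2048 - (u / 1024) ^+ 2) + - (t ^+ 2 / 8).
  by rewrite /t; field.
rewrite expRD ler_wpM2r ?expR_ge0//; apply: le_trans (expR_ge1Dx _); nra.
Qed.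

End numerics.

Theorem theorem1p6 (R : realType) (tau : R) (htau : 0 < tau < 1 / 2) :
  exists c : R, 0 < c /\
  forall (d : measure_display) (T : measurableType d) (P : probability T R)
    (n m l : nat) (K : set 'cV[R]_n) (G : T -> 'M[R]_(m, n)) (g : T -> 'cV[R]_n),
    nontrivial_closed_convex_cone K ->
    std_gaussian_matrix P G ->
    std_gaussian_matrix P g ->
    let delta := stat_dim P K g in
    Num.max 1 (Num.max 0 (m%:R - delta)) <= l%:R -> (l <= m)%N ->
    m%:R - l%:R <= (1 - tau) * delta ->
    forall (eps : R), 0 < eps < 1 / 2 ->
    forall k : nat, (1 <= k)%N -> (k <= l)%N -> k%:R <= c * scrL (eps ^+ 2 * delta) ->
    exists A : set T, measurable A /\
      (A `<=` [set w |
         @eball R k ((1 - eps) * Num.sqrt (delta - m%:R + l%:R))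
           `<=` @proj_first R m k @` (@coordL R m l `&` GKn (G w) K) /\
         @proj_first R m k @` (@coordL R m l `&` GKn (G w) K)
           `<=` @eball R k ((1 + eps) * Num.sqrt (delta - m%:R + l%:R))]) /\
      (P A >= (1 - expR (- (c * eps ^+ 2 * delta)))%:E)%E.
Proof.
exists ((tau / 1024) ^+ 2); have [tau0 tau1] := andP htau.
have n1024 : 0 < 1024 :> R by rewrite ltr0n.
split; first exact: exprn_gt0 (divr_gt0 tau0 n1024).
move=> d T P n m l K G g [Kcl [Kcone [Kconv Kn0]]] sG sg delta _ lm hq eps eps01 k k1 kl hk.
have dE : delta = Eg (fun x => projn K x ^+ 2) by exact: stat_dimE.
have [eps0 eps1] := andP eps01.
set c := (tau / 1024) ^+ 2 in hk *.
have c0 : 0 <= c by exact: sqr_ge0.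
have x0 : 0 <= eps ^+ 2 * delta.
  rewrite mulr_ge0 ?sqr_ge0// dE -(Eg_cst 'I_n 0); apply: le_Eg; first exact: itg_cst.
    exact: (itg_sublin_sq (projn_approx Kcl Kcone Kconv)).
  by move=> x; exact: sqr_ge0.
have kc : k%:R <= c * (eps ^+ 2 * delta).
  by apply: (le_trans hk); exact: (ler_wpM2l c0 (scrL_le x0)).
have k1' : 1 <= k%:R :> R by rewrite ler1n.
(* Positivity is forced by [1 <= k <= c eps^2 delta]. *)
have delta0 : 0 < delta.
  have : 0 < eps ^+ 2 * delta.
    rewrite lt_def x0 andbT; apply/negP => /eqP x00; move: kc; rewrite x00 mulr0 => kc.
    by have := le_trans k1' kc; rewrite ler10.
  by rewrite pmulr_rgt0// exprn_gt0.
pose p1 : pred 'I_m := fun i => (i < k)%N.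
pose p3 : pred 'I_m := fun i => (l <= i)%N.
pose q : R := m%:R - l%:R.
have q0 : 0 <= q by rewrite subr_ge0 ler_nat.
have p1E : #|p1|%:R = k%:R :> R by rewrite (card_first kl lm).
have p3E : #|p3|%:R = q by rewrite (card_last R lm).
have p13 i : p1 i -> p3 i -> False.
  by rewrite /p1 /p3 => h1 h2; have := leq_trans h1 (leq_trans kl h2); rewrite ltnn.
have p1n0 : exists i, p1 i by exists (Ordinal (leq_trans k1 (leq_trans kl lm))).
have Kn0' : exists2 mu0, K mu0 & mu0 != 0.
  apply: contrapT => h; apply: Kn0; apply/seteqP; split => [x Kx /=|x /= ->]; last by have [] := Kcone.
  by apply/eqP; rewrite -[_ == _]negbK; apply/negP => x_n0; apply: h; exists x.
pose r := Num.sqrt (delta - q).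
have -> : Num.sqrt (delta - m%:R + l%:R) = r by congr Num.sqrt; rewrite /q; ring.
pose u := tau * (eps * Num.sqrt delta).
pose t := u / 16; pose eta := u / 64.
have u1 : 1024 <= u := u_ge htau eps01 delta0 k1' kc.
have up : 0 < u by exact: lt_le_trans n1024 u1.
have t0 : 0 < t by rewrite divr_gt0.
have eta0 : 0 < eta by rewrite divr_gt0.
have r0 : 0 < r := r_gt0 htau delta0 hq.
have rE : r ^+ 2 = delta - q := r_sq htau delta0 hq.
have upnum : Num.sqrt k%:R + 39 + 3 * t + 4 * eta <= r / Num.sqrt delta * (eps * r).
  exact: upper_numeric htau eps01 delta0 hq k1' kc.
have lonum : Num.sqrt (q + ((1 - eps) * r) ^+ 2) + 4 * eta + Num.sqrt k%:R + 39 + 3 * t <= Num.sqrt delta.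
  exact: lower_numeric htau eps01 delta0 hq k1' kc.
have expnum : 193 * expR (- (t ^+ 2 / 8)) <= expR (- (c * eps ^+ 2 * delta)).
  exact: exp_numeric htau eps01 delta0 k1' kc.
clearbody r t eta.
pose tail := expR (- (t ^+ 2 / 8)).
have tail0 : 0 < tail by exact: expR_gt0.
pose N : R := #|{: 'I_m * 'I_n}|%:R; have N0 : 0 <= N by exact: ler0n.
(* [E |G|^2 = N] and [N / M^2 <= tail], so the Frobenius bound costs one more tail. *)
pose M := N / tail + 1.
have NT0 : 0 <= N / tail by rewrite divr_ge0// ltW.
have M0 : 0 < M by rewrite ltr_wpDl.
have MN : N / M ^+ 2 <= tail.
  rewrite ler_pdivrMr ?exprn_gt0// -{1}(divfK (lt0r_neq0 tail0) N).
  exact: (le_mul_sqr_succ NT0 (ltW tail0)).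
have [den0 den_q den_n den_M den_r] := mesh_bounds M0 r0 (sqrtr_ge0 q) (sqrtr_ge0 (n%:R : R)) t0.
pose den := 3 * M + r + Num.sqrt q + Num.sqrt n%:R + 13 + t.
pose e := eta / den; have e0 : 0 < e by rewrite divr_gt0.
have e_le y : y <= den -> e * y <= eta.
  by move=> yd; rewrite /e mulrAC ler_pdivrMr// ler_wpM2l// ltW.
have e_q := e_le _ den_q; have e_n := e_le _ den_n.
have e_M := e_le _ den_M; have e_r := e_le _ den_r.
have eps01' : 0 < eps < 1.
  by rewrite eps0 (lt_trans eps1)// ltr_pdivrMr// mul1r ltr1n.
rewrite -p3E in e_q rE lonum. rewrite -p1E in upnum lonum.
have delta0' := delta0.
rewrite dE in delta0' rE upnum lonum.
have [E1 [mE1 PE1] hE1] := upper_event Kcl Kcone Kconv Kn0' p13 p1n0 t0 delta0' r0 rE eta0 M0 e0 e_q e_M eps01' upnum.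
have [E2 [mE2 PE2] hE2] := lower_event Kcl Kcone Kconv Kn0' p13 p1n0 t0 delta0' r0 eta0 M0 e0 e_n e_r eps01' lonum.
pose E3 := [set H : vec R ('I_m * 'I_n)%type | M ^+ 2 <= dot H H].
have mE3 : measurable E3 by exact: (measurable_ge _ (@measurable_dotxx R _)).
have PE3 : Pg E3 <= tail by apply: le_trans MN; exact: Pg_norm2_ge.
pose E := E1 `|` (E2 `|` E3).
have mE23 : measurable (E2 `|` E3) by exact: measurableU.
have mE : measurable E by exact: measurableU.
have PE : Pg E <= expR (- (c * eps ^+ 2 * delta)).
  apply: le_trans expnum; rewrite -/tail.
  have h1 : Pg E <= Pg E1 + Pg (E2 `|` E3) by apply: Pg_le_U.
  have h2 : Pg (E2 `|` E3) <= Pg E2 + Pg E3 by apply: Pg_le_U.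
  (* Each min-max event costs 4 from Gordon times 24 from six deviations of [4 tail] each; the
     Frobenius bound adds one. *)
  have -> : 193 * tail = 96 * tail + (96 * tail + tail) by ring.
  by apply: (le_trans h1); apply: lerD => //; apply: (le_trans h2); exact: lerD.
pose W w : vec R ('I_m * 'I_n)%type := fun ij => G w ij.1 ij.2.
have gW : iid (@gauss1 R) P W := gaussian_matrix_iid sG.
have mW : measurable_fun setT W := iid_measurable gW.
have mA : measurable (W @^-1` E) by rewrite -[X in measurable X]setTI; exact: mW.
exists (~` (W @^-1` E)); split; first exact: measurableC.
split; last first.
  rewrite probability_setC// (gam_law gW mE) -Pg_fin// -EFinB lee_fin.
  by rewrite lerD2l lerN2.
move=> w /= nE.
have n1 : ~ E1 (W w) by move=> h; apply: nE; left.
have n2 : ~ E2 (W w) by move=> h; apply: nE; right; left.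
have nM : norm2 (W w) <= M.
  rewrite -ler_sqr ?nnegrE ?norm2_ge0 ?(ltW M0)// norm2_sq leNgt; apply/negP => h.
  by apply: nE; right; right; exact: ltW.
split=> [y /=|_ [x [Lx [mu [Kmu Bmu] muE]] <-]].
- move=> yr; have := hE2 _ n2 nM (extend y); rewrite extend_restr (norm2_extend kl lm).
  move=> /(_ erefl yr)[mu [Kmu Bmu muE]].
  (* Rows between [k] and [l] stay free. On the last rows [extend y] is 0 because [k <= l], which
     places [G mu] in [L]. *)
  have muE' i : restr [pred i | p1 i || p3 i] (cvf (G w *m mu)) i = extend y i.
    by rewrite -muE /restr; case: ifP => // _; rewrite -mulmx_app.
  exists (G w *m mu); last first.
    apply: (proj_first_extend kl lm); apply/funext => i; rewrite -muE' /restr /= -/(p1 i) -/(p3 i).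
    by case: (boolP (p1 i)) => //= h; case: (boolP (p3 i)) => // h3; have := muE' i; rewrite /restr /= h3 orbT /extend coord_nat_out// leqNgt.
  split; last by exists mu.
  move=> i li; have := muE' i; rewrite /restr /= /p3 li orbT /cvf => ->.
  by rewrite /extend coord_nat_out// (leq_trans kl li).
- rewrite /eball /= (enorm_proj_first kl lm) -muE.
  have -> : cvf (G w *m mu) = app (W w) (cvf mu) by apply/funext => i; rewrite /cvf mulmx_app.
  apply: (hE1 _ n1 nM) => // i p3i; rewrite -mulmx_app muE; exact: Lx.
Qed.
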